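(* Let $\varepsilon\in(0,1)$. Suppose that the terminal-boundary value problem $$\begin{cases}\dfrac{\partial u}{\partial t}-(-\Delta)^su+b(t,\mathrm x)\cdot\nabla u+c(t,\mathrm x)u+f(t,\mathrm x)=0, & (t,\mathrm x)\in[0,T)\times\mathbb D,\\ u(T,\mathrm x)=g(\mathrm x), & \mathrm x\in\mathbb D,\\ u(t,\mathrm x)=\chi(t,\mathrm x), & (t,\mathrm x)\in[0,T]\times(\mathbb R^n\setminus\mathbb D),\end{cases}$$ has a unique solution $u$, that $u\in C^{1,\beta}([0,T]\times\mathbb R^n)$ with $\beta\in(\max(2s,1),2)$, and that the functions $b_i$ $(i=1,\dots,n)$, $c$, $f$ and their first derivatives with respect to $t$ and $\mathrm x$ are uniformly bounded. Let $\widetilde{\mathrm X},\widetilde Y,\widetilde Z,\widetilde\tau_{t,\mathrm x}$ be given by the jump-adapted Euler scheme with truncation parameter $\varepsilon$ started at $(t,\mathrm x)$, as described in the context. Then $$\Big|\mathbf E\Big[u\big(T\wedge\widetilde\tau_{t,\mathrm x},\widetilde{\mathrm X}_{T\wedge\widetilde\tau_{t,\mathrm x}}\big)\widetilde Y_{T\wedge\widetilde\tau_{t,\mathrm x}}+\widetilde Z_{T\wedge\widetilde\tau_{t,\mathrm x}}\Big]-u(t,\mathrm x)\Big|\le C_1\varepsilon^{2s}+C_2\varepsilon^{\beta-2s},$$ where $C_1$ and $C_2$ are constants independent of $t$ and $\mathrm x$ (and of $\varepsilon$).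
   Context: Setting: $s\in(0,1)$, $T>0$, $n\ge3$, $\mathbb D\subset\mathbb R^n$ is a bounded region (open set); $b=(b_1,\dots,b_n)$, $c$, $f$ are given functions on $[0,T]\times\mathbb R^n$, and $g,\chi$ are given real data. Fractional Laplacian: $(-\Delta)^su(t,\mathrm x)=C(n,s)\,\mathrm{P.V.}\int_{\mathbb R^n}\frac{u(t,\mathrm x)-u(t,\mathrm y)}{|\mathrm x-\mathrm y|^{n+2s}}\,\mathrm d\mathrm y$, with $C(n,s)=\frac{s2^{2s}\Gamma(\frac n2+s)}{\pi^{n/2}\Gamma(1-s)}$. Function spaces: for $\beta=\lfloor\beta\rfloor+\{\beta\}^+>0$ with $\lfloor\beta\rfloor\in\{0,1,2,\dots\}$ and $\{\beta\}^+\in[0,1)$, $C^\beta([0,T]\times\mathbb R^n)$ is the space of measurable functions $u(t,\mathrm x)$ with finite norm $$|u|_\beta=\sum_{|\gamma|\le\lfloor\beta\rfloor}\sup_{(t,\mathrm x)}|\partial^\gamma_{\mathrm x}u(t,\mathrm x)|+\sup_{|\gamma|=\lfloor\beta\rfloor,\;t,\mathrm x,\mathrm h\ne0}\frac{|\partial^\gamma_{\mathrm x}u(t,\mathrm x+\mathrm h)-\partial^\gamma_{\mathrm x}u(t,\mathrm x)|}{|\mathrm h|^{\{\beta\}^+}}.$$ $C^{1,\beta}([0,T]\times\mathbb R^n)$ is the space of $u\in C^\beta([0,T]\times\mathbb R^n)$ whose first derivative in $t$ is bounded and continuous on $[0,T]$ for every $\mathrm x\in\mathbb R^n$. Driving process: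 on a complete filtered probability space satisfying the usual conditions, $N(\mathrm d\eta,\mathrm d\mathrm y)$ is a Poisson random measure on $[0,T]\times(\mathbb R^n\setminus\{0\})$ with intensity $\nu(\mathrm d\mathrm y)\,\mathrm d\eta$, $\nu(\mathrm d\mathrm y)=C(n,s)|\mathrm y|^{-n-2s}\mathrm d\mathrm y$, and $\widetilde N=N-\nu(\mathrm d\mathrm y)\mathrm d\eta$. Put $$L^\varepsilon_t=\int_0^t\int_{\varepsilon<|\mathrm y|<1}\mathrm y\,\widetilde N(\mathrm d\eta,\mathrm d\mathrm y)+\int_0^t\int_{|\mathrm y|\ge1}\mathrm y\,N(\mathrm d\eta,\mathrm d\mathrm y),\qquad \Delta L^\varepsilon_r=L^\varepsilon_r-L^\varepsilon_{r-}.$$ (By symmetry of $\nu$ the compensator vanishes, so $L^\varepsilon$ is a compound Poisson process, the sum of the jumps of size larger than $\varepsilon$.) Jump-adapted Euler scheme started at $(t,\mathrm x)$, $t\in[0,T]$, $\mathrm x\in\mathbb D$: set $\tau_0=t$, $\widetilde{\mathrm X}_t=\mathrm x$, $\widetilde Y_t=1$, $\widetilde Z_t=0$, and $$\tau_{i+1}=\inf\{r>\tau_i:\Delta L^\varepsilon_r\ne0\}\wedge\widetilde\tau_{t,\mathrm x}\wedge T,\qquad \widetilde\tau_{t,\mathrm x}=\inf\{r\ge t:\widetilde{\mathrm X}_r\notin\mathbb D\}.$$ For $r\in(\tau_i,\tau_{i+1})$, $$\widetilde{\mathrm X}_r=\widetilde{\mathrm X}_{\tau_i}+b(\tau_i,\widetilde{\mathrm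 X}_{\tau_i})(r-\tau_i),\quad \widetilde Y_r=\widetilde Y_{\tau_i}+c(\tau_i,\widetilde{\mathrm X}_{\tau_i})\widetilde Y_{\tau_i}(r-\tau_i),\quad \widetilde Z_r=\widetilde Z_{\tau_i}+f(\tau_i,\widetilde{\mathrm X}_{\tau_i})\widetilde Y_{\tau_i}(r-\tau_i),$$ and at $r=\tau_{i+1}$, $\widetilde{\mathrm X}_{\tau_{i+1}}=\widetilde{\mathrm X}_{\tau_{i+1}-}+\Delta L^\varepsilon_{\tau_{i+1}}$, while $\widetilde Y_{\tau_{i+1}},\widetilde Z_{\tau_{i+1}}$ are given by the same formulas with $r=\tau_{i+1}$. The recursion stops when $\tau_i=T\wedge\widetilde\tau_{t,\mathrm x}$. *)

(* Defs.v *)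
From HB Require Import structures.
From mathcomp Require Import all_boot all_order all_algebra.
From mathcomp Require Import all_classical all_reals all_analysis.
From mathcomp Require Import measurable_realfun.

Set Implicit Arguments.
Unset Strict Implicit.
Unset Printing Implicit Defensive.

Import Order.TTheory GRing.Theory Num.Theory.
Import numFieldNormedType.Exports.

Local Open Scope classical_set_scope.
Local Open Scope ring_scope.

(* The product sigma-algebra on R^n, generated by the coordinates as for       *)
(* n.-tuple; it is the Borel sigma-algebra.                                    *)
Section measurable_rV.
Context {R : realType} {n : nat}.

Definition rV_coord (i : 'I_n) (x : 'rV[R]_n) : R := x ord0 i.

Let rV_set0 : g_sigma_preimage rV_coord set0.
Proof. exact: sigma_algebra0. Qed.

Let rV_setC A : g_sigma_preimage rV_coord A -> g_sigma_preimage rV_coord (~` A).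
Proof. exact: sigma_algebraC. Qed.

Let rV_bigcup (F : (set 'rV[R]_n)^nat) :
  (forall i, g_sigma_preimage rV_coord (F i)) ->
  g_sigma_preimage rV_coord (\bigcup_i (F i)).
Proof. exact: sigma_algebra_bigcup. Qed.

HB.instance Definition _ :=
  @isMeasurable.Build (measure_tuple_display default_measure_display)
    'rV[R]_n (g_sigma_preimage rV_coord) rV_set0 rV_setC rV_bigcup.

Lemma measurable_rV_coord (i : 'I_n) : measurable_fun setT (rV_coord i).
Proof.
move=> _ Y mY; apply: sub_sigma_algebra => /=.
rewrite -bigcup_seq/=; exists i => /=; first by rewrite mem_index_enum.
by exists Y.
Qed.

Lemma measurable_fun_rV d (S : measurableType d) (f : S -> 'rV[R]_n) :
  (forall i, measurable_fun setT (fun s => f s ord0 i)) ->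
  measurable_fun setT f.
Proof.
move=> mf; apply: (@measurability _ _ _ _ _ _
  (\big[setU/set0]_(i < n) preimage_set_system setT (rV_coord i) measurable)).
  by [].
move=> _ [C + <-]; rewrite -bigcup_seq/= => -[i _ [B mB <-]].
rewrite setTI [X in _ @^-1` X]setTI -[X in measurable X]setTI.
exact: (mf i measurableT B mB).
Qed.

End measurable_rV.

Section lebesgue_rV.
Context {R : realType}.

Definition rV_cons n (z : R * 'rV[R]_n) : 'rV[R]_n.+1 :=
  \row_(i < n.+1) oapp (fun j => z.2 ord0 j) z.1 (unlift ord0 i).

Definition rV_uncons n (x : 'rV[R]_n.+1) : R * 'rV[R]_n :=
  (x ord0 ord0, \row_(j < n) x ord0 (lift ord0 j)).

Lemma rV_consK n : cancel (@rV_cons n) (@rV_uncons n).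
Proof.
move=> -[a v]; rewrite /rV_uncons mxE unlift_none/=; congr pair.
by apply/rowP => j; rewrite !mxE liftK.
Qed.

Lemma measurable_rV_cons n : measurable_fun setT (@rV_cons n).
Proof.
apply: measurable_fun_rV => i.
case: (unliftP ord0 i) => [j ->|->].
  apply: (@eq_measurable_fun _ _ _ _ _ (rV_coord j \o snd)).
    by move=> z _; rewrite mxE liftK.
  apply: measurableT_comp => //; exact: measurable_rV_coord.
apply: (@eq_measurable_fun _ _ _ _ _ fst).
  by move=> z _; rewrite mxE unlift_none.
exact: measurable_fst.
Qed.

Lemma measurable_rV_uncons n : measurable_fun setT (@rV_uncons n).
Proof.
apply: measurable_fun_pair; first exact: measurable_rV_coord.
apply: measurable_fun_rV => i.
apply: (@eq_measurable_fun _ _ _ _ _ (rV_coord (lift ord0 i))).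
  by move=> z _; rewrite mxE.
exact: measurable_rV_coord.
Qed.

Section rV_cons_measure.
Variables (n : nat) (mu : {sigma_finite_measure set 'rV[R]_n -> \bar R}).

Definition rV_cons_measure : set 'rV[R]_n.+1 -> \bar R :=
  pushforward (lebesgue_measure \x mu)%E (@rV_cons n).

Let m0 : rV_cons_measure set0 = 0%E.
Proof. by rewrite /rV_cons_measure /pushforward preimage_set0 measure0. Qed.

Let m_ge0 A : (0 <= rV_cons_measure A)%E.
Proof. by rewrite /rV_cons_measure /pushforward measure_ge0. Qed.

Let m_sigma_additive : semi_sigma_additive rV_cons_measure.
Proof.
apply: measure_semi_sigma_additive; exact: measurable_rV_cons.
Qed.

HB.instance Definition _ := isMeasure.Build _ _ _ rV_cons_measure
  m0 m_ge0 m_sigma_additive.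

Let m_sigma_finite : sigma_finite setT rV_cons_measure.
Proof.
have /sigma_finiteP[F [FT ndF Foo]] := sigma_finiteT (@lebesgue_measure R).
have /sigma_finiteP[G [GT ndG Goo]] := sigma_finiteT mu.
exists (fun k => @rV_uncons n @^-1` (F k `*` G k)).
  rewrite -preimage_bigcup -[LHS](preimage_setT (@rV_uncons n)).
  congr (_ @^-1` _); rewrite -setXTT FT GT predeqE => -[x y]; split.
    move=> [/= [k _ Fkx] [l _ Gly]]; exists (maxn k l) => //; split.
    - by move: x Fkx; exact/subsetPset/ndF/leq_maxl.
    - by move: y Gly; exact/subsetPset/ndG/leq_maxr.
  by move=> [k _ []/= ? ?]; split; exists k.
move=> k; have [mF Fkoo] := Foo k; have [mG Gkoo] := Goo k; split.
  by rewrite -[X in measurable X]setTI; apply: measurable_rV_uncons => //;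
    exact: measurableX.
rewrite /rV_cons_measure /pushforward -comp_preimage.
rewrite (_ : _ \o _ = id) ?preimage_id; last first.
  by apply/funext => z /=; rewrite rV_consK.
by rewrite product_measure1E// lte_mul_pinfty// ge0_fin_numE.
Qed.

HB.instance Definition _ := Measure_isSigmaFinite.Build _ _ _ rV_cons_measure
  m_sigma_finite.

End rV_cons_measure.

(* Lebesgue measure on R^n, the n-fold product of the one on R.               *)
Fixpoint lebesgue_rV n : {sigma_finite_measure set 'rV[R]_n -> \bar R} :=
  if n is m.+1 then rV_cons_measure (lebesgue_rV m) else dirac (0 : 'rV[R]_0).

End lebesgue_rV.

Section fractional_laplacian.
Context {R : realType} {n : nat}.
Implicit Types (v : 'rV[R]_n -> R) (x y : 'rV[R]_n) (s a : R).

(* The norm `|x| of the library on 'rV[R]_n is the maximum norm.              *)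
Definition enorm x : R := Num.sqrt (\sum_(i < n) x ord0 i ^+ 2).

Definition Gamma a : R :=
  \int[lebesgue_measure]_(r in `]0, +oo[%classic) (r `^ (a - 1) * expR (- r)).

Definition frac_const s : R :=
  (s * 2 `^ (2 * s) * Gamma (n%:R / 2 + s)) /
  (pi `^ (n%:R / 2) * Gamma (1 - s)).

Definition pv_integral s v x (delta : R) : R :=
  \int[lebesgue_rV n]_(y in [set y | delta < enorm (x - y)])
    ((v x - v y) / enorm (x - y) `^ (n%:R + 2 * s)).

Definition frac_laplacian s v x : R :=
  frac_const s * lim (pv_integral s v x delta @[delta --> 0^'+]).

End fractional_laplacian.

Section function_spaces.
Context {R : realType} {n : nat}.
Implicit Types (T t beta : R) (x : 'rV[R]_n) (v : 'rV[R]_n -> R)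
  (u : R -> 'rV[R]_n -> R).

Definition partial (i : 'I_n) v x : R := 'D_(delta_mx ord0 i) v x.

Definition multi_index k := {ffun 'I_n -> 'I_k.+1}.

Definition order k (gamma : multi_index k) : nat := (\sum_(i < n) gamma i)%N.

Definition mpartial k (gamma : multi_index k) v : 'rV[R]_n -> R :=
  foldr (fun i w => iter (gamma i) (partial i) w) v (enum 'I_n).

(* Derivative in time relative to [0, T]: one-sided at 0 and at T.            *)
Definition dt_quotient u t x (r : R) : R := (u r x - u t x) / (r - t).

Definition dt_filter T t : set_system R :=
  within [set r | 0 <= r <= T /\ r != t] (nbhs t).

Definition dt_derivable T u t x : Prop :=
  cvg (dt_quotient u t x @ dt_filter T t).

Definition dt T u t x : R := lim (dt_quotient u t x @ dt_filter T t).

Definition sup_norm_mpartial T u k (gamma : multi_index k) : \bar R :=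
  ereal_sup [set e | exists t x, 0 <= t <= T /\
                       e = (`|mpartial gamma (u t) x|)%:E].

Definition holder_seminorm T u k (a : R) : \bar R :=
  ereal_sup [set e | exists (gamma : multi_index k) t x h,
    [/\ order gamma = k, 0 <= t <= T, h != 0 &
     e = (`|mpartial gamma (u t) (x + h) - mpartial gamma (u t) x|
          / enorm h `^ a)%:E]].

(* For beta >= 0, Num.truncn beta is the integer part of beta.                *)
Definition holder_norm T beta u : \bar R :=
  let k := Num.truncn beta in
  (\sum_(gamma : multi_index k | (order gamma <= k)%N)
     sup_norm_mpartial T u gamma
   + holder_seminorm T u k (beta - k%:R)%R)%E.

Definition holder_space T beta u : Prop :=
  let k := Num.truncn beta in
  [/\ measurable_fun ([set t | 0 <= t <= T] `*` [set: 'rV[R]_n])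
        (fun z : R * 'rV[R]_n => u z.1 z.2),
      forall (gamma : multi_index k) (i : 'I_n) t x,
        (order gamma < k)%N -> 0 <= t <= T ->
        derivable (mpartial gamma (u t)) x (delta_mx ord0 i) &
      (holder_norm T beta u < +oo)%E].

Definition C1_holder_space T beta u : Prop :=
  holder_space T beta u /\
  forall x,
    [/\ forall t, 0 <= t <= T -> dt_derivable T u t x,
        exists M : R, forall t, 0 <= t <= T -> `|dt T u t x| <= M &
        {within `[0, T]%classic, continuous (fun t => dt T u t x)}].

Definition bounded_with_derivatives T u : Prop :=
  exists M : R, forall t x, 0 <= t <= T ->
    [/\ `|u t x| <= M,
        dt_derivable T u t x /\ `|dt T u t x| <= M &
        forall i : 'I_n,
          derivable (u t) x (delta_mx ord0 i) /\ `|partial i (u t) x| <= M].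

Definition is_solution T (D : set 'rV[R]_n) (s : R)
    (b : R -> 'rV[R]_n -> 'rV[R]_n) (c f : R -> 'rV[R]_n -> R)
    (g : 'rV[R]_n -> R) (chi : R -> 'rV[R]_n -> R) u : Prop :=
  [/\ forall t x, 0 <= t < T -> D x ->
        [/\ dt_derivable T u t x,
            cvg (pv_integral s (u t) x delta @[delta --> 0^'+]),
            forall i : 'I_n, derivable (u t) x (delta_mx ord0 i) &
            dt T u t x - frac_laplacian s (u t) x
            + \sum_(i < n) b t x ord0 i * partial i (u t) x
            + c t x * u t x + f t x = 0],
      forall x, D x -> u T x = g x &
      forall t x, 0 <= t <= T -> ~ D x -> u t x = chi t x].

End function_spaces.

Section poisson_random_measure.
Context {R : realType} d (Omega : measurableType d) (P : probability Omega R).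

Definition usual_conditions (T : R) (F : R -> set (set Omega)) : Prop :=
  [/\ measure_is_complete P,
      forall t, 0 <= t <= T -> sigma_algebra setT (F t) /\ F t `<=` measurable,
      forall t r, 0 <= t -> t <= r -> r <= T -> F t `<=` F r,
      forall t, 0 <= t < T -> F t = \bigcap_(r in `]t, T]%classic) F r &
      P.-negligible `<=` F 0].

(* Only the restriction of N to the measurable subsets of E matters.          *)
Definition is_poisson_random_measure d' (S : measurableType d') (E : set S)
    (mu : set S -> \bar R) (N : R.-ker Omega ~> S) : Prop :=
  [/\ forall w A, measurable A -> A `<=` E ->
        N w A = +oo%E \/ exists k : nat, N w A = k%:R%:E,
      forall A, measurable A -> A `<=` E -> (mu A < +oo)%E ->
        forall k : nat, P [set w | N w A = k%:R%:E] =
          (fine (mu A) ^+ k / k`!%:R * expR (- fine (mu A)))%:E,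
      forall A, measurable A -> A `<=` E -> mu A = +oo%E ->
        P [set w | N w A = +oo%E] = 1%E &
      forall m (A : 'I_m -> set S) (B : 'I_m -> set (\bar R)),
        (forall i, measurable (A i) /\ A i `<=` E) -> trivIset setT A ->
        (forall i, measurable (B i)) ->
        P [set w | forall i, B i (N w (A i))] =
        (\prod_(i < m) P [set w | B i (N w (A i))])%E].

(* N is adapted to F, and its restriction to the times in ]t, T] is           *)
(* independent of F t.                                                        *)
Definition compatible_with_filtration d' (S : measurableType d') (T : R)
    (F : R -> set (set Omega)) (E : set (R * S)%type)
    (N : R.-ker Omega ~> (R * S)%type) : Prop :=
  (forall t A B, 0 <= t <= T -> measurable A -> measurable B ->
     A `<=` E `&` (`[0, t]%classic `*` setT) -> F t [set w | B (N w A)]) /\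
  (forall t (G : set Omega) m (A : 'I_m -> set (R * S)%type)
      (B : 'I_m -> set (\bar R)), 0 <= t <= T -> F t G ->
     (forall i, measurable (A i) /\
                A i `<=` E `&` (`]t, T]%classic `*` setT)) ->
     (forall i, measurable (B i)) ->
     P (G `&` [set w | forall i, B i (N w (A i))]) =
     (P G * P [set w | forall i, B i (N w (A i))])%E).

End poisson_random_measure.

Section driving_process.
Context {R : realType} {n : nat}.

Definition levy_density (s : R) (y : 'rV[R]_n) : R :=
  @frac_const R n s * enorm y `^ (- (n%:R + 2 * s)).

Definition jump_space (T : R) : set (R * 'rV[R]_n)%type :=
  `[0, T]%classic `*` [set y | y != 0].

(* nu(dy) d eta, where nu has density levy_density s.                         *)
Definition levy_intensity (s : R) (A : set (R * 'rV[R]_n)%type) : \bar R :=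
  (\int[lebesgue_measure \x lebesgue_rV n]_(z in A) (levy_density s z.2)%:E)%E.

(* The value at time t of L^eps, for a realization M of the random measure.   *)
Definition trunc_levy (s eps : R) (M : {measure set (R * 'rV[R]_n)%type -> \bar R})
    (t : R) : 'rV[R]_n :=
  let small := `]0, t]%classic `*` [set y | eps < enorm y < 1] in
  let large := `]0, t]%classic `*` [set y | 1 <= enorm y] in
  \row_(i < n)
    (\int[M]_(z in small) z.2 ord0 i
     - \int[(lebesgue_measure \x lebesgue_rV n)%E]_(z in small)
         (z.2 ord0 i * levy_density s z.2)
     + \int[M]_(z in large) z.2 ord0 i).

End driving_process.

Section euler_scheme.
Context {R : realType} {n : nat}.
Implicit Types (L X : R -> 'rV[R]_n) (Y Z : R -> R) (D : set 'rV[R]_n)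
  (t r T : R).

Definition jump L r : 'rV[R]_n := L r - lim (L eta @[eta --> r^'-]).

Definition next_jump_time L r : \bar R :=
  ereal_inf [set q%:E | q in [set q | r < q /\ jump L q != 0]].

Definition exit_time D t X : \bar R :=
  ereal_inf [set r%:E | r in [set r | t <= r /\ ~ D (X r)]].

Definition stop_time D T t X : R := fine (mine T%:E (exit_time D t X)).

(* X, Y, Z are the paths of the scheme driven by the path L and tau is the    *)
(* sequence of grid times. The recursion defines X up to stop_time only; X is *)
(* kept constant afterwards (euler_stop), since otherwise arbitrary later     *)
(* values of X could create a spurious exit_time.                             *)
Record jump_adapted_euler D (b : R -> 'rV[R]_n -> 'rV[R]_n)
    (c f : R -> 'rV[R]_n -> R) T L t (x : 'rV[R]_n) X Y Z (tau : nat -> R)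
    : Prop := JumpAdaptedEuler {
  euler_tau0 : tau 0%N = t;
  euler_X0 : X t = x;
  euler_Y0 : Y t = 1;
  euler_Z0 : Z t = 0;
  euler_tauS : forall i,
    tau i.+1 =
    fine (mine (mine (next_jump_time L (tau i)) (exit_time D t X)) T%:E);
  euler_X : forall i r, tau i < stop_time D T t X -> tau i < r < tau i.+1 ->
    X r = X (tau i) + (r - tau i) *: b (tau i) (X (tau i));
  euler_X_jump : forall i, tau i < stop_time D T t X ->
    X (tau i.+1) = lim (X r @[r --> (tau i.+1)^'-]) + jump L (tau i.+1);
  euler_Y : forall i r, tau i < stop_time D T t X -> tau i < r <= tau i.+1 ->
    Y r = Y (tau i) + c (tau i) (X (tau i)) * Y (tau i) * (r - tau i);
  euler_Z : forall i r, tau i < stop_time D T t X -> tau i < r <= tau i.+1 ->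
    Z r = Z (tau i) + f (tau i) (X (tau i)) * Y (tau i) * (r - tau i);
  euler_stop : forall r, stop_time D T t X <= r ->
    X r = X (stop_time D T t X)
}.

End euler_scheme.

(* Main.v *)
(* Between two jumps, freeze the coefficients at the last jump. Along this    *)
(* flow the value u(t, X) Y + Z has, by the equation satisfied by u, a slope  *)
(* equal to minus the effect of the jumps of size larger than eps, up to an   *)
(* error C (A + E), where A is the time elapsed since the last jump and E is  *)
(* the error of replacing the fractional Laplacian by the truncated Levy      *)
(* operator. A Taylor expansion, whose odd first-order term integrates to     *)
(* zero on symmetric shells, gives E = O(eps^(beta - 2 s)). The jumps have    *)
(* rate lam >= c eps^(- 2 s), so that A has mean at most 1 / lam.             *)
(* To avoid stochastic calculus, time is cut into m cells of length h and     *)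
(* only the cells containing exactly one jump are kept: this defines a Markov *)
(* chain adapted to the filtration, whose mean error is bounded by summing    *)
(* the one-step errors. With probability 1 - O(m h^2) no cell contains two    *)
(* jumps, and then the chain ends at the payoff of the scheme; let m grow.    *)

From HB Require Import structures.
From mathcomp Require Import all_boot all_order all_algebra.
From mathcomp Require Import all_classical all_reals all_analysis.
From mathcomp Require Import measurable_realfun ring lra.
Require Import Defs.

Set Implicit Arguments.
Unset Strict Implicit.
Unset Printing Implicit Defensive.

Import Order.TTheory GRing.Theory Num.Theory.
Import numFieldNormedType.Exports.

Local Open Scope classical_set_scope.
Local Open Scope ring_scope.

(** * Lebesgue measure on row vectors *)

(** Two errors add up: the coefficients are frozen between jumps, and the jumps smaller than [eps]
    are dropped. Differentiate u(r, X_r) Y_r + Z_r along a flow frozen at time tau with Y = y there.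
    By the equation the slope is minus Y_r times the integral of u(r, X_r + z) - u(r, X_r) over the
    jumps larger than [eps], up to |y| C (A + E) ([payoff_slope_error], [payoff_increment]). The age
    A = r - tau measures how far the coefficients have moved since they were frozen. The number E is
    the cost of the small jumps ([frac_laplacian_error]): an increment of u minus its odd linear
    part is O(|z|^beta), and |z|^(beta - n - 2s) has an integral O([eps]^(beta - 2s)) over the ball
    of radius [eps].

    The integral left in the slope is what the jumps themselves add in the mean, so it cancels in
    expectation, and the total error is at most T C (E + largest mean age). Jumps arrive at rate
    [lam], so the mean age is at most 1 / [lam], and [lam] is at least a multiple of [eps]^(-2s)
    ([levy_mass_ge]). This gives both terms of the bound.

    The cancellation is proved on a mesh of step h. Given the past, a cell contains exactly one
    jump, located in B, with probability e^(-lam h) times the intensity of B ([poisson_mark]). Hence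
    [mean_step] gives the exact mean increment of a function of the [chain]; with the pathwise
    estimate [one_step] it yields [mean_age] and [mean_value]. The chain and the scheme end at the
    same payoff when no cell contains two jumps ([path_payoff]). Finally h tends to 0 in
    [scheme_error]: the terms of order h^2 per step vanish, although their constants depend on
    [eps]. *)

Section density.
Local Open Scope ereal_scope.
Context d (T : measurableType d) (R : realType).
Variables (mu : {measure set T -> \bar R}) (g : T -> R).
Hypotheses (g0 : forall x, (0 <= g x)%R) (mg : measurable_fun setT g).

(** The proofs of nonnegativity and measurability are arguments, so that the measure structure can
    be attached to the term itself. *)
Definition density of (forall x, (0 <= g x)%R) & measurable_fun setT g :
  set T -> \bar R := fun A => \int[mu]_(x in A) (g x)%:E.

Local Notation nu := (density g0 mg).

Let density0 : nu set0 = 0. Proof. by rewrite /density integral_set0. Qed.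

Let density_ge0 A : 0 <= nu A.
Proof. by apply: integral_ge0 => x _; rewrite lee_fin. Qed.

Let density_sigma_additive : semi_sigma_additive nu.
Proof.
move=> /= F mF tF mUF; rewrite /density ge0_integral_bigcup//=; last 2 first.
- by apply/measurable_EFinP; exact: measurable_funTS.
- by move=> x _; rewrite lee_fin.
apply: is_cvg_ereal_nneg_natsum_cond => n _ _.
by apply: integral_ge0 => x _; rewrite lee_fin.
Qed.

HB.instance Definition _ := isMeasure.Build _ _ _ nu
  density0 density_ge0 density_sigma_additive.

Import HBNNSimple.

(** Approximate [f] from below by simple functions: on an indicator the identity is the definition
    of the density, and monotone convergence passes to the limit on both sides. *)
Lemma ge0_integral_density (f : T -> \bar R) : measurable_fun setT f ->
  (forall x, 0 <= f x) -> \int[nu]_x f x = \int[mu]_x (f x * (g x)%:E).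
Proof.
move=> mf f0.
pose f_ := nnsfun_approx measurableT mf.
have mgE : measurable_fun setT (EFin \o g) by exact/measurable_EFinP.
transitivity (limn (fun n => \int[nu]_x (f_ n x)%:E)).
  rewrite -monotone_convergence//.
  - by apply: eq_integral => y _; apply/esym/cvg_lim => //;
      apply: cvg_nnsfun_approx.
  - by move=> n; exact/measurable_EFinP/measurable_funP.
  - by move=> n y _; rewrite lee_fin.
  - by move=> y _ m n mn; rewrite lee_fin; exact/lefP/nd_nnsfun_approx.
transitivity (limn (fun n => \int[mu]_x ((f_ n x)%:E * (g x)%:E))); last first.
  rewrite -monotone_convergence//.
  - apply: eq_integral => y _; apply/cvg_lim => //.
    by apply: cvgeZr => //; apply: cvg_nnsfun_approx.
  - by move=> n; apply: emeasurable_funM => //; exact/measurable_EFinP.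
  - by move=> n y _; rewrite -EFinM lee_fin mulr_ge0.
  - move=> y _ m n mn; rewrite -!EFinM lee_fin ler_wpM2r//.
    exact/lefP/nd_nnsfun_approx.
congr (limn _); apply/funext => n.
under [LHS]eq_integral => x _ do rewrite fimfunE -fsumEFin//.
rewrite ge0_integral_fsum//; last 2 first.
- by move=> r; exact/measurable_EFinP/measurableT_comp.
- by move=> r x _; rewrite nnfun_muleindic_ge0.
under [RHS]eq_integral => x _.
  rewrite fimfunE -fsumEFin// ge0_mule_fsuml; last first.
    by move=> r; rewrite nnfun_muleindic_ge0.
  over.
rewrite [RHS]ge0_integral_fsum//; last 2 first.
- move=> r; apply: emeasurable_funM => //.
  exact/measurable_EFinP/measurableT_comp.
- by move=> r x _; rewrite mule_ge0// ?nnfun_muleindic_ge0// lee_fin.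
apply: eq_fsbigr => r _; rewrite integralZl_indic_nnsfun// integral_indic//= setIT.
have [r0|r0] := ltP r 0%R.
  rewrite preimage_nnfun0// measure0 mule0; apply/esym/integral0_eq => x _.
  by rewrite indicE in_set0 mulr0 mul0e.
under [RHS]eq_integral => x _ do rewrite EFinM -muleA.
rewrite ge0_integralZl//; last 2 first.
- apply: emeasurable_funM => //.
  exact/measurable_EFinP/measurable_indic/measurable_funPTI.
- by move=> x _; rewrite mule_ge0// lee_fin.
congr (_ * _); rewrite /= /density integral_mkcond.
apply: eq_integral => x _; rewrite epatch_indic.
by rewrite muleC.
Qed.

End density.

Lemma measurable_rV_forall (R : realType) n (J : 'I_n -> set R) :
  (forall i, measurable (J i)) ->
  measurable [set x : 'rV[R]_n | forall i, J i (x ord0 i)].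
Proof.
move=> mJ; have -> : [set x : 'rV[R]_n | forall i, J i (x ord0 i)] =
    \big[setI/setT]_(i < n) (rV_coord i @^-1` J i).
  rewrite -bigcap_seq; apply/seteqP; split => x /= H i.
    by move=> _; exact: H.
  by apply: (H i) => /=; rewrite mem_index_enum.
apply: bigsetI_measurable => i _; rewrite -[X in measurable X]setTI.
exact: measurable_rV_coord.
Qed.

Section lebesgue_rV_theory.
Context {R : realType}.
Local Open Scope ereal_scope.

(** Reflections suffice for all changes of variables below: parity is the reflection at 0, and a
    translation is the composition of two reflections. Half-open intervals determine Lebesgue
    measure. *)
Lemma lebesgue_measure_subl (c : R) (A : set R) : measurable A ->
  lebesgue_measure ((fun x : R => c - x)%R @^-1` A) = lebesgue_measure A.
Proof.
have mc : measurable_fun setT (fun x : R => c - x)%R.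
  by apply: measurable_funB => //; exact: measurable_id.
move=> mA.
have -> : lebesgue_measure ((fun x : R => c - x)%R @^-1` A) =
  pushforward (@lebesgue_measure R) (fun x : measurableTypeR R => c - x : measurableTypeR R)%R A.
  by [].
apply/esym/lebesgue_measure_unique => //= _ [[a b]] _ <-.
rewrite /pushforward.
have -> : ((fun x : R => (c - x)%R) @^-1` `]a, b]) = `[c - b, c - a[%classic%R.
  by apply/seteqP; split => x /=; rewrite !in_itv/= => /andP[? ?]; apply/andP;
    split; lra.
rewrite !lebesgue_measure_itv/= !lte_fin ltrD2l ltrN2.
case: ifPn => // ab; rewrite -!EFinB; congr EFin; lra.
Qed.

Lemma ge0_integral_lebesgue_subl (c : R) (f : R -> \bar R) :
  measurable_fun setT f -> (forall x, 0 <= f x) ->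
  \int[lebesgue_measure]_x f (c - x)%R = \int[lebesgue_measure]_x f x.
Proof.
move=> mf f0.
have mc : measurable_fun setT (fun x : R => c - x)%R.
  by apply: measurable_funB => //; exact: measurable_id.
transitivity (\int[pushforward (@lebesgue_measure R)
    (fun x : measurableTypeR R => c - x : measurableTypeR R)%R]_x f x).
  by rewrite ge0_integral_pushforward//=.
by apply: eq_measure_integral => A mA _; exact: lebesgue_measure_subl.
Qed.

Lemma ge0_integral_rV_cons n (f : 'rV[R]_n.+1 -> \bar R) :
  measurable_fun setT f -> (forall x, 0 <= f x) ->
  \int[lebesgue_rV n.+1]_x f x =
  \int[lebesgue_measure]_a \int[lebesgue_rV n]_v f (rV_cons (a, v)).
Proof.
move=> mf f0 /=; rewrite /rV_cons_measure ge0_integral_pushforward//=.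
- rewrite preimage_setT fubini_tonelli1//=.
  by apply: measurableT_comp => //; exact: measurable_rV_cons.
- exact: measurable_rV_cons.
Qed.

Lemma measurable_subl_rV n (h : 'rV[R]_n) :
  measurable_fun setT (fun x : 'rV[R]_n => h - x)%R.
Proof.
apply: measurable_fun_rV => i.
apply: (@eq_measurable_fun _ _ _ _ _ (fun x => h ord0 i - rV_coord i x)%R).
  by move=> x _; rewrite !mxE.
by apply: measurable_funB => //; exact: measurable_rV_coord.
Qed.

(** Induction on the dimension: Tonelli splits off the first coordinate, and it is reflected
    separately from the others. *)
Lemma ge0_integral_rV_subl n (h : 'rV[R]_n) (f : 'rV[R]_n -> \bar R) :
  measurable_fun setT f -> (forall x, 0 <= f x) ->
  \int[lebesgue_rV n]_x f (h - x)%R = \int[lebesgue_rV n]_x f x.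
Proof.
elim: n h f => [|n IH] h f mf f0.
  by apply: eq_integral => x _; congr f; apply/rowP => -[].
rewrite [RHS]ge0_integral_rV_cons//.
have mfh : measurable_fun setT (fun x : 'rV[R]_n.+1 => f (h - x)%R).
  by apply: measurableT_comp => //; exact: measurable_subl_rV.
have f0h x : 0 <= f (h - x)%R by exact: f0.
rewrite (ge0_integral_rV_cons mfh f0h).
have consB a v : (h - rV_cons (a, v) =
    rV_cons ((rV_uncons h).1 - a, (rV_uncons h).2 - v))%R.
  apply/rowP => i; rewrite !mxE; case: (unliftP ord0 i) => [j ->|->] /=;
  by rewrite ?mxE ?liftK ?unlift_none.
under eq_integral => a _.
  under eq_integral => v _ do rewrite consB.
  rewrite (IH _ (fun v => f (rV_cons ((rV_uncons h).1 - a, v)%R)))//; last first.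
    apply: measurableT_comp => //; apply: measurableT_comp.
      exact: measurable_rV_cons.
    exact: measurable_pair1.
  over.
rewrite /= (@ge0_integral_lebesgue_subl _
  (fun a => \int[lebesgue_rV n]_v f (rV_cons (a, v))))//.
- apply: (@measurable_fun_fubini_tonelli_F _ _ _ _ _ (lebesgue_rV n)
    (fun z => f (rV_cons z))) => //.
  by apply: measurableT_comp => //; exact: measurable_rV_cons.
- by move=> a; exact: integral_ge0.
Qed.

Lemma lebesgue_rV_box n (J : set R) : measurable J ->
  lebesgue_rV n [set x | forall i, J (x ord0 i)] = (lebesgue_measure J) ^+ n.
Proof.
move=> mJ; elim: n => [|n IH].
  rewrite /= diracE mem_set// => -[]//.
have mB : measurable [set x : 'rV[R]_n | forall i, J (x ord0 i)].
  exact: (measurable_rV_forall (fun=> mJ)).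
rewrite [LHS]/= /rV_cons_measure /pushforward.
rewrite (_ : _ @^-1` _ = J `*` [set x : 'rV[R]_n | forall i, J (x ord0 i)]).
  by rewrite product_measure1E// IH expeS.
apply/seteqP; split => -[a v] /=.
  move=> H; split => /=.
    by have := H ord0; rewrite mxE unlift_none.
  by move=> i; have := H (lift ord0 i); rewrite mxE liftK.
move=> [Ja Jv] i; rewrite mxE; case: (unliftP ord0 i) => [j _|_] /=.
  exact: Jv.
by [].
Qed.

End lebesgue_rV_theory.

Section measurable_rV_open.
Context {R : realType} {n : nat}.

Lemma measurable_rV_box (x : 'rV[R]_n) (e : R) :
  measurable [set y : 'rV[R]_n | forall i, `|x ord0 i - y ord0 i| < e].
Proof.
apply: (@measurable_rV_forall _ _ (fun i => ball (x ord0 i) e)) => i.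
exact: measurable_ball.
Qed.

Lemma open_rVP (A : set 'rV[R]_n) (x : 'rV[R]_n) : open A -> A x ->
  exists2 e : R, 0 < e &
    forall y : 'rV[R]_n, (forall i, `|x ord0 i - y ord0 i| < e) -> A y.
Proof.
move=> oA Ax; have /nbhs_ballP[e /= e0 eA] : nbhs x A by exact: open_nbhs_nbhs.
exists e => // y H; apply: eA; split => // i j; rewrite (ord1 i); exact: H.
Qed.

(** An open set is the union of the countably many boxes with rational centre and radius 1/(k+1)
    that it contains. *)
Lemma open_measurable_rV (A : set 'rV[R]_n) : open A -> measurable A.
Proof.
move=> oA.
pose c (p : 'rV[rat]_n * nat) : 'rV[R]_n := map_mx ratr p.1.
pose box p := [set y : 'rV[R]_n |
  forall i, `|c p ord0 i - y ord0 i| < p.2.+1%:R^-1].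
pose B p := if `[< box p `<=` A >] then box p else set0.
have -> : A = \bigcup_p B p.
  apply/seteqP; split => [x Ax|x [p _]]; last first.
    by rewrite /B; case: asboolP => // pA /pA.
  have [e e0 eA] := open_rVP oA Ax.
  (* Half of [e]: a box of this radius that contains [x] stays within [e] of [x]. *)
  have [k ke] : exists k : nat, k.+1%:R^-1 < e / 2.
    have [k _ /(_ k (leqnn k))] := near_infty_natSinv_lt (PosNum (divr_gt0 e0 (ltr0n R 2))).
    by exists k.
  have k0 : (0 : R) < k.+1%:R^-1 by rewrite invr_gt0.
  have rq i : exists q : rat, `|ratr q - x ord0 i| < k.+1%:R^-1.
    move: (k.+1%:R^-1 : R) k0 => a a0.
    have xa : x ord0 i - a < x ord0 i + a by lra.
    have [q] := rat_in_itvoo xa.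
    by rewrite in_itv/= => qx; exists q; rewrite ltr_norml; lra.
  have [q Hq] := choice rq.
  have cE i : c (\row_i q i, k) ord0 i = ratr (q i) by rewrite !mxE.
  exists (\row_i q i, k) => //; rewrite /B; case: asboolP; last first.
    case=> y /= H; apply: eA => i.
    have := H i; have := Hq i; rewrite cE/=.
    by move: (k.+1%:R^-1 : R) ke => a ae; rewrite !ltr_norml; lra.
  by move=> _ i /=; rewrite cE.
apply: countable_bigcupT_measurable => [|p].
  exact: countableP.
rewrite /B; case: ifP => // _; exact: measurable_rV_box.
Qed.

Lemma continuous_measurable_rV (f : 'rV[R]_n -> R) : continuous f ->
  measurable_fun setT f.
Proof.
move=> cf; apply: (measurability _ (RGenOpens.measurableE R)).
move=> _ [_ [a [b ->] <-]]; rewrite setTI; apply: open_measurable_rV.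
by apply: open_comp => // x _; exact: cf.
Qed.

End measurable_rV_open.

(** * Powers of the Euclidean norm *)

Section enorm_theory.
Context {R : realType} {n : nat}.
Implicit Types x y : 'rV[R]_n.

Lemma enorm_ge0 x : 0 <= enorm x. Proof. exact: sqrtr_ge0. Qed.

Lemma enormN x : enorm (- x) = enorm x.
Proof. by congr Num.sqrt; apply: eq_bigr => i _; rewrite mxE sqrrN. Qed.

Lemma enormZ (a : R) x : enorm (a *: x) = `|a| * enorm x.
Proof.
rewrite /enorm -sqrtr_sqr -sqrtrM ?sqr_ge0//; congr Num.sqrt.
by rewrite mulr_sumr; apply: eq_bigr => i _; rewrite mxE exprMn.
Qed.

Lemma ler_coord_enorm x i : `|x ord0 i| <= enorm x.
Proof.
rewrite -sqrtr_sqr ler_sqrt; last by apply: sumr_ge0 => j _; exact: sqr_ge0.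
by rewrite (bigD1 i)//= lerDl sumr_ge0// => j _; exact: sqr_ge0.
Qed.

(** The sum of squares is at most n r^2, hence at most (n r)^2; the crude constant n replaces its
    square root. *)
Lemma enorm_le (r : R) x : 0 <= r -> (forall i, `|x ord0 i| <= r) ->
  enorm x <= n%:R * r.
Proof.
move=> r0 xr; rewrite -(@ger0_norm _ (n%:R * r)) ?mulr_ge0// -sqrtr_sqr.
rewrite ler_sqrt ?sqr_ge0//.
apply: (@le_trans _ _ (\sum_(i < n) r ^+ 2)).
  by apply: ler_sum => i _; rewrite -real_normK ?num_real// lerXn2r ?nnegrE.
rewrite sumr_const card_ord -(mulr_natl (r ^+ 2)) exprMn.
apply: ler_wpM2r; first exact: sqr_ge0.
by rewrite -natrX ler_nat; case: (n) => // m; rewrite expnS leq_pmulr.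
Qed.

Lemma enorm_gt0 x : (0 < enorm x) = (x != 0).
Proof.
apply/idP/idP => [|x0].
  apply: contraTneq => ->; rewrite -leNgt.
  have := @enorm_le 0 0 (lexx _); rewrite mulr0; apply => i.
  by rewrite mxE normr0.
have [i xi] : exists i, x ord0 i != 0.
  apply/existsP; apply: contraNT x0; rewrite negb_exists => /forallP H.
  by apply/eqP/rowP => i; have := H i; rewrite negbK mxE => /eqP.
by apply: lt_le_trans (ler_coord_enorm x i); rewrite normr_gt0.
Qed.

Lemma measurable_enorm : measurable_fun setT (@enorm R n).
Proof.
have -> : @enorm R n =
    Num.sqrt \o (fun x => \sum_(i < n) (rV_coord i x) ^+ 2) by [].
apply: measurableT_comp; first by apply: continuous_measurable_fun; exact: sqrt_continuous.
apply: measurable_sum => i; apply: measurable_funX.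
exact: measurable_rV_coord.
Qed.

Lemma measurable_enorm_set (J : set R) : measurable J ->
  measurable [set x : 'rV[R]_n | J (enorm x)].
Proof.
by move=> mJ; rewrite -[X in measurable X]setTI; exact: measurable_enorm.
Qed.

Lemma measurable_enorm_powR (p : R) :
  measurable_fun setT (fun x : 'rV[R]_n => enorm x `^ p).
Proof.
apply: (@measurableT_comp _ _ _ _ _ _ (fun a => a `^ p)).
  exact: measurable_powR.
exact: measurable_enorm.
Qed.

End enorm_theory.

Section enorm_powers.
Context {R : realType} {n : nat}.
Local Open Scope ereal_scope.

Definition enorm_powR_measure (p : R) :=
  density (lebesgue_rV n) (fun x : 'rV[R]_n => powR_ge0 (enorm x) p)
    (measurable_enorm_powR p).
Local Notation pm := enorm_powR_measure.

HB.instance Definition _ (p : R) := Measure.on (pm p).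

(** 4^n r^n is the volume of the cube of half-side 2 r around the shell, and 2^|p| bounds (|x| /
    r)^p when 1 < |x| / r <= 2. *)
Let K0 (p : R) : R := (4 ^+ n * 2 `^ `|p|)%R.

Lemma enorm_powR_shell (p r : R) : (0 < r)%R ->
  pm p [set x | r < enorm x <= 2 * r]%R <= (K0 p * r `^ (n%:R + p))%:E.
Proof.
move=> r0; set A := [set x | _].
have mA : measurable A.
  have -> : A = [set x | `]r, (2 * r)%R]%classic (enorm x)].
    by apply/seteqP; split => x; rewrite /A /= in_itv.
  exact: measurable_enorm_set.
pose J : set R := [set` `[- (2 * r), 2 * r]%R].
have mJ : measurable J by exact: measurable_itv.
have AJ : A `<=` [set x | forall i, J (x ord0 i)].
  move=> x /andP[_ xr] i; rewrite /J /= in_itv/= -ler_norml.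
  exact: le_trans (ler_coord_enorm x i) xr.
have J4 : lebesgue_measure J = (4 * r)%:E.
  rewrite /J lebesgue_measure_itv/= lte_fin ifT; last lra.
  by rewrite -EFinB; congr EFin; lra.
apply: (@le_trans _ _ (\int[lebesgue_rV n]_(x in A) (2 `^ `|p| * r `^ p)%:E)).
  apply: ge0_le_integral => //.
  - by move=> x _; rewrite lee_fin powR_ge0.
  - by apply/measurable_EFinP/measurable_funTS; exact: measurable_enorm_powR.
  - move=> x /andP[rx xr]; rewrite lee_fin.
    have -> : enorm x = (enorm x / r * r)%R by rewrite divfK// gt_eqF.
    rewrite powRM; [|by rewrite divr_ge0 ?enorm_ge0 ?ltW|exact: ltW].
    rewrite ler_wpM2r ?powR_ge0//.
    have x1 : (1 <= enorm x / r)%R by rewrite ler_pdivlMr// mul1r ltW.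
    apply: (le_trans (ler_powR x1 (ler_norm p))).
    apply: ge0_ler_powR => //; rewrite ?nnegrE// ?(le_trans _ x1)//.
    by rewrite ler_pdivrMr.
rewrite integral_cst//.
have : lebesgue_rV n A <= ((4 * r) ^+ n)%:E.
  apply: le_trans (_ : _ <= lebesgue_rV n [set x | forall i, J (x ord0 i)]) _.
    by apply: le_measure => //; rewrite inE//; exact: (measurable_rV_forall (fun=> mJ)).
  by rewrite lebesgue_rV_box// J4 EFin_expe.
move=> /(lee_wpmul2l _) - /(_ (2 `^ `|p| * r `^ p)%:E) H.
apply: le_trans (H _) _; first by rewrite lee_fin mulr_ge0// powR_ge0.
rewrite -EFinM lee_fin /K0 powRD; last by rewrite (gt_eqF r0) implybT.
rewrite powR_mulrn ?(ltW r0)// exprMn.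
by have -> : (2 `^ `|p| * r `^ p * (4 ^+ n * r ^+ n) =
  4 ^+ n * 2 `^ `|p| * (r ^+ n * r `^ p))%R by ring.
Qed.

(** Sums the shell estimate over a covering by shells whose weights decay geometrically with ratio
    [z]. *)
Lemma enorm_powR_shells (p B z : R) (r : nat -> R) (A : set 'rV[R]_n) :
  measurable A -> (forall j, 0 < r j)%R -> (0 <= z < 1)%R ->
  (forall j, r j `^ (n%:R + p) <= B * z ^+ j)%R ->
  A `<=` \bigcup_j [set x | r j < enorm x <= 2 * r j]%R ->
  pm p A <= (K0 p * (B / (1 - z)))%:E.
Proof.
move=> mA r0 z01 rB AU.
have mS j : measurable [set x : 'rV[R]_n | r j < enorm x <= 2 * r j]%R.
  have -> : [set x : 'rV[R]_n | r j < enorm x <= 2 * r j]%R =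
      [set x | `]r j, (2 * r j)%R]%classic (enorm x)].
    by apply/seteqP; split => x; rewrite /= in_itv.
  exact: measurable_enorm_set.
apply: le_trans (measure_sigma_subadditive (pm p) mS mA AU) _.
have K00 : (0 <= K0 p)%R by rewrite mulr_ge0// ?exprn_ge0// powR_ge0.
have B0 : (0 <= B)%R.
  by have := rB 0%N; rewrite expr0 mulr1; apply: le_trans; exact: powR_ge0.
apply: lime_le.
  by apply: is_cvg_nneseries => *; exact: measure_ge0.
apply: nearW => N.
apply: (@le_trans _ _ (\sum_(0 <= j < N) (K0 p * (B * z ^+ j))%:E)).
  apply: lee_sum => j _; apply: le_trans (enorm_powR_shell p (r0 j)) _.
  by rewrite lee_fin ler_wpM2l.
rewrite sumEFin lee_fin -mulr_sumr ler_wpM2l// -mulr_sumr ler_wpM2l//.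
have z1 : (0 < 1 - z)%R by lra.
rewrite -div1r ler_pdivlMr//.
have -> : (\sum_(0 <= j < N) z ^+ j = \sum_(j < N) z ^+ j)%R by rewrite big_mkord.
have := subrX1 z N; have zN : (0 <= z ^+ N)%R by rewrite exprn_ge0//; lra.
by rewrite mulrC; lra.
Qed.

Let powR2_lt1 (r : R) : (r < 0 -> 2 `^ r < 1)%R.
Proof.
move=> r0; rewrite /powR pnatr_eq0/= expR_lt1.
by rewrite nmulr_rlt0// ln_gt0// ltr1n.
Qed.

Let exprn_powR (j : nat) (q : R) : ((2 ^+ j) `^ q = (2 `^ q) ^+ j)%R.
Proof.
rewrite -(powR_mulrn j (ler0n R 2)) -(powR_mulrn j (powR_ge0 2 q)) -!powRrM.
by rewrite mulrC.
Qed.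

Let pow2_gt (r : R) : exists j : nat, (r < 2 ^+ j)%R.
Proof.
exists (Num.truncn r).+1; apply: (lt_le_trans (Num.Theory.truncnS_gt r)).
by rewrite -natrX ler_nat ltnW// ltn_expl.
Qed.

(** Dyadic shells of radii e 2^j; the ratio 2^(n + p) is below 1 because the power is integrable at
    infinity. *)
Lemma enorm_powR_outer (p e : R) : (n%:R + p < 0)%R -> (0 < e)%R ->
  pm p [set x | e < enorm x]%R <=
  (K0 p / (1 - 2 `^ (n%:R + p)) * e `^ (n%:R + p))%:E.
Proof.
move=> np0 e0; set z : R := (2 `^ (n%:R + p))%R.
have z01 : (0 <= z < 1)%R.
  by rewrite powR_ge0/= powR2_lt1.
have -> : (K0 p / (1 - z) * e `^ (n%:R + p) = K0 p * (e `^ (n%:R + p) / (1 - z)))%R.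
  by rewrite mulrAC -mulrA.
apply: (@enorm_powR_shells p _ z (fun j => e * 2 ^+ j)%R) => //.
- have -> : [set x : 'rV[R]_n | e < enorm x]%R =
      [set x | `]e, +oo[%classic (enorm x)].
    by apply/seteqP; split => x; rewrite /= in_itv/= andbT.
  exact: measurable_enorm_set.
- by move=> j; rewrite mulr_gt0// exprn_gt0.
- move=> j; rewrite powRM ?exprn_ge0 ?(ltW e0)//.
  by rewrite exprn_powR.
- move=> x /= ex.
  (* The least such index selects the shell of [x]: minimality is the strict lower bound on the
     norm. *)
  have /ex_minnP[[|m] mP mmin] : exists j, (enorm x <= e * 2 ^+ j.+1)%R.
  + have [j] := pow2_gt (enorm x / e); rewrite ltr_pdivrMr// => H.
    exists j; apply: ltW; apply: (lt_le_trans H); rewrite mulrC.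
    by rewrite ler_wpM2l ?(ltW e0)// exprS ler_peMl ?exprn_ge0// ler1n.
  + exists 0%N => //=; rewrite expr0 mulr1 ex/=.
    by move: mP; rewrite expr1 mulrC.
  + exists m.+1 => //=; rewrite mulrCA -exprS mP andbT ltNge.
    by apply/negP => /mmin; rewrite ltnn.
Qed.

(** The same argument with radii e / 2^(j+1), whose weights decay because n + p > 0. *)
Lemma enorm_powR_inner (p e : R) : (0 < n%:R + p)%R -> (0 < e)%R ->
  pm p [set x | 0 < enorm x <= e]%R <=
  (K0 p / (1 - 2 `^ (- (n%:R + p))) * e `^ (n%:R + p))%:E.
Proof.
move=> np0 e0; set z : R := (2 `^ (- (n%:R + p)))%R.
have z01 : (0 <= z < 1)%R.
  by rewrite powR_ge0/= powR2_lt1// oppr_lt0.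
have -> : (K0 p / (1 - z) * e `^ (n%:R + p) = K0 p * (e `^ (n%:R + p) / (1 - z)))%R.
  by rewrite mulrAC -mulrA.
apply: (@enorm_powR_shells p _ z (fun j => e / 2 ^+ j.+1)%R) => //.
- have -> : [set x : 'rV[R]_n | 0 < enorm x <= e]%R =
      [set x | `]0%R, e]%classic (enorm x)].
    by apply/seteqP; split => x; rewrite /= in_itv.
  exact: measurable_enorm_set.
- by move=> j; rewrite divr_gt0// exprn_gt0.
- move=> j; rewrite powRM ?invr_ge0 ?exprn_ge0 ?(ltW e0)//.
  rewrite ler_wpM2l ?powR_ge0//.
  apply: (@le_trans _ _ (z ^+ j.+1)%R); last first.
    by rewrite exprS ler_piMl ?exprn_ge0//; lra.
  by rewrite -powR_inv1 ?exprn_ge0// -powRrM mulN1r exprn_powR.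
- move=> x /= /andP[x0 xe].
  have /ex_minnP[[|m] mP mmin] : exists j, (e / 2 ^+ j.+1 < enorm x)%R.
  + have [j] := pow2_gt (e / enorm x); rewrite ltr_pdivrMr// => H.
    exists j; rewrite ltr_pdivrMr ?exprn_gt0//.
    apply: (lt_le_trans H); rewrite mulrC.
    by rewrite ler_wpM2l ?(ltW x0)// exprS ler_peMl ?exprn_ge0// ler1n.
  + exists 0%N => //=; rewrite mP/=; apply: (le_trans xe).
    by rewrite expr1 mulrC divfK.
  + exists m.+1 => //=; rewrite mP/= (exprS _ m.+1) invfM mulrCA.
    rewrite (mulrA 2%R) divff// mul1r leNgt.
    by apply/negP => /mmin; rewrite ltnn.
Qed.

(** The cube of points with all coordinates in ]e, 2e[ lies outside the ball, has volume e^n, and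
    its points have norm at most 2 n e. This is the source of the lower bound on the jump rate. *)
Lemma enorm_powR_outer_ge (p e : R) : (0 < n)%N -> (p <= 0)%R -> (0 < e)%R ->
  ((2 * n%:R) `^ p * e `^ (n%:R + p))%:E <= pm p [set x | e < enorm x]%R.
Proof.
move=> n0 p0 e0; have nR0 : (0 < n%:R :> R)%R by rewrite ltr0n.
pose J : set R := [set` `]e, 2 * e[%R].
have mJ : measurable J by exact: measurable_itv.
have lJ : lebesgue_measure J = e%:E.
  rewrite /J lebesgue_measure_itv/= lte_fin ifT; last lra.
  by rewrite -EFinB; congr EFin; lra.
pose B : set 'rV[R]_n := [set x | forall i, J (x ord0 i)].
have mB : measurable B by exact: (measurable_rV_forall (fun=> mJ)).
have Be x : B x -> (e < enorm x <= 2 * n%:R * e)%R.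
  move=> Bx; apply/andP; split.
    have := Bx (Ordinal n0); rewrite /J /= in_itv/= => /andP[ex _].
    apply: (lt_le_trans ex); apply: le_trans (ler_norm _) _.
    exact: ler_coord_enorm.
  rewrite -mulrA mulrCA; apply: enorm_le => [|i]; first lra.
  have := Bx i; rewrite /J /= in_itv/= => /andP[ex xe].
  by rewrite ger0_norm ltW// (lt_trans e0).
apply: (@le_trans _ _ (pm p B)); last first.
  apply: le_measure; rewrite ?inE//; last by move=> x /Be/andP[].
  have -> : [set x : 'rV[R]_n | e < enorm x]%R =
      [set x | `]e, +oo[%classic (enorm x)].
    by apply/seteqP; split => x; rewrite /= in_itv/= andbT.
  exact: measurable_enorm_set.
apply: (@le_trans _ _
    (\int[lebesgue_rV n]_(x in B) (((2 * n%:R) * e) `^ p)%:E)).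
  have lB : lebesgue_rV n B = (e ^+ n)%:E.
    by have := lebesgue_rV_box n mJ; rewrite lJ EFin_expe.
  rewrite integral_cst// [X in _ <= _ * X]lB -EFinM lee_fin.
  have -> : ((2 * n%:R * e) `^ p = (2 * n%:R) `^ p * e `^ p)%R.
    by rewrite powRM ?(ltW e0)// mulr_ge0.
  rewrite powRD; last by rewrite (gt_eqF e0) implybT.
  by rewrite powR_mulrn ?(ltW e0)// mulrA mulrAC.
apply: ge0_le_integral => //.
- by move=> x _; rewrite lee_fin powR_ge0.
- by apply/measurable_EFinP/measurable_funTS; exact: measurable_enorm_powR.
- move=> x /Be /andP[ex xe]; rewrite lee_fin.
  have x0 : (0 < enorm x)%R by exact: lt_trans ex.
  rewrite -[p]opprK powRN [leRHS]powRN lef_pV2 ?posrE ?powR_gt0 ?mulr_gt0//.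
  by apply: ge0_ler_powR; rewrite ?nnegrE ?oppr_ge0 ?(ltW x0)// ?mulr_ge0 ?ltW.
Qed.

End enorm_powers.

(** * Positivity of the Gamma function *)

Section Gamma_gt0.
Context {R : realType}.
Local Open Scope ereal_scope.

(** Carries integrals over the line to integrals in the norm of R^1, where the dyadic estimates
    apply. *)
Lemma ge0_integral_rV1 (F : R -> \bar R) : measurable_fun setT F ->
  (forall r, 0 <= F r) ->
  \int[lebesgue_rV 1]_x F (enorm x) = \int[lebesgue_measure]_r F `|r|%R.
Proof.
move=> mF F0; rewrite (ge0_integral_rV_cons (f := fun x => F (enorm x)))//; last first.
  by apply: measurableT_comp => //; exact: measurable_enorm.
apply: eq_integral => r _.
have E v : enorm (@rV_cons R 0 (r, v)) = `|r|%R.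
  by rewrite /enorm big_ord1 mxE unlift_none/= sqrtr_sqr.
under eq_integral do rewrite E.
by rewrite integral_cst//= diracE mem_set// mule1.
Qed.

(** The real-valued integral takes the default value 0 when it is infinite, so finiteness is needed
    as well as positivity. The integrand is bounded below on [1, 2]; it is at most r^(a-1) on ]0, 1]
    and K r^(-2) beyond. *)
Lemma Gamma_gt0 (a : R) : (0 < a)%R -> (0 < Gamma a)%R.
Proof.
move=> a0; pose g (r : R) : R := (r `^ (a - 1) * expR (- r))%R.
have mg : measurable_fun setT g.
  apply: measurable_funM; first exact: measurable_powR.
  by apply: measurableT_comp => //; exact: measurable_funN.
have g0 r : (0 <= g r)%R by rewrite mulr_ge0// ?powR_ge0// expR_ge0.
rewrite /Gamma /Rintegral; apply: fine_gt0; apply/andP; split.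
- apply: (@lt_le_trans _ _
    (\int[lebesgue_measure]_(r in `[1%R, 2%R]) (2 `^ (- `|a - 1|) * expR (- 2))%:E)).
    rewrite integral_cst//= lebesgue_measure_itv/= lte_fin ltr1n.
    by rewrite -EFinB -EFinM lte_fin !mulr_gt0// ?powR_gt0// ?expR_gt0//; lra.
  apply: (@le_trans _ _ (\int[lebesgue_measure]_(r in `[1%R, 2%R]) (g r)%:E)).
    apply: ge0_le_integral => //.
    + by apply/measurable_EFinP/measurable_funTS.
    + move=> r /=; rewrite in_itv/= => /andP[r1 r2]; rewrite lee_fin.
      apply: ler_pM; rewrite ?powR_ge0 ?expR_ge0//; last first.
        by rewrite ler_expR lerN2.
      have r0 : (0 < r)%R by rewrite (lt_le_trans _ r1).
      apply: (@le_trans _ _ (r `^ (- `|a - 1|))%R); last first.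
        by apply: ler_powR => //; rewrite lerNl -normrN ler_norm.
      rewrite !powRN lef_pV2 ?posrE ?powR_gt0//.
      by apply: ge0_ler_powR; rewrite ?nnegrE// (le_trans _ r1).
  apply: ge0_subset_integral => //.
  + by apply/measurable_EFinP/measurable_funTS.
  + by move=> r _; rewrite lee_fin.
  + by move=> r /=; rewrite !in_itv/= => /andP[r1 _]; rewrite andbT (lt_le_trans _ r1).
- pose pm p := @enorm_powR_measure R 1 p.
  (* From r^(m+1) <= (m+1)! e^r with m + 1 >= a + 1 one gets e^(-r) <= K r^(-a-1) for r > 1. *)
  have [K HK] : exists K : R, forall r, (1 < r)%R -> (g r <= K * r `^ (- 2))%R.
    have [m am] : exists m : nat, (a + 1 <= m.+1%:R)%R.
      exists (Num.truncn (a + 1)); apply/ltW; exact: truncnS_gt.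
    exists (m.+1)`!%:R => r r1; have r0 : (0 < r)%R by lra.
    rewrite /g expRN ler_pdivrMr ?expR_gt0//.
    have H : (r ^+ m.+1 <= m.+1`!%:R * expR r)%R.
      have := expR_ge1Dxn m (ltW r0).
      move=> H1; rewrite mulrC -ler_pdivrMr ?ltr0n ?fact_gt0//.
      by apply: le_trans H1; rewrite lerDr.
    rewrite mulrAC mulrC.
    have -> : (r `^ (a - 1) = r `^ (- 2) * r `^ (a + 1))%R.
      by rewrite -powRD; [congr powR; lra|rewrite (gt_eqF r0) implybT].
    rewrite ler_wpM2l ?powR_ge0//.
    apply: le_trans H; rewrite -powR_mulrn ?(ltW r0)//.
    by apply: ler_powR => //; exact: ltW.
  have K0 : (0 <= K)%R.
    have := HK 2%R ltac:(lra); rewrite -ler_pdivrMr ?powR_gt0//.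
    by apply: le_trans; rewrite divr_ge0// powR_ge0.
  pose F (r : R) : \bar R := ((if 0 < r <= 1 then r `^ (a - 1) else 0) +
     (if 1 < r then K * r `^ (- 2) else 0))%:E.
  have mF1 : measurable_fun setT (fun r : R => if 0 < r <= 1 then r `^ (a - 1) else 0)%R.
    apply: measurable_fun_ifT; [|exact: measurable_powR|exact: measurable_cst].
    by apply: measurable_and; [exact: measurable_fun_ltr|exact: measurable_fun_ler].
  have mF2 : measurable_fun setT (fun r : R => if 1 < r then K * r `^ (- 2) else 0)%R.
    apply: measurable_fun_ifT; [exact: measurable_fun_ltr| |exact: measurable_cst].
    by apply: measurable_funM => //; exact: measurable_powR.
  have mF : measurable_fun setT F by apply/measurable_EFinP/measurable_funD.
  have F10 (r : R) : (0 <= if 0 < r <= 1 then r `^ (a - 1) else 0)%R.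
    by case: ifP => // _; exact: powR_ge0.
  have F20 (r : R) : (0 <= if 1 < r then K * r `^ (- 2) else 0)%R.
    by case: ifP => // _; rewrite mulr_ge0// powR_ge0.
  have F0 r : 0 <= F r by rewrite lee_fin addr_ge0.
  apply: (@le_lt_trans _ _ (\int[lebesgue_measure]_(r in `]0%R, +oo[) F `|r|%R)).
    apply: ge0_le_integral => //.
    + by move=> r _; rewrite lee_fin; exact: g0.
    + by apply/measurable_EFinP/measurable_funTS.
    + by apply/measurable_funTS; apply: measurableT_comp.
    + move=> r /=; rewrite in_itv/= andbT => r0; rewrite lee_fin gtr0_norm// r0/=.
      have [r1|r1] := leP r 1%R; last by rewrite add0r; exact: HK.
      by rewrite addr0 /g ler_piMr ?powR_ge0// -(expR0) ler_expR oppr_le0 ltW.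
  apply: (@le_lt_trans _ _ (\int[lebesgue_measure]_r F `|r|%R)).
    by apply: ge0_subset_integral => //; apply: measurableT_comp.
  rewrite -(ge0_integral_rV1 mF F0) /F.
  under eq_integral do rewrite EFinD.
  rewrite ge0_integralD//; last 4 first.
  + by move=> x _; rewrite lee_fin.
  + apply/measurable_EFinP; apply: (measurableT_comp mF1); exact: measurable_enorm.
  + by move=> x _; rewrite lee_fin.
  + apply/measurable_EFinP; apply: (measurableT_comp mF2); exact: measurable_enorm.
  apply: lte_add_pinfty.
  + apply: (@le_lt_trans _ _ (pm (a - 1)%R [set x | 0 < enorm x <= 1]%R)).
      rewrite /pm /enorm_powR_measure /density [leRHS]integral_mkcond.
      apply: ge0_le_integral => //.
      * by move=> x _; rewrite lee_fin.
      * apply/measurable_EFinP; apply: (measurableT_comp mF1); exact: measurable_enorm.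
      * apply/(measurable_restrictT _ _).1 => //.
          have -> : [set x : 'rV[R]_1 | 0 < enorm x <= 1]%R =
            [set x | `]0%R, 1%R]%classic (enorm x)].
            by apply/seteqP; split => x; rewrite /= in_itv.
          exact: measurable_enorm_set.
        by apply/measurable_EFinP/measurable_funTS; exact: measurable_enorm_powR.
      * move=> x _; rewrite patchE; case: ifPn => Hx; first by rewrite mem_set.
        by case: ifP => // _; rewrite ?mule_ge0// lee_fin ?powR_ge0.
    apply: le_lt_trans (enorm_powR_inner (n := 1) (p := a - 1) _ ltr01) _.
      by lra.
    exact: ltry.
  + apply: (@le_lt_trans _ _ (K%:E * pm (- 2)%R [set x | 1 < enorm x]%R)).
      rewrite /pm /enorm_powR_measure /density -ge0_integralZl//; last 3 first.
      * have -> : [set x : 'rV[R]_1 | 1 < enorm x]%R =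
            [set x | `]1%R, +oo[%classic (enorm x)].
          by apply/seteqP; split => x; rewrite /= in_itv/= andbT.
        exact: measurable_enorm_set.
      * by apply/measurable_EFinP/measurable_funTS; exact: measurable_enorm_powR.
      * by move=> x _; rewrite lee_fin powR_ge0.
      rewrite [leRHS]integral_mkcond; apply: ge0_le_integral => //.
      * by move=> x _; rewrite lee_fin.
      * apply/measurable_EFinP; apply: (measurableT_comp mF2); exact: measurable_enorm.
      * apply/(measurable_restrictT _ _).1 => //.
          have -> : [set x : 'rV[R]_1 | 1 < enorm x]%R =
            [set x | `]1%R, +oo[%classic (enorm x)].
            by apply/seteqP; split => x; rewrite /= in_itv/= andbT.
          exact: measurable_enorm_set.
        apply: emeasurable_funM => //.
        by apply/measurable_EFinP/measurable_funTS; exact: measurable_enorm_powR.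
      * move=> x _; rewrite patchE; case: ifPn => Hx; first by rewrite mem_set.
        by case: ifP => // _; rewrite ?mule_ge0// lee_fin ?powR_ge0.
    rewrite lte_mul_pinfty ?lee_fin//.
    apply: le_lt_trans (enorm_powR_outer (n := 1) (p := - 2) _ ltr01) _.
      by lra.
    exact: ltry.
Qed.

End Gamma_gt0.

(** * The truncated Levy measure and the fractional Laplacian *)

Section integral_density.
Local Open Scope ereal_scope.
Context d (T : measurableType d) (R : realType).
Variables (mu : {measure set T -> \bar R}) (g : T -> R).
Hypotheses (g0 : forall x, (0 <= g x)%R) (mg : measurable_fun setT g).

Lemma integral_density (f : T -> \bar R) : measurable_fun setT f ->
  \int[density mu g0 mg]_x f x = \int[mu]_x (f x * (g x)%:E).
Proof.
move=> mf; rewrite [LHS]integralE [RHS]integralE; congr (_ - _).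
- rewrite ge0_integral_density//; last exact: measurable_funepos.
  apply: eq_integral => x _; rewrite !funeposE.
  by rewrite maxeMl ?lee_fin// mul0e.
- rewrite ge0_integral_density//; last exact: measurable_funeneg.
  apply: eq_integral => x _; rewrite !funenegE -mulNe.
  by rewrite maxeMl ?lee_fin// mul0e.
Qed.

End integral_density.

Section integral_subl.
Context {R : realType}.

Lemma integral_rV_subl n (h : 'rV[R]_n) (f : 'rV[R]_n -> \bar R) :
  measurable_fun setT f ->
  (\int[lebesgue_rV n]_x f (h - x)%R = \int[lebesgue_rV n]_x f x)%E.
Proof.
move=> mf; rewrite [LHS]integralE [RHS]integralE; congr (_ - _)%E.
- have mp := measurable_funepos mf.
  rewrite -(ge0_integral_rV_subl h mp)//.
  by apply: eq_integral => x _; rewrite !funeposE.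
- have mp := measurable_funeneg mf.
  rewrite -(ge0_integral_rV_subl h mp)//.
  by apply: eq_integral => x _; rewrite !funenegE.
Qed.

End integral_subl.

Section levy_measure.
Context {R : realType} {n : nat}.
Variable s : R.
Hypothesis hs : 0 < s < 1.

Local Notation kappa := (@frac_const R n s).
Local Notation q := (n%:R + 2 * s).

Lemma frac_const_gt0 : 0 < kappa.
Proof.
have /andP[s0 s1] := hs; have n0 : 0 <= n%:R / 2 :> R by rewrite divr_ge0.
rewrite /frac_const divr_gt0// !mulr_gt0 ?powR_gt0 ?Gamma_gt0 ?pi_gt0//; lra.
Qed.

Lemma levy_density_ge0 (y : 'rV[R]_n) : 0 <= levy_density s y.
Proof. by rewrite mulr_ge0// ?powR_ge0// ltW// frac_const_gt0. Qed.

Lemma measurable_levy_density : measurable_fun setT (@levy_density R n s).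
Proof. by apply: measurable_funM => //; exact: measurable_enorm_powR. Qed.

Lemma measurable_enorm_gt (e : R) : measurable [set y : 'rV[R]_n | e < enorm y].
Proof.
have -> : [set x : 'rV[R]_n | e < enorm x] =
    [set x | `]e, +oo[%classic (enorm x)].
  by apply/seteqP; split => x; rewrite /= in_itv/= andbT.
exact: measurable_enorm_set.
Qed.

Definition trunc_levy_density (e : R) (y : 'rV[R]_n) : R :=
  levy_density s y * \1_[set y | e < enorm y] y.

Lemma trunc_levy_density_ge0 e y : 0 <= trunc_levy_density e y.
Proof. by rewrite mulr_ge0// levy_density_ge0. Qed.

Lemma measurable_trunc_levy_density e :
  measurable_fun setT (trunc_levy_density e).
Proof.
apply: measurable_funM; first exact: measurable_levy_density.
by apply: measurable_indic; exact: measurable_enorm_gt.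
Qed.

(** The Levy measure of the jumps larger than [e]. Positivity of [e] makes it finite and is an
    argument so that the finite measure structure can be attached. *)
Definition levy_measure (e : R) of 0 < e :=
  density (lebesgue_rV n) (trunc_levy_density_ge0 e)
    (measurable_trunc_levy_density e).

HB.instance Definition _ (e : R) (he : 0 < e) := Measure.on (levy_measure he).

Lemma levy_measureE (e : R) (he : 0 < e) (A : set 'rV[R]_n) :
  levy_measure he A =
  (\int[lebesgue_rV n]_(y in A `&` [set y | (e < enorm y)%R]) (levy_density s y)%:E)%E.
Proof.
rewrite /levy_measure /density integral_mkcondr.
by apply: eq_integral => y _; rewrite epatch_indic EFinM.
Qed.

Lemma levy_measure_outer (e : R) (he : 0 < e) :
  levy_measure he setT =
  (kappa%:E * enorm_powR_measure (n := n) (- q) [set y | (e < enorm y)%R])%E.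
Proof.
rewrite levy_measureE setTI /enorm_powR_measure /density -ge0_integralZl//.
- exact: measurable_enorm_gt.
- by apply/measurable_EFinP/measurable_funTS; exact: measurable_enorm_powR.
- by move=> y _; rewrite lee_fin powR_ge0.
- by rewrite lee_fin ltW// frac_const_gt0.
Qed.

Lemma levy_measure_fin (e : R) (he : 0 < e) : (levy_measure he setT < +oo)%E.
Proof.
rewrite levy_measure_outer lte_mul_pinfty ?lee_fin ?ltW ?frac_const_gt0//.
apply: le_lt_trans (enorm_powR_outer _ he) _; last exact: ltry.
by have := hs; lra.
Qed.

HB.instance Definition _ (e : R) (he : 0 < e) :=
  @Measure_isFinite.Build _ _ _ (levy_measure he)
   (lty_fin_num_fun (levy_measure_fin he)).

(** The jump rate of the truncated process. *)
Definition levy_mass (e : R) (he : 0 < e) : R := fine (levy_measure he setT).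

Lemma levy_measureT (e : R) (he : 0 < e) :
  levy_measure he setT = (levy_mass he)%:E.
Proof. by rewrite fineK// ge0_fin_numE// levy_measure_fin. Qed.

(** Makes the mean time between two jumps O(e^(2s)), the origin of the first term of the error
    bound. *)
Lemma levy_mass_ge (e : R) (he : 0 < e) : (0 < n)%N ->
  kappa * (2 * n%:R) `^ (- q) * e `^ (- (2 * s)) <= levy_mass he.
Proof.
move=> n0; rewrite -lee_fin -levy_measureT levy_measure_outer -mulrA EFinM.
rewrite lee_pmul2l ?lte_fin ?frac_const_gt0//.
have /andP[s0 s1] := hs; have := @enorm_powR_outer_ge R n (- q) e n0 _ he.
rewrite (_ : n%:R + - q = - (2 * s)); last by lra.
by apply; rewrite oppr_le0 addr_ge0//; lra.
Qed.

Lemma measurable_bounded_enorm_div (f : 'rV[R]_n -> R) :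
  measurable_fun setT f ->
  measurable_fun setT (fun z => f z / enorm z `^ q).
Proof.
move=> mf; apply: measurable_funM => //.
apply: (@eq_measurable_fun _ _ _ _ _ (fun z => enorm z `^ (- q))).
  by move=> z _; rewrite powRN.
exact: measurable_enorm_powR.
Qed.

Lemma integrable_enorm_div (f : 'rV[R]_n -> R) (M e : R) : 0 < e ->
  measurable_fun setT f -> (forall z, `|f z| <= M) ->
  (lebesgue_rV n).-integrable [set z | e < enorm z]
    (EFin \o (fun z => f z / enorm z `^ q)).
Proof.
move=> e0 mf fM; have mE := measurable_enorm_gt e.
have M0 : 0 <= M by exact: le_trans (fM 0).
apply/integrableP; split.
  by apply/measurable_EFinP/measurable_funTS; exact: measurable_bounded_enorm_div.
apply: (@le_lt_trans _ _
    (M%:E * enorm_powR_measure (n := n) (- q) [set y | (e < enorm y)%R])%E).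
  rewrite /enorm_powR_measure /density -ge0_integralZl//; last 2 first.
  - by apply/measurable_EFinP/measurable_funTS; exact: measurable_enorm_powR.
  - by move=> y _; rewrite lee_fin powR_ge0.
  apply: ge0_le_integral => //.
  - apply: measurableT_comp => //.
    by apply/measurable_EFinP/measurable_funTS; exact: measurable_bounded_enorm_div.
  - apply: emeasurable_funM => //.
    by apply/measurable_EFinP/measurable_funTS; exact: measurable_enorm_powR.
  - move=> z _; rewrite -EFinM/= lee_fin normrM normfV powRN.
    by rewrite (ger0_norm (powR_ge0 _ _)) ler_wpM2r// invr_ge0 powR_ge0.
rewrite lte_mul_pinfty ?lee_fin//.
apply: le_lt_trans (enorm_powR_outer _ e0) _; last exact: ltry.
by have := hs; lra.
Qed.

Lemma measurable_addl_rV (x : 'rV[R]_n) (v : 'rV[R]_n -> R) :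
  measurable_fun setT v -> measurable_fun setT (fun z => v (x + z)).
Proof.
move=> mv; apply: measurableT_comp => //; apply: measurable_fun_rV => i.
apply: (@eq_measurable_fun _ _ _ _ _ (fun z => x ord0 i + rV_coord i z)).
  by move=> z _; rewrite mxE.
by apply: measurable_funD => //; exact: measurable_rV_coord.
Qed.

Lemma Rintegral_rV_subl (h : 'rV[R]_n) (D : set 'rV[R]_n) (f : 'rV[R]_n -> R) :
  measurable D -> measurable_fun setT f ->
  \int[lebesgue_rV n]_(z in [set z | D (h - z)]) f (h - z) =
  \int[lebesgue_rV n]_(z in D) f z.
Proof.
move=> mD mf; rewrite [LHS]Rintegral_mkcond [RHS]Rintegral_mkcond.
congr fine.
rewrite -(@integral_rV_subl _ _ h (fun z => ((f \_ D) z)%:E)); last first.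
  apply/measurable_EFinP; have mDf : measurable_fun D f by exact: measurable_funTS.
  by move/(measurable_restrictT f mD) : mDf.
by apply: eq_integral => z _; congr EFin; rewrite !patchE.
Qed.

(** Substitutes y = x + z, a translation obtained as the reflection at 0 followed by the one
    exchanging z and x - z. *)
Lemma pv_integralE (v : 'rV[R]_n -> R) (x : 'rV[R]_n) (e : R) :
  measurable_fun setT v ->
  pv_integral s v x e =
  \int[lebesgue_rV n]_(z in [set z | e < enorm z])
     ((v x - v (x + z)) / enorm z `^ q).
Proof.
move=> mv; have mE := measurable_enorm_gt e.
have mf : measurable_fun setT (fun z => (v x - v (x + z)) / enorm z `^ q).
  apply: measurable_bounded_enorm_div; apply: measurable_funB => //.
  exact: measurable_addl_rV.
rewrite -[RHS](Rintegral_rV_subl 0 mE mf).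
have mE' : measurable [set z : 'rV[R]_n | e < enorm (0 - z)].
  by under eq_set => z do rewrite sub0r enormN.
have mf' : measurable_fun setT (fun z : 'rV[R]_n =>
    (v x - v (x + (0 - z))) / enorm (0 - z) `^ q).
  apply: (measurableT_comp mf); exact: measurable_subl_rV.
rewrite -[RHS](Rintegral_rV_subl x mE' mf').
have E z : 0 - (x - z) = z - x by rewrite sub0r opprB.
rewrite /pv_integral.
have -> : [set y | e < enorm (x - y)] = [set z | e < enorm (0 - (x - z))].
  by apply/seteqP; split => z /=; rewrite E -enormN opprB.
apply: eq_Rintegral => z _.
have -> : x + (0 - (x - z)) = z by rewrite E addrC subrK.
by rewrite E -(enormN (z - x)) opprB.
Qed.

Lemma Rintegral_levy_measure (e : R) (he : 0 < e) (f : 'rV[R]_n -> R) (M : R) :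
  measurable_fun setT f -> (forall z, `|f z| <= M) ->
  \int[levy_measure he]_z f z =
  kappa * \int[lebesgue_rV n]_(z in [set z | e < enorm z]) (f z / enorm z `^ q).
Proof.
move=> mf fM; rewrite -RintegralZl//; last 2 first.
- exact: measurable_enorm_gt.
- exact: integrable_enorm_div fM.
rewrite /Rintegral; congr fine; rewrite integral_density; last exact/measurable_EFinP.
rewrite [RHS]integral_mkcond; apply: eq_integral => z _.
rewrite epatch_indic -EFinM; congr EFin.
rewrite /trunc_levy_density /levy_density powRN.
by ring.
Qed.

Lemma pv_integral_levy (v : 'rV[R]_n -> R) (x : 'rV[R]_n) (e M : R) (he : 0 < e) :
  measurable_fun setT v -> (forall z, `|v z| <= M) ->
  kappa * pv_integral s v x e = - \int[levy_measure he]_z (v (x + z) - v x).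
Proof.
move=> mv vM; have mxv := measurable_addl_rV x mv.
have mf : measurable_fun setT (fun z => v (x + z) - v x).
  by apply: measurable_funB.
have fM z : `|v (x + z) - v x| <= M + M.
  by apply: le_trans (ler_normB _ _) _; exact: lerD.
rewrite (Rintegral_levy_measure he mf fM) -mulrN; congr (_ * _).
rewrite pv_integralE// -mulN1r -RintegralZl//; last 2 first.
- exact: measurable_enorm_gt.
- exact: integrable_enorm_div fM.
by apply: eq_Rintegral => z _; rewrite mulN1r -mulNr opprB.
Qed.

(* The gradient term is odd, so it does not contribute to the integral over the
   symmetric shell [d < |z| <= e]. *)
Lemma pv_integral_diff (v L : 'rV[R]_n -> R) (x : 'rV[R]_n) (d e M ML C beta : R) :
  0 < d -> d < e -> 2 * s < beta ->
  measurable_fun setT v -> (forall z, `|v z| <= M) ->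
  measurable_fun setT L -> (forall z, L (- z) = - L z) ->
  (forall z, enorm z <= e -> `|L z| <= ML) -> 0 <= C ->
  (forall z, `|v (x + z) - v x - L z| <= C * enorm z `^ beta) ->
  `|pv_integral s v x d - pv_integral s v x e| <=
  C * fine (enorm_powR_measure (n := n) (beta - q) [set z | 0 < enorm z <= e]).
Proof.
move=> d0 de sb mv vM mL LN LM C0 vC; have e0 : 0 < e by exact: lt_trans de.
have mxv := measurable_addl_rV x mv.
pose D : set 'rV[R]_n := [set z | d < enorm z <= e].
have mD : measurable D.
  have -> : D = [set z | `]d, e]%classic (enorm z)].
    by apply/seteqP; split => z; rewrite /D /= in_itv.
  exact: measurable_enorm_set.
pose f z := (v x - v (x + z)) / enorm z `^ q.
have fM z : `|v x - v (x + z)| <= M + M.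
  by apply: le_trans (ler_normB _ _) _; exact: lerD.
have mvx : measurable_fun setT (fun z => v x - v (x + z)) by exact: measurable_funB.
have fint := integrable_enorm_div d0 mvx fM.
have DU : [set z : 'rV[R]_n | d < enorm z] = D `|` [set z | e < enorm z].
  apply/seteqP; split => z /=; rewrite /D /=.
    by move=> ->; case: (leP (enorm z) e) => H; [left|right].
  by move=> [/andP[]//|]; exact: lt_trans.
have Dd : [disjoint D & [set z | e < enorm z]].
  apply/disj_setPS => z [/= /andP[_ ze] ez].
  by have := le_lt_trans ze ez; rewrite ltxx.
have mE := measurable_enorm_gt e.
rewrite !pv_integralE// DU Rintegral_setU//; last by rewrite -DU.
rewrite addrK.
have DS : D `<=` [set z | d < enorm z] by move=> z /andP[].
have mEd := measurable_enorm_gt d.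
(* The linear term is bounded only on bounded sets; cutting it off to the shell makes it bounded and
   keeps it odd. *)
pose LD z := L z * \1_D z.
have mLD : measurable_fun setT LD.
  by apply: measurable_funM => //; exact: measurable_indic.
have ML0 : 0 <= ML.
  apply: le_trans (LM 0 _); rewrite ?normr_ge0//.
  by apply: le_trans (ltW e0); rewrite -(scale0r 0) enormZ normr0 mul0r.
have LDM z : `|LD z| <= ML.
  rewrite /LD indicE; case: (boolP (z \in D)) => [/set_mem /andP[_ ze]|_].
    by rewrite mulr1 LM.
  by rewrite mulr0 normr0.
have LDint := integrable_enorm_div d0 mLD LDM.
have LDintD := integrableS mEd mD DS LDint.
have fintD := integrableS mEd mD DS fint.
(* The reflection z -> -z preserves the shell and changes the sign of the integral, which therefore
   vanishes. *)
have IL0 : \int[lebesgue_rV n]_(z in D) (LD z / enorm z `^ q) = 0.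
  have mg : measurable_fun setT (fun z => LD z / enorm z `^ q).
    exact: measurable_bounded_enorm_div.
  have := Rintegral_rV_subl 0 mD mg.
  have -> : [set z | D (0 - z)] = D.
    by apply/seteqP; split => z; rewrite /D /= sub0r enormN.
  have -> : \int[lebesgue_rV n]_(z in D) (LD (0 - z) / enorm (0 - z) `^ q) =
      \int[lebesgue_rV n]_(z in D) (-1 * (LD z / enorm z `^ q)); last first.
    by rewrite RintegralZl// => H; lra.
  apply: eq_Rintegral => z _; rewrite sub0r enormN /LD LN mulN1r !mulNr.
  rewrite !indicE (_ : (- z \in D) = (z \in D))//.
  by apply/idP/idP => /set_mem H; apply/mem_set; move: H; rewrite /D /= enormN.
pose r z := v (x + z) - v x - L z.
have H1 : \int[lebesgue_rV n]_(z in D) f z + 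
   \int[lebesgue_rV n]_(z in D) (LD z / enorm z `^ q) =
   \int[lebesgue_rV n]_(z in D) (- r z / enorm z `^ q).
  rewrite -RintegralD//; apply: eq_Rintegral => z zD.
  by rewrite /f /LD /r indicE zD mulr1 -mulrDl; congr (_ / _); ring.
move: H1; rewrite IL0 addr0 => ->.
have rint : (lebesgue_rV n).-integrable D (EFin \o (fun z => - r z / enorm z `^ q)).
  have := integrableD mD fintD LDintD; apply: eq_integrable => // z zD.
  by rewrite /= -EFinD /f /LD /r indicE zD mulr1 -mulrDl; congr (_ / _)%:E; ring.
apply: le_trans (le_normr_Rintegral mD rint) _.
have A0 : (enorm_powR_measure (n := n) (beta - q) [set z | (0 < enorm z <= e)%R]
   < +oo)%E.
  by apply: le_lt_trans (enorm_powR_inner _ e0) _; [lra|exact: ltry].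
have mA : measurable [set z : 'rV[R]_n | 0 < enorm z <= e].
  have -> : [set z : 'rV[R]_n | 0 < enorm z <= e] = [set z | `]0, e]%classic (enorm z)].
    by apply/seteqP; split => z; rewrite /= in_itv.
  exact: measurable_enorm_set.
rewrite -lee_fin EFinM [X in (_ <= _ * X)%E]fineK; last by rewrite ge0_fin_numE.
rewrite [X in (X <= _)%E]fineK; last first.
  apply: integrable_fin_num => //; have := integrable_abse rint.
  by apply: eq_integrable.
rewrite /enorm_powR_measure /density -ge0_integralZl//; last 2 first.
- by apply/measurable_EFinP/measurable_funTS; exact: measurable_enorm_powR.
- by move=> y _; rewrite lee_fin powR_ge0.
apply: (@le_trans _ _ (\int[lebesgue_rV n]_(z in D)
    (C%:E * (enorm z `^ (beta - q))%:E))%E).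
  apply: ge0_le_integral => //.
  - by have /integrableP[] := integrable_abse rint.
  - apply: emeasurable_funM => //.
    by apply/measurable_EFinP/measurable_funTS; exact: measurable_enorm_powR.
  - move=> z /andP[dz ze]; rewrite -EFinM lee_fin.
    have z0 : 0 < enorm z by exact: lt_trans dz.
    rewrite powRD; last by rewrite (gt_eqF z0) implybT.
    rewrite powRN mulrA normrM normrN normfV (ger0_norm (powR_ge0 _ _)).
    by rewrite ler_wpM2r ?invr_ge0 ?powR_ge0//; exact: vC.
apply: ge0_subset_integral => //.
- apply: emeasurable_funM => //.
  by apply/measurable_EFinP/measurable_funTS; exact: measurable_enorm_powR.
- by move=> z _; rewrite -EFinM lee_fin mulr_ge0// powR_ge0.
- by move=> z /andP[dz ze]; rewrite /= ze (lt_trans d0 dz).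
Qed.

(** Let the inner radius of [pv_integral_diff] tend to 0. The constant depends neither on the
    function nor on the point nor on [e]. Convergence of the principal value is assumed because
    [lim] has a default value otherwise. *)
Lemma frac_laplacian_error (beta : R) : 2 * s < beta ->
  exists2 K : R, 0 <= K & forall (v L : 'rV[R]_n -> R) (x : 'rV[R]_n) (e M C : R)
    (he : 0 < e),
  measurable_fun setT v -> (forall z, `|v z| <= M) ->
  measurable_fun setT L -> (forall z, L (- z) = - L z) ->
  (forall r : R, exists ML, forall z, enorm z <= r -> `|L z| <= ML) -> 0 <= C ->
  (forall z, `|v (x + z) - v x - L z| <= C * enorm z `^ beta) ->
  cvg (pv_integral s v x d @[d --> 0^'+]) ->
  `|frac_laplacian s v x + \int[levy_measure he]_z (v (x + z) - v x)| <=
  K * C * e `^ (beta - 2 * s).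
Proof.
move=> sb; pose p := beta - q.
have p0 : 0 < n%:R + p by rewrite /p; lra.
pose K1 : R := 4 ^+ n * 2 `^ `|p| / (1 - 2 `^ (- (n%:R + p))).
(* The absolute value makes the constant visibly nonnegative. *)
exists (kappa * `|K1|); first by rewrite mulr_ge0// ltW// frac_const_gt0.
move=> v L x e M C he mv vM mL LN LM C0 vC cpv.
have [ML LML] := LM e.
have -> : \int[levy_measure he]_z (v (x + z) - v x) = - (kappa * pv_integral s v x e).
  by rewrite (pv_integral_levy x he mv vM) opprK.
rewrite /frac_laplacian -mulrBr normrM (gtr0_norm frac_const_gt0).
have k0 := frac_const_gt0; have [k kE] : exists k, k = kappa by exists kappa.
rewrite -kE in k0 *.
rewrite -!mulrA ler_pM2l//.
have key d : 0 < d < e -> `|pv_integral s v x d - pv_integral s v x e| <=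
    C * (K1 * e `^ (n%:R + p)).
  move=> /andP[d0 de].
  apply: le_trans (pv_integral_diff d0 de sb mv vM mL LN LML C0 vC) _.
  rewrite ler_wpM2l// -lee_fin fineK; first exact: enorm_powR_inner.
  rewrite ge0_fin_numE//; apply: le_lt_trans (enorm_powR_inner p0 he) _.
  exact: ltry.
apply: (@le_trans _ _ (C * (K1 * e `^ (n%:R + p)))); last first.
  have -> : n%:R + p = beta - 2 * s by rewrite /p; lra.
  by rewrite mulrCA ler_wpM2r ?mulr_ge0 ?powR_ge0// ler_norm.
have cn : `|pv_integral s v x d - pv_integral s v x e| @[d --> 0^'+] -->
    `|lim (pv_integral s v x d @[d --> 0^'+]) - pv_integral s v x e|.
  by apply: cvg_norm; apply: cvgB => //; exact: cvg_cst.
rewrite -(cvg_lim _ cn)//.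
apply: limr_le; first by apply/cvg_ex; eexists; exact: cn.
near=> d; apply: key; apply/andP; split; near: d.
  exact: nbhs_right_gt.
exact: nbhs_right_lt.
Unshelve. all: by end_near. Qed.

End levy_measure.

(** * Lipschitz and Hoelder estimates *)

Section coordinate_mvt.
Context {R : realType} {n : nat}.

Lemma derivable_line (f : 'rV[R]_n -> R) (p e : 'rV[R]_n) (r : R) :
  derivable f (p + r *: e) e ->
  is_derive r 1 (fun a => f (p + a *: e)) ('D_e f (p + r *: e)).
Proof.
move=> df.
have E : (fun h : R => h^-1 *: (((fun a => f (p + a *: e)) \o shift r) (h *: 1) -
      f (p + r *: e))) =
    (fun h : R => h^-1 *: ((f \o shift (p + r *: e)) (h *: e) - f (p + r *: e))).
  apply/funext => h /=; congr (_ *: (f _ - _)).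
  by rewrite [h *: 1]mulr1 scalerDl addrCA addrA addrC addrA.
by split; [rewrite /derivable E|rewrite /derive E].
Qed.

Lemma mvt_line (f : 'rV[R]_n -> R) (p e : 'rV[R]_n) (a : R) :
  (forall x, derivable f x e) ->
  exists2 r : R, `|r| <= `|a| & f (p + a *: e) - f p = a * 'D_e f (p + r *: e).
Proof.
move=> df; pose g r := f (p + r *: e).
have dg (r : R) : is_derive r (1 : R) g ('D_e f (p + r *: e)) by exact: derivable_line.
have cg (r1 r2 : R) : {within `[r1, r2], continuous g}.
  apply: continuous_subspaceT => r; apply/differentiable_continuous.
  by apply/derivable1_diffP; have [] := dg r.
have g0 : g 0 = f p by rewrite /g scale0r addr0.
have [a0|a0] := leP 0 a.
  have [r] := MVT_segment a0 (fun x _ => dg x) (cg 0 a).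
  rewrite in_itv/= => /andP[r0 ra]; rewrite g0 subr0 => gE; exists r.
    by rewrite !ger0_norm.
  by rewrite -/(g a) gE mulrC.
have [r] := MVT_segment (ltW a0) (fun x _ => dg x) (cg a 0).
rewrite in_itv/= => /andP[ra r0]; rewrite g0 sub0r => gE; exists r.
  by rewrite !ler0_norm ?lerN2// ltW.
by rewrite -opprB -/(g a) gE mulrN opprK mulrC.
Qed.

Lemma ler_enorm (x y : 'rV[R]_n) : (forall i, `|x ord0 i| <= `|y ord0 i|) ->
  enorm x <= enorm y.
Proof.
move=> xy; rewrite ler_sqrt ?sumr_ge0// => [|i _]; last exact: sqr_ge0.
apply: ler_sum => i _; rewrite -[leLHS]real_normK ?num_real//.
by rewrite -[leRHS]real_normK ?num_real// lerXn2r ?nnegrE.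
Qed.

(** Only derivatives along the axes are given, so the coordinates are changed one at a time, each
    with its own intermediate point. *)
Lemma mvt_coordinates (f : 'rV[R]_n -> R) (x h : 'rV[R]_n) :
  (forall i y, derivable f y (delta_mx ord0 i)) ->
  exists2 xi : 'I_n -> 'rV[R]_n, forall i, enorm (xi i - x) <= enorm h &
    f (x + h) - f x = \sum_(i < n) h ord0 i * partial i f (xi i).
Proof.
(* The first [k] coordinates have been moved, the others not yet. *)
move=> df; pose p (k : nat) : 'rV[R]_n := \row_i (if (i < k)%N then h ord0 i else 0).
have step (i : 'I_n) : exists y, enorm (y - x) <= enorm h /\
    f (x + p i.+1) - f (x + p i) = h ord0 i * partial i f y.
  have [r ra fE] := mvt_line (x + p i) (h ord0 i) (df i).
  exists (x + p i + r *: delta_mx ord0 i); split.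
    have -> : x + p i + r *: delta_mx ord0 i - x = p i + r *: delta_mx ord0 i.
      by rewrite -(addrA x) (addrC x) addrK.
    apply: ler_enorm => j; rewrite !mxE/=.
    have [->|ji] := eqVneq j i; first by rewrite ltnn add0r mulr1.
    by rewrite mulr0 addr0; case: ifP => // _; rewrite normr0.
  rewrite -fE -addrA; congr (f (x + _) - _).
  apply/rowP => j; rewrite !mxE/= ltnS leq_eqVlt.
  rewrite -[(nat_of_ord j == nat_of_ord i)]/(j == i); have [->|ji] := eqVneq j i.
    by rewrite ltnn add0r mulr1.
  by rewrite mulr0 addr0.
have [xi Hxi] := choice step; exists xi => [i|]; first by have [] := Hxi i.
rewrite (eq_bigr (fun i : 'I_n => f (x + p i.+1) - f (x + p i))); last first.
  by move=> i _; have [_ ->] := Hxi i.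
rewrite -(big_mkord xpredT (fun i => f (x + p i.+1) - f (x + p i))).
rewrite telescope_sumr//; congr (f _ - f _).
  by congr (_ + _); apply/rowP => j; rewrite mxE ltn_ord.
by rewrite -[LHS]addr0; congr (_ + _); apply/rowP => j; rewrite !mxE.
Qed.

Lemma lipschitz_of_partial (f : 'rV[R]_n -> R) (M : R) (x h : 'rV[R]_n) :
  (forall i y, derivable f y (delta_mx ord0 i)) ->
  (forall i y, `|partial i f y| <= M) ->
  `|f (x + h) - f x| <= n%:R * M * enorm h.
Proof.
move=> df fM; have [xi _ ->] := mvt_coordinates x h df.
apply: le_trans (ler_norm_sum _ _ _) _.
apply: (@le_trans _ _ (\sum_(i < n) (M * enorm h))); last first.
  by rewrite sumr_const card_ord -(mulr_natl (M * enorm h)) mulrA.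
by apply: ler_sum => i _; rewrite normrM mulrC ler_pM ?ler_coord_enorm.
Qed.

(** The intermediate points of [mvt_coordinates] lie within |h| of [x], so each partial derivative
    there differs from the one at [x] by at most H |h|^a. *)
Lemma taylor_of_holder (f : 'rV[R]_n -> R) (H a : R) (x h : 'rV[R]_n) :
  0 <= a -> 0 <= H ->
  (forall i y, derivable f y (delta_mx ord0 i)) ->
  (forall i y, `|partial i f (x + y) - partial i f x| <= H * enorm y `^ a) ->
  `|f (x + h) - f x - \sum_(i < n) h ord0 i * partial i f x| <=
  n%:R * H * enorm h `^ (a + 1).
Proof.
move=> a0 H0 df fH; have [xi xih ->] := mvt_coordinates x h df.
rewrite -sumrB; apply: le_trans (ler_norm_sum _ _ _) _.
apply: (@le_trans _ _ (\sum_(i < n) (H * enorm h `^ (a + 1)))); last first.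
  by rewrite sumr_const card_ord -(mulr_natl (H * _)) mulrA.
apply: ler_sum => i _; rewrite -mulrBr normrM.
have -> : enorm h `^ (a + 1) = enorm h `^ a * enorm h.
  rewrite powRD ?powRr1 ?enorm_ge0//.
  by rewrite gt_eqF// ltr_wpDl.
rewrite mulrA mulrC ler_pM ?ler_coord_enorm//.
have -> : xi i = x + (xi i - x) by rewrite addrC subrK.
apply: le_trans (fH _ _) _; rewrite ler_wpM2l//.
by apply: ge0_ler_powR; rewrite ?nnegrE ?enorm_ge0.
Qed.

End coordinate_mvt.

Section time_derivative.
Context {R : realType} {n : nat}.
Variable T : R.
Implicit Types (u : R -> 'rV[R]_n -> R).

(** In the interior of [0, T] the filter restricted to [0, T] is the punctured neighbourhood
    filter. *)
Lemma dt_is_derive u t x : 0 < t < T -> dt_derivable T u t x ->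
  is_derive t 1 (fun r => u r x) (dt T u t x).
Proof.
move=> t0T du.
have qE : (fun h : R => h^-1 *: (((fun r => u r x) \o shift t) (h *: 1) - u t x)) =
    (fun h => dt_quotient u t x (h + t)).
  apply/funext => h; rewrite /dt_quotient /= [h *: 1]mulr1 addrK.
  by rewrite [LHS]mulrC.
have cq : dt_quotient u t x (h + t) @[h --> 0^'] --> dt T u t x.
  move/cvgrPdist_lt : du => du; apply/cvgrPdist_lt => e e0.
  have {du} := du e e0; rewrite /dt_filter => -[d /= d0 H].
  have dd0 : 0 < Num.min d (Num.min t (T - t)).
    by rewrite !lt_min d0; lra.
  exists (Num.min d (Num.min t (T - t))) => //= h.
  rewrite /ball_/= sub0r normrN !lt_min => /and3P[hd ht hT] h0.
  apply: H => /=; first by rewrite opprD addrCA subrr addr0 normrN.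
  split; first by move: ht hT; rewrite !ltr_norml; lra.
  by apply: contra_neq h0 => h0; lra.
split; first by rewrite /derivable qE; apply/cvg_ex; eexists; exact: cq.
by rewrite /derive qE; apply/cvg_lim.
Qed.

(** A convergent difference quotient is bounded near [t]; this also covers the endpoints, where the
    derivative is one-sided. *)
Lemma dt_continuous u t x : 0 <= t <= T -> dt_derivable T u t x ->
  forall e : R, 0 < e -> exists2 d : R, 0 < d &
    forall r, 0 <= r <= T -> `|r - t| < d -> `|u r x - u t x| < e.
Proof.
move=> tT; rewrite /dt_derivable => du e e0.
move/cvgrPdist_lt : du => /(_ 1 ltr01) [d /= d0 H].
set l := lim _ in H.
have l0 : 0 < `|l| + 1 by rewrite ltr_wpDl.
exists (Num.min d (e / (`|l| + 1))); first by rewrite lt_min d0 divr_gt0.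
move=> r rT; rewrite lt_min => /andP[rd re].
have [->|rt] := eqVneq r t; first by rewrite subrr normr0.
have := H r; rewrite /= distrC => /(_ rd (conj rT rt)) Hr.
have rt0 : 0 < `|r - t| by rewrite normr_gt0 subr_eq0.
have qle : `|dt_quotient u t x r| < `|l| + 1.
  rewrite distrC in Hr; have := ler_normB (dt_quotient u t x r - l) (- l).
  by rewrite opprK subrK normrN; lra.
have -> : u r x - u t x = dt_quotient u t x r * (r - t).
  by rewrite /dt_quotient divfK// subr_eq0.
rewrite normrM; apply: (@lt_trans _ _ ((`|l| + 1) * `|r - t|)).
  by rewrite ltr_pM2r.
by rewrite mulrC -ltr_pdivlMr.
Qed.

Lemma within_continuous_itv (a b : R) (g : R -> R) :
  (forall t, a <= t <= b -> forall e : R, 0 < e -> exists2 d : R, 0 < d &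
    forall r, a <= r <= b -> `|r - t| < d -> `|g r - g t| < e) ->
  {within `[a, b], continuous g}.
Proof.
move=> H; apply/subspace_continuousP => t; rewrite /= in_itv/= => tab.
apply/cvgrPdist_lt => e e0; have [d d0 Hd] := H t tab e e0.
exists d => //= r rd rab; rewrite distrC; apply: Hd.
  by move: rab; rewrite in_itv.
by rewrite distrC.
Qed.

End time_derivative.

Section space_time_lipschitz.
Context {R : realType} {n : nat}.
Variable T : R.

(** Mean value theorem in time at the point [y], then coordinatewise in space at time [t]; the
    factor n + 1 accounts for both. *)
Lemma lipschitz_space_time (u : R -> 'rV[R]_n -> R) :
  bounded_with_derivatives T u ->
  exists2 M : R, 0 <= M & forall t r x y, 0 <= t <= T -> 0 <= r <= T ->
    `|u t x| <= M /\ `|u r y - u t x| <= M * (`|r - t| + enorm (y - x)).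
Proof.
move=> [M0 HM]; pose M := `|M0|.
have MM : M0 <= M by exact: ler_norm.
have MnM : M <= (n%:R + 1) * M by rewrite ler_peMl ?normr_ge0// lerDr.
exists ((n%:R + 1) * M); first by rewrite mulr_ge0 ?addr_ge0 ?normr_ge0.
move=> t r x y tT rT; split.
  by have [H _ _] := HM t x tT; rewrite (le_trans H)// (le_trans MM).
have timeL a b z : 0 <= a -> a <= b -> b <= T -> `|u b z - u a z| <= M * (b - a).
  move=> a0 ab bT; pose g q := u q z.
  have dg q : q \in `]a, b[ -> is_derive q (1 : R) g (dt T u q z).
    rewrite in_itv/= => /andP[aq qb]; apply: dt_is_derive.
      by rewrite (le_lt_trans a0)//= (lt_le_trans qb).
    by have [_ [] ] := HM q z ltac:(lra).
  have cg : {within `[a, b], continuous g}.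
    apply: within_continuous_itv => q /andP[aq qb] e e0.
    have qT : 0 <= q <= T by lra.
    have [_ [dq _] _] := HM q z qT.
    have [d d0 Hd] := dt_continuous qT dq e0; exists d => // q' /andP[aq' q'b].
    by apply: Hd; lra.
  have [q] := MVT_segment ab dg cg; rewrite in_itv/= => qab; rewrite /g => ->.
  rewrite normrM [X in _ * X]ger0_norm ?subr_ge0// ler_wpM2r ?subr_ge0//.
  by have [_ [_ H] _] := HM q z ltac:(lra); rewrite (le_trans H).
have time z : `|u r z - u t z| <= M * `|r - t|.
  have [tr|rt] := leP t r.
    by rewrite [`|r - t|]ger0_norm ?subr_ge0//; apply: timeL => //; lra.
  rewrite distrC [`|r - t|]ltr0_norm ?subr_lt0// opprB.
  by apply: timeL; lra.
have space : `|u t y - u t x| <= n%:R * M * enorm (y - x).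
  rewrite -{1}(subrK x y) (addrC _ x).
  apply: lipschitz_of_partial => i z; have [_ _ /(_ i) [Hd Hb]] := HM t z tT.
    exact: Hd.
  exact: le_trans Hb MM.
have -> : u r y - u t x = (u r y - u t y) + (u t y - u t x) by ring.
apply: le_trans (ler_normD _ _) _; rewrite mulrDr; apply: lerD.
  by apply: le_trans (time y) _; rewrite ler_wpM2r.
by apply: le_trans space _; rewrite ler_wpM2r ?enorm_ge0// ler_wpM2r ?normr_ge0// lerDl.
Qed.

End space_time_lipschitz.

Section holder_space_theory.
Context {R : realType} {n : nat}.

Lemma foldr_partial (g : 'I_n -> nat) (v : 'rV[R]_n -> R) (s : seq 'I_n) :
  (forall i, g i = 0%N) ->
  foldr (fun i w => iter (g i) (partial i) w) v s = v.
Proof. by move=> g0; elim: s => //= i s ->; rewrite g0. Qed.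

Lemma foldr_partial1 (g : 'I_n -> nat) (v : 'rV[R]_n -> R) (j : 'I_n) (s : seq 'I_n) :
  uniq s -> (forall i, g i = (i == j)) ->
  foldr (fun i w => iter (g i) (partial i) w) v s =
  if j \in s then partial j v else v.
Proof.
move=> us gE; elim: s us => //= i s IH /andP[si us].
rewrite IH// in_cons gE eq_sym; have [ij|//] := eqVneq j i.
by move: si; rewrite -ij => /negbTE ->.
Qed.

(** For 1 < beta < 2 the integer part of beta is 1, so only the multi-indices of order 0 and 1 enter
    the Hoelder norm. *)
Definition mindex0 : multi_index (n := n) 1 := [ffun => ord0].
Definition mindex1 (j : 'I_n) : multi_index (n := n) 1 := [ffun i => inord (i == j)].

Lemma mpartial_mindex0 (v : 'rV[R]_n -> R) : mpartial mindex0 v = v.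
Proof. by rewrite /mpartial foldr_partial// => i; rewrite ffunE. Qed.

Lemma mpartial_mindex1 j (v : 'rV[R]_n -> R) :
  mpartial (mindex1 j) v = partial j v.
Proof.
have gE i : nat_of_ord (mindex1 j i) = (i == j).
  by rewrite ffunE inordK//; case: (i == j).
by rewrite /mpartial (foldr_partial1 v (enum_uniq 'I_n) gE) mem_enum.
Qed.

Lemma order_mindex0 : order mindex0 = 0%N.
Proof. by rewrite /order big1// => i _; rewrite ffunE. Qed.

Lemma order_mindex1 j : order (mindex1 j) = 1%N.
Proof.
rewrite /order (bigD1 j)//= ffunE eqxx inordK// big1// => i ij.
by rewrite ffunE (negbTE ij) inordK.
Qed.

(** All terms of the norm are nonnegative, hence each is at most the finite sum [M]. *)
Lemma holder_spaceP (T beta : R) (u : R -> 'rV[R]_n -> R) :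
  (0 < n)%N -> 0 <= T -> 1 < beta < 2 -> holder_space T beta u ->
  exists2 M : R, 0 <= M & forall t, 0 <= t <= T ->
   [/\ forall x, `|u t x| <= M,
       forall i x, derivable (u t) x (delta_mx ord0 i),
       forall i x, `|partial i (u t) x| <= M &
       forall i x h, `|partial i (u t) (x + h) - partial i (u t) x| <=
         M * enorm h `^ (beta - 1)].
Proof.
move=> n0 T0 b12; rewrite /holder_space /holder_norm.
have -> : Num.truncn beta = 1%N.
  by apply/eqP; rewrite truncn_eq; lra.
move=> [_ hd]; set S1 := (\sum_(_ | _) _)%E; set S2 := holder_seminorm _ _ _ _ => hS.
have h0T : 0 <= (0 : R) <= T by rewrite lexx.
have sup0 (gamma : multi_index (n := n) 1) : (0 <= sup_norm_mpartial T u gamma)%E.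
  apply: (@le_trans _ _ (`|mpartial gamma (u 0) 0|)%:E); first by rewrite lee_fin.
  by apply: ereal_sup_ubound; exists 0, 0.
have S10 : (0 <= S1)%E by apply: sume_ge0.
(* The supremum of the empty set would be -oo: a nonzero [h] exists because n > 0. *)
have S20 : (0 <= S2)%E.
  pose h : 'rV[R]_n := const_mx 1.
  have hneq0 : h != 0.
    by apply/eqP => /rowP/(_ (Ordinal n0)); rewrite !mxE => /eqP; rewrite oner_eq0.
  apply: (@le_trans _ _ (`|mpartial (mindex1 (Ordinal n0)) (u 0) (0 + h) -
       mpartial (mindex1 (Ordinal n0)) (u 0) 0| / enorm h `^ (beta - 1%:R))%:E).
    by rewrite lee_fin divr_ge0 ?powR_ge0.
  apply: ereal_sup_ubound; exists (mindex1 (Ordinal n0)), 0, 0, h; split => //.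
  exact: order_mindex1.
have S1oo : (S1 < +oo)%E by apply: le_lt_trans hS; rewrite leeDl.
have S2oo : (S2 < +oo)%E by apply: le_lt_trans hS; rewrite leeDr.
have S1fin : S1 \is a fin_num by rewrite ge0_fin_numE.
have S2fin : S2 \is a fin_num by rewrite ge0_fin_numE.
pose M := fine S1 + fine S2.
have S1M : fine S1 <= M by rewrite lerDl fine_ge0.
have S2M : fine S2 <= M by rewrite lerDr fine_ge0.
have bd (gamma : multi_index (n := n) 1) t x : (order gamma <= 1)%N -> 0 <= t <= T ->
    `|mpartial gamma (u t) x| <= M.
  move=> g1 tT; apply: le_trans S1M; rewrite -lee_fin fineK//.
  apply: (@le_trans _ _ (sup_norm_mpartial T u gamma)).
    by apply: ereal_sup_ubound; exists t, x.
  by rewrite /S1 (bigD1 gamma)//= leeDl// sume_ge0.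
exists M; first by rewrite addr_ge0 ?fine_ge0.
move=> t tT; split.
- move=> x; have := bd mindex0 t x; rewrite order_mindex0 mpartial_mindex0.
  exact.
- move=> i x; have := hd mindex0 i t x; rewrite order_mindex0 mpartial_mindex0.
  exact.
- move=> i x; have := bd (mindex1 i) t x; rewrite order_mindex1 mpartial_mindex1.
  exact.
- move=> i x h; have [->|hneq0] := eqVneq h 0.
    by rewrite addr0 subrr normr0 mulr_ge0 ?powR_ge0// addr_ge0 ?fine_ge0.
  have hp : 0 < enorm h `^ (beta - 1) by rewrite powR_gt0// enorm_gt0.
  rewrite -ler_pdivrMr//; apply: le_trans S2M; rewrite -lee_fin fineK//.
  apply: ereal_sup_ubound; exists (mindex1 i), t, x, h.
  by rewrite order_mindex1 mpartial_mindex1.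
Qed.

End holder_space_theory.

(** * The Euler flow between two jumps *)

(** A Lipschitz function is continuous; R x R^n is read as R^(n+1), for which Borel measurability of
    continuous functions has been shown. *)
Lemma lipschitz_measurable (R : realType) n (g : R -> 'rV[R]_n -> R) (K : R) :
  0 <= K ->
  (forall t r x y, `|g r y - g t x| <= K * (`|r - t| + enorm (y - x))) ->
  measurable_fun setT (fun z : R * 'rV[R]_n => g z.1 z.2).
Proof.
move=> K0 gL; pose h (v : 'rV[R]_n.+1) := g (rV_uncons v).1 (rV_uncons v).2.
have -> : (fun z : R * 'rV[R]_n => g z.1 z.2) = h \o @rV_cons R n.
  by apply/funext => z; rewrite /h /comp rV_consK.
apply: measurableT_comp; last exact: measurable_rV_cons.
apply: continuous_measurable_rV => x; apply/(@cvgrPdist_lt _ _ _ (nbhs x)) => e e0.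
pose L := K * (1 + n%:R) + 1; have L0 : 0 < L.
  by rewrite ltr_wpDl// mulr_ge0// addr_ge0.
apply/nbhs_ballP; exists (e / L) => /=; first exact: divr_gt0.
move=> y [_ xy]; have d0 : 0 <= e / L by rewrite divr_ge0// ltW.
have xyi i : `|x ord0 i - y ord0 i| <= e / L by apply: ltW; exact: xy.
apply: (@le_lt_trans _ _ (K * (1 + n%:R) * (e / L))).
  apply: le_trans (gL _ _ _ _) _; rewrite -mulrA ler_wpM2l// mulrDl mul1r.
  apply: lerD; first exact: xyi.
  by apply: enorm_le => // i; rewrite !mxE; exact: xyi.
by rewrite mulrA ltr_pdivrMr// mulrC ltr_pM2l// ltrDl.
Qed.

Lemma integrable_bounded (R : realType) d (S : measurableType d)
    (mu : {measure set S -> \bar R}) (A : set S) (g : S -> R) (M : R) :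
  measurable A -> (mu A < +oo)%E -> measurable_fun A g ->
  (forall z, A z -> `|g z| <= M) -> mu.-integrable A (EFin \o g).
Proof.
move=> mA Aoo mg gM; apply: measurable_bounded_integrable => //.
exists M; split; first exact: num_real.
by move=> M' MM' z Az; apply: le_trans (gM z Az) (ltW MM').
Qed.

Lemma Rintegral_le_cst (R : realType) d (S : measurableType d)
    (mu : {measure set S -> \bar R}) (A : set S) (g : S -> R) (M m : R) :
  measurable A -> (mu A <= m%:E)%E -> measurable_fun A g -> 0 <= M ->
  (forall z, A z -> `|g z| <= M) -> `|\int[mu]_(z in A) g z| <= M * m.
Proof.
move=> mA Am mg M0 gM; have Aoo : (mu A < +oo)%E by exact: le_lt_trans Am (ltry _).
have ig := integrable_bounded mA Aoo mg gM.
apply: le_trans (le_normr_Rintegral mA ig) _.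
apply: (@le_trans _ _ (\int[mu]_(z in A) M)); last first.
  rewrite Rintegral_cst// ler_wpM2l// -lee_fin fineK//.
  by rewrite ge0_fin_numE.
apply: le_Rintegral => //.
- by have := integrable_abse ig; apply: eq_integrable.
- by apply: (integrable_bounded (M := `|M|)).
Qed.

Lemma Rintegral_prod_set (R : realType) d1 d2 (S1 : measurableType d1) (S2 : measurableType d2)
    (m1 : {sigma_finite_measure set S1 -> \bar R})
    (m2 : {finite_measure set S2 -> \bar R}) (A : set S1) (g : S1 * S2 -> R) (M : R) :
  measurable A -> (m1 A < +oo)%E -> measurable_fun setT g ->
  (forall z, `|g z| <= M) ->
  \int[(m1 \x m2)%E]_(z in A `*` setT) g z =
  \int[m1]_(q in A) \int[m2]_w g (q, w).
Proof.
move=> mA Aoo mg gM.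
have mAT : measurable (A `*` [set: S2]) by exact: measurableX.
have m2oo (B : set S2) : measurable B -> (m2 B < +oo)%E.
  by move=> mB; rewrite -ge0_fin_numE// fin_num_measure.
have AToo : ((m1 \x m2)%E (A `*` [set: S2]) < +oo)%E.
  rewrite product_measure1E//; apply: lte_mul_pinfty => //; last exact: m2oo.
  by rewrite ge0_fin_numE.
have ig : (m1 \x m2)%E.-integrable (A `*` setT) (EFin \o g).
  by apply: (integrable_bounded (M := M)) => //; exact: measurable_funTS.
have igT : (m1 \x m2)%E.-integrable setT ((EFin \o g) \_ (A `*` setT)).
  by apply/(integrable_mkcond _ mAT).
rewrite /Rintegral integral_mkcond -(integral12_prod_meas1 igT); congr fine.
rewrite [RHS]integral_mkcond; apply: eq_integral => q _.
rewrite /fubini_F patchE; case: ifPn => qA.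
  have igq : m2.-integrable setT (fun w => (g (q, w))%:E).
    apply: (integrable_bounded (M := M)) => //; first exact: m2oo.
    have -> : (fun w => g (q, w)) = g \o pair q by [].
    by apply: measurableT_comp => //; exact: measurable_pair1.
  rewrite [in RHS]fineK; last exact: integrable_fin_num igq.
  apply: eq_integral => w _; rewrite patchE mem_set//=; split => //.
  exact/set_mem.
apply: integral0_eq => w _; rewrite patchE memNset// => -[/= Aq _].
by move: qA; rewrite mem_set.
Qed.

Lemma lebesgue_itv_oc (R : realType) (p q : R) : p <= q ->
  lebesgue_measure (`]p, q]%classic : set R) = (q - p)%:E.
Proof.
rewrite le_eqVlt => /predU1P[->|pq].
  by rewrite set_itv_ge ?bnd_simp// measure0 subrr.
by rewrite lebesgue_measure_itv/= lte_fin pq EFinB.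
Qed.

Section euler_flow.
Context {R : realType} {n : nat}.
Variables (T : R) (D : set 'rV[R]_n) (b : R -> 'rV[R]_n -> 'rV[R]_n).
Variables (c f u ut : R -> 'rV[R]_n -> R).
(** [nu] stands for the Levy measure of the jumps larger than [eps], [lam] for its mass, [a] for
    beta - 1. The bounds on the coefficients and on [u] are asked at every real time: they will be
    applied to functions extended by constants outside [0, T]. *)
Variables (nu : {finite_measure set 'rV[R]_n -> \bar R}) (K a E lam : R).
Hypotheses (T0 : 0 < T) (K0 : 0 <= K) (a0 : 0 < a) (E0 : 0 <= E).
Hypothesis nuT : nu setT = lam%:E.
Hypothesis bK : forall t x i, `|b t x ord0 i| <= K.
Hypothesis bL : forall t r x y i,
  `|b r y ord0 i - b t x ord0 i| <= K * (`|r - t| + enorm (y - x)).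
Hypothesis cK : forall t x, `|c t x| <= K.
Hypothesis cL : forall t r x y,
  `|c r y - c t x| <= K * (`|r - t| + enorm (y - x)).
Hypothesis fK : forall t x, `|f t x| <= K.
Hypothesis fL : forall t r x y,
  `|f r y - f t x| <= K * (`|r - t| + enorm (y - x)).
Hypothesis uK : forall t x, `|u t x| <= K.
Hypothesis ud : forall t i x, derivable (u t) x (delta_mx ord0 i).
Hypothesis upK : forall t i x, `|partial i (u t) x| <= K.
Hypothesis upH : forall t i x h,
  `|partial i (u t) (x + h) - partial i (u t) x| <= K * enorm h `^ a.
Hypothesis uc : forall x, continuous (u ^~ x).
Hypothesis mu2 : measurable_fun setT (fun z : R * 'rV[R]_n => u z.1 z.2).
Hypothesis udt : forall t x, 0 < t < T -> D x ->
  is_derive t (1 : R) (u ^~ x) (ut t x).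

Definition levy_increment (t : R) (x : 'rV[R]_n) : R :=
  \int[nu]_z (u t (x + z) - u t x).

(** The equation with the fractional Laplacian replaced by the generator of the large jumps, at the
    price [E]. *)
Hypothesis gen : forall t x, 0 < t < T -> D x ->
  `|ut t x + \sum_(i < n) b t x ord0 i * partial i (u t) x + c t x * u t x
    + f t x + levy_increment t x| <= E.

Lemma u_lipschitz t x h : `|u t (x + h) - u t x| <= n%:R * K * enorm h.
Proof. by apply: lipschitz_of_partial => i y; [exact: ud|exact: upK]. Qed.

Lemma lam_ge0 : 0 <= lam.
Proof. by rewrite -lee_fin -nuT. Qed.

Lemma u_line_continuous (p v : 'rV[R]_n) (tau : R) :
  continuous (fun r => u r (p + (r - tau) *: v)).
Proof.
move=> t; apply/cvgrPdist_lt => e e0.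
pose C := n%:R * K * enorm v.
have C0 : 0 <= C by rewrite !mulr_ge0 ?enorm_ge0.
have C1 : 0 < C + 1 by lra.
have /cvgrPdist_lt/(_ _ (divr_gt0 e0 (ltr0n R 2))) H := @uc (p + (t - tau) *: v) t.
near=> r.
have Hr : `|u t (p + (t - tau) *: v) - u r (p + (t - tau) *: v)| < e / 2.
  by near: r.
have rt : `|t - r| < e / 2 / (C + 1).
  by near: r; exists (e / 2 / (C + 1)) => //=; rewrite !divr_gt0.
have L : `|u r (p + (r - tau) *: v) - u r (p + (t - tau) *: v)| <= C * `|t - r|.
  have -> : p + (r - tau) *: v = p + (t - tau) *: v + (r - t) *: v.
    by rewrite -(addrA p) -scalerDl; congr (_ + _ *: _); ring.
  apply: le_trans (u_lipschitz _ _ _) _.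
  by rewrite enormZ distrC /C mulrCA mulrC.
have L2 : C * `|t - r| < e / 2.
  move: rt; rewrite ltr_pdivlMr// => rt; apply: le_lt_trans rt.
  by rewrite mulrC ler_wpM2l ?normr_ge0// lerDl.
rewrite -(subrK (u r (p + (t - tau) *: v)) (u t _)) -addrA.
apply: le_lt_trans (ler_normD _ _) _.
rewrite [X in _ + X]distrC; lra.
Unshelve. all: by end_near. Qed.

Lemma powR_near0 (C e : R) : 0 <= C -> 0 < e ->
  exists2 d : R, 0 < d & forall h : R, `|h| < d -> C * `|h| `^ a < e.
Proof.
move=> C0 e0; have C1 : 0 < C + 1 by lra.
exists ((e / (C + 1)) `^ a^-1); first exact/powR_gt0/divr_gt0.
move=> h hd; apply: (@le_lt_trans _ _ ((C + 1) * `|h| `^ a)).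
  by rewrite ler_wpM2r ?powR_ge0// lerDl.
rewrite mulrC -ltr_pdivlMr//.
have := gt0_ltr_powR a0 _ _ hd; rewrite !nnegrE normr_ge0 powR_ge0.
by rewrite -powRrM mulVf ?gt_eqF// powRr1 ?divr_ge0 ?(ltW e0) ?(ltW C1)//; exact.
Qed.

(** The gradient is continuous in time because a finite difference of step h approximates it
    uniformly in time, by the Hoelder bound, and this difference involves the values of [u] at two
    fixed points only. *)
Lemma partial_time_continuous i x : continuous (fun t => partial i (u t) x).
Proof.
move=> t; apply/cvgrPdist_lt => e e0.
(* The step is small enough for each of the two Taylor errors to cost e / 4; the two values of [u]
   will cost e / 8 each. *)
have [d d0 Hd] := powR_near0 (mulr_ge0 (ler0n R n) K0) (divr_gt0 e0 (ltr0n R 4)).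
pose h := d / 2; have h0 : 0 < h by rewrite /h; lra.
pose y : 'rV[R]_n := h *: delta_mx ord0 i.
have Ey : enorm y <= h.
  rewrite /y enormZ (gtr0_norm h0) -[leRHS]mulr1 ler_wpM2l ?(ltW h0)//.
  rewrite -[leRHS]sqrtr1 ler_sqrt// (bigD1 i)//= mxE !eqxx expr1n big1 ?addr0//.
  by move=> j ji; rewrite mxE eqxx/= (negbTE ji) expr0n.
have tay r : `|u r (x + y) - u r x - h * partial i (u r) x| <= h * (e / 4).
  have := taylor_of_holder y (ltW a0) K0 (@ud r) (fun i z => upH r i x z).
  rewrite (bigD1 i)//= !mxE !eqxx mulr1 big1 ?addr0; last first.
    by move=> j ji; rewrite !mxE eqxx/= (negbTE ji) mulr0 mul0r.
  move=> /le_trans; apply; rewrite powRD ?powRr1 ?enorm_ge0//; last first.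
    by rewrite gt_eqF// addr_gt0.
  rewrite mulrA mulrC ler_pM ?enorm_ge0 ?mulr_ge0 ?powR_ge0//.
  apply: (@le_trans _ _ (n%:R * K * `|h| `^ a)).
    rewrite ler_wpM2l ?mulr_ge0//; apply: ge0_ler_powR; rewrite ?nnegrE ?enorm_ge0 ?(ltW a0)//.
    by rewrite gtr0_norm.
  by apply/ltW/Hd; rewrite gtr0_norm// /h; lra.
have /cvgrPdist_lt/(_ _ (mulr_gt0 h0 (divr_gt0 e0 (ltr0n R 8)))) H1 := @uc (x + y) t.
have /cvgrPdist_lt/(_ _ (mulr_gt0 h0 (divr_gt0 e0 (ltr0n R 8)))) H2 := @uc x t.
near=> r.
have H3 : `|u t (x + y) - u r (x + y)| < h * (e / 8) by near: r.
have H4 : `|u t x - u r x| < h * (e / 8) by near: r.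
rewrite -(ltr_pM2l h0) -{1}(gtr0_norm h0) -normrM mulrBr.
have -> : h * partial i (u t) x - h * partial i (u r) x =
  - (u t (x + y) - u t x - h * partial i (u t) x) +
  (u r (x + y) - u r x - h * partial i (u r) x) +
  ((u t (x + y) - u r (x + y)) - (u t x - u r x)) by ring.
have T1 := tay t; have T2 := tay r.
apply: le_lt_trans (ler_normD _ _) _.
have A1 := ler_normD (- (u t (x + y) - u t x - h * partial i (u t) x))
  (u r (x + y) - u r x - h * partial i (u r) x).
have A2 := ler_normB (u t (x + y) - u r (x + y)) (u t x - u r x).
by rewrite normrN in A1; have he := mulr_gt0 h0 e0; lra.
Unshelve. all: by end_near. Qed.

(** Chain rule without joint differentiability: the increment is a time increment at the fixed point
    [x] plus a space increment at time h + r, and the latter is controlled by a Taylor bound uniform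
    in time. *)
Lemma u_line_derive (p v : 'rV[R]_n) (tau r : R) :
  0 < r < T -> D (p + (r - tau) *: v) ->
  is_derive r (1 : R) (fun r => u r (p + (r - tau) *: v))
    (ut r (p + (r - tau) *: v) +
     \sum_(i < n) v ord0 i * partial i (u r) (p + (r - tau) *: v)).
Proof.
move=> rT Dx; set x := p + (r - tau) *: v in Dx *.
pose F q := u q (p + (q - tau) *: v).
pose S t := \sum_(i < n) v ord0 i * partial i (u t) x.
have xE h : p + (h + r - tau) *: v = x + h *: v.
  by rewrite /x -(addrA p) -scalerDl; congr (_ + _ *: _); ring.
have Sc : S (h + r) @[h --> 0^'] --> S r.
  have SC : continuous S.
    move=> t; rewrite /S; apply: cvg_big => [|i _].
      by move=> [? ?]; apply: add_continuous.
    by apply: cvgM; [exact: cvg_cst|exact: partial_time_continuous].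
  have h0 : h + r @[h --> (0 : R)^'] --> r.
    rewrite -[X in _ --> X]add0r; apply: cvgD; last exact: cvg_cst.
    exact: cvg_within.
  by apply: (cvg_comp _ _ h0); exact: SC.
pose Q1 (h : R) := h^-1 * (u (h + r) (x + h *: v) - u (h + r) x).
have Q1c : Q1 h @[h --> 0^'] --> S r.
  apply/cvgrPdist_lt => e e0.
  pose C := n%:R * K * enorm v `^ (a + 1).
  have C0 : 0 <= C by rewrite !mulr_ge0 ?powR_ge0.
  have [d d0 Hd] := powR_near0 C0 (divr_gt0 e0 (ltr0n R 2)).
  move/cvgrPdist_lt : Sc => /(_ _ (divr_gt0 e0 (ltr0n R 2))) Sc.
  near=> h.
  have h0 : h != 0 by near: h; exact: nbhs_dnbhs_neq.
  have hd : `|h| < d by near: h; exact: dnbhs0_lt.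
  have Sh : `|S r - S (h + r)| < e / 2 by near: h.
  have h0' : 0 < `|h| by rewrite normr_gt0.
  have Q1S : `|Q1 h - S (h + r)| <= C * `|h| `^ a.
    rewrite -(ler_pM2l h0') -normrM mulrBr /Q1 mulVKf//.
    have -> : h * S (h + r) = \sum_(i < n) (h *: v) ord0 i * partial i (u (h + r)) x.
      by rewrite /S mulr_sumr; apply: eq_bigr => i _; rewrite !mxE mulrA.
    have := taylor_of_holder (h *: v) (ltW a0) K0 (@ud (h + r))
      (fun i z => upH (h + r) i x z).
    move=> /le_trans; apply; rewrite enormZ powRM ?normr_ge0 ?enorm_ge0//.
    rewrite [X in _ * (X * _) <= _]powRD ?powRr1 ?normr_ge0//; last first.
      by rewrite gt_eqF// addr_gt0.
    by rewrite /C le_eqVlt; apply/orP; left; apply/eqP; ring.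
  have CH := Hd _ hd.
  rewrite -(subrK (S (h + r)) (S r)) -addrA.
  apply: le_lt_trans (ler_normD _ _) _.
  by rewrite [X in _ + X]distrC; lra.
have [dd dE] := udt rT Dx.
have Q2c : h^-1 *: (((u ^~ x) \o shift r) (h *: (1 : R)) - u r x) @[h --> 0^'] --> ut r x.
  by rewrite -dE; exact: dd.
have QE : (fun h : R => h^-1 *: ((F \o shift r) (h *: (1 : R)) - F r)) =
    (fun h : R => h^-1 *: (((u ^~ x) \o shift r) (h *: (1 : R)) - u r x) + Q1 h).
  apply/funext => h; rewrite /F /Q1 /= [h *: 1]mulr1 xE -/x.
  by rewrite -[h^-1 * _]/(h^-1 *: _) -scalerDr; congr (_ *: _); ring.
have Qc : h^-1 *: ((F \o shift r) (h *: (1 : R)) - F r) @[h --> 0^'] --> ut r x + S r.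
  by rewrite QE; exact: cvgD.
split; first by apply/cvg_ex; eexists; exact: Qc.
by apply/cvg_lim => //; exact: Qc.
Unshelve. all: by end_near. Qed.

Lemma measurable_u t : measurable_fun setT (u t).
Proof.
have -> : u t = (fun z : R * 'rV[R]_n => u z.1 z.2) \o pair t by [].
by apply: measurableT_comp => //; exact: measurable_pair1.
Qed.


Lemma levy_integrand_bound t x z : `|u t (x + z) - u t x| <= 2 * K.
Proof.
apply: le_trans (ler_normB _ _) _.
by rewrite mulr_natl mulr2n; apply: lerD; exact: uK.
Qed.

Lemma measurable_levy_integrand t x :
  measurable_fun setT (fun z : 'rV[R]_n => u t (x + z) - u t x).
Proof.
by apply: measurable_funB => //; apply: measurable_addl_rV; exact: measurable_u.
Qed.

Lemma nu_lty A : measurable A -> (nu A < +oo)%E.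
Proof. by move=> mA; rewrite -ge0_fin_numE// fin_num_measure. Qed.

Lemma integrable_levy t x :
  nu.-integrable setT (EFin \o (fun z => u t (x + z) - u t x)).
Proof.
apply: (integrable_bounded (M := 2 * K)) => //; first exact: nu_lty.
  exact: measurable_levy_integrand.
by move=> z _; exact: levy_integrand_bound.
Qed.

Lemma levy_increment_bound t x : `|levy_increment t x| <= 2 * K * lam.
Proof.
apply: le_trans (le_normr_Rintegral measurableT (integrable_levy t x)) _.
have -> : 2 * K * lam = \int[nu]_(z in setT) (2 * K).
  by rewrite Rintegral_cst// [X in _ = _ * fine X]nuT.
apply: le_Rintegral => //.
- by have := integrable_abse (integrable_levy t x); apply: eq_integrable.
- by apply: (integrable_bounded (M := `|2 * K|)) => //; exact: nu_lty.
- by move=> z _; exact: levy_integrand_bound.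
Qed.

(** Dominated convergence: the integrand is bounded by 2 K and [nu] is finite. *)
Lemma levy_increment_continuous (p v : 'rV[R]_n) (tau : R) :
  continuous (fun r => levy_increment r (p + (r - tau) *: v)).
Proof.
move=> r; rewrite /levy_increment.
have rI : r \in (`]r - 1, r + 1[%classic : set R).
  by rewrite inE/= in_itv/=; lra.
apply: (@continuity_under_integral _ _ _ nu
  (fun r z => u r (p + (r - tau) *: v + z) - u r (p + (r - tau) *: v))
  setT measurableT (r - 1) (r + 1) _ _ (cst (2 * K)) _ _ r rI).
- by move=> x _; exact: integrable_levy.
- apply: aeW => z _ x _; apply: cvgB; last exact: u_line_continuous.
  have -> : (fun x0 => u x0 (p + (x0 - tau) *: v + z)) =
     (fun x0 => u x0 ((p + z) + (x0 - tau) *: v)).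
    by apply/funext => x0; congr u; rewrite addrAC.
  rewrite [X in _ --> X](_ : _ = u x (p + z + (x - tau) *: v)).
    exact: u_line_continuous.
  by congr u; rewrite addrAC.
- by apply: (integrable_bounded (M := `|2 * K|)) => //; exact: nu_lty.
- by move=> x _; apply: aeW => z _; exact: levy_integrand_bound.
Qed.

Definition xlin (t : R) (x : 'rV[R]_n) (r : R) : 'rV[R]_n := x + (r - t) *: b t x.
Definition ylin (t : R) (x : 'rV[R]_n) (y r : R) : R := y + c t x * y * (r - t).
Definition zlin (t : R) (x : 'rV[R]_n) (y z r : R) : R := z + f t x * y * (r - t).
Definition payoff (t : R) x (y z r : R) : R :=
  u r (xlin t x r) * ylin t x y r + zlin t x y z r.
(** The mean rate at which jumps would change the payoff: Z is continuous across a jump, and u is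
    multiplied by the current Y. *)
Definition jump_rate t x y r : R := ylin t x y r * levy_increment r (xlin t x r).

Lemma is_derive_affine (p k t r : R) :
  is_derive r (1 : R) (fun q : R => p + k * (q - t)) k.
Proof.
have QE : \forall h \near (0 : R)^', h^-1 *: (((fun q : R => p + k * (q - t)) \o shift r) (h *: (1 : R)) -
    (p + k * (r - t))) = k.
  near=> h; have h0 : h != 0 by near: h; exact: nbhs_dnbhs_neq.
  by rewrite /= [h *: 1]mulr1 -[LHS]/(h^-1 * _); field.
have Qc : h^-1 *: (((fun q : R => p + k * (q - t)) \o shift r) (h *: (1 : R)) -
    (p + k * (r - t))) @[h --> (0 : R)^'] --> k.
  apply/cvgrPdist_lt => e e0; apply: filterS QE => h ->.
  by rewrite subrr normr0.
split; first by apply/cvg_ex; eexists; exact: Qc.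
by apply/cvg_lim => //; exact: Qc.
Unshelve. all: by end_near. Qed.

Definition payoff_slope (t : R) x (y r : R) : R :=
  (ut r (xlin t x r) + \sum_(i < n) b t x ord0 i * partial i (u r) (xlin t x r)) *
    ylin t x y r + u r (xlin t x r) * (c t x * y) + f t x * y.

Lemma is_derive_payoff t x y z r : 0 < r < T -> D (xlin t x r) ->
  is_derive r (1 : R) (payoff t x y z) (payoff_slope t x y r).
Proof.
move=> rT Dx; have du := u_line_derive rT Dx.
have dy := is_derive_affine y (c t x * y) t r.
have dz := is_derive_affine z (f t x * y) t r.
have dP := is_deriveD (is_deriveM du dy) dz.
apply: is_derive_eq dP _; rewrite /payoff_slope -/(xlin t x r) -/(ylin t x y r).
by rewrite /= -![_ *: _]/(_ * _); ring.
Qed.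

(** Depends on n, K and T only, hence not on [eps]. With L = K (1 + n K), the Lipschitz constant of
    the coefficients along the flow, the first summand collects the generator and drift errors, the
    second the errors of c and f. *)
Definition flow_const : R :=
  (1 + K * T) * (1 + n%:R * K * (K * (1 + n%:R * K)))
   + (K + 1) * (K * K + K * (1 + n%:R * K) * (1 + K * T)).

Lemma flow_const_ge0 : 0 <= flow_const.
Proof.
have HT := T0; have HK := K0.
by rewrite /flow_const; do ?[rewrite ?ler0n ?ler01 ?(ltW HT) ?HK//; apply: addr_ge0 || apply: mulr_ge0].
Qed.

Lemma ylin_bound t x y r : t <= r -> `|ylin t x y r| <= `|y| * (1 + K * (r - t)).
Proof.
move=> tr; rewrite /ylin [leRHS]mulrDr mulr1; apply: le_trans (ler_normD _ _) _.
rewrite lerD2l !normrM [`|r - t|]ger0_norm ?subr_ge0// mulrA ler_wpM2r ?subr_ge0//.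
by rewrite mulrC ler_wpM2l.
Qed.

Lemma enorm_b t x : enorm (b t x) <= n%:R * K.
Proof. by apply: enorm_le => // i. Qed.

Lemma payoff_slope_error t x y r : 0 <= t <= r -> 0 < r < T -> D (xlin t x r) ->
  `|payoff_slope t x y r + jump_rate t x y r| <=
  `|y| * flow_const * ((r - t) + E).
Proof.
move=> /andP[t0 tr] /andP[r0 rT] Dx.
have rT' : 0 < r < T by rewrite r0 rT.
have HT := T0; have HK := K0; have HE := E0.
set X := xlin t x r; set A := r - t; have A0 : 0 <= A by rewrite subr_ge0.
have AT : A <= T by rewrite /A; lra.
set Yr := ylin t x y r; set u0 := u r X; set J := levy_increment r X.
have g := gen rT' Dx; rewrite -/X -/u0 -/J in g.
have Xx : enorm (X - x) <= n%:R * K * A.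
  rewrite /X /xlin addrAC subrr add0r enormZ -/A (ger0_norm A0) mulrC.
  by rewrite ler_wpM2r// enorm_b.
pose L := K * (1 + n%:R * K).
have L0 : 0 <= L by rewrite !mulr_ge0// addr_ge0// mulr_ge0.
have Lip : K * (`|r - t| + enorm (X - x)) <= L * A.
  rewrite -/A (ger0_norm A0) /L -mulrA ler_wpM2l//.
  by rewrite mulrDl mul1r lerD2l.
have bd i : `|b t x ord0 i - b r X ord0 i| <= L * A.
  by rewrite distrC; apply: le_trans (bL _ _ _ _ _) Lip.
have cd : `|c r X - c t x| <= L * A by apply: le_trans (cL _ _ _ _) Lip.
have fd : `|f r X - f t x| <= L * A by apply: le_trans (fL _ _ _ _) Lip.
have y0 := normr_ge0 y.
have Yb : `|Yr| <= `|y| * (1 + K * T).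
  apply: le_trans (ylin_bound x y tr) _; rewrite ler_wpM2l// lerD2l ler_wpM2l//.
have Yd : `|y - Yr| <= K * A * `|y|.
  rewrite /Yr /ylin opprD addrA subrr sub0r normrN !normrM -/A (ger0_norm A0).
  by rewrite mulrAC ler_wpM2r// ler_wpM2r.
pose g0 := ut r X + \sum_(i < n) b r X ord0 i * partial i (u r) X
   + c r X * u0 + f r X + J.
pose S := \sum_(i < n) (b t x ord0 i - b r X ord0 i) * partial i (u r) X.
have SE : \sum_(i < n) b t x ord0 i * partial i (u r) X =
   S + \sum_(i < n) b r X ord0 i * partial i (u r) X.
  by rewrite /S -big_split/=; apply: eq_bigr => i _; ring.
have Sb : `|S| <= n%:R * (L * A * K).
  apply: le_trans (ler_norm_sum _ _ _) _.
  apply: (@le_trans _ _ (\sum_(i < n) (L * A * K))).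
    by apply: ler_sum => i _; rewrite normrM ler_pM.
  by rewrite sumr_const card_ord -(mulr_natl (L * A * K)).
have E1 : payoff_slope t x y r + jump_rate t x y r =
   Yr * g0 + Yr * S + u0 * (c t x * (y - Yr) + (c t x - c r X) * Yr)
   + (f t x * (y - Yr) + (f t x - f r X) * Yr).
  rewrite /payoff_slope /jump_rate -/X -/Yr -/u0 -/J SE /g0; ring.
have e1 : `|Yr * g0| <= `|y| * (1 + K * T) * E.
  by rewrite normrM ler_pM// ?normr_ge0.
have e2 : `|Yr * S| <= `|y| * (1 + K * T) * (n%:R * (L * A * K)).
  by rewrite normrM ler_pM// ?normr_ge0.
have e3 (k1 k2 : R) : `|k1| <= K -> `|k2 - k1| <= L * A ->
    `|k1 * (y - Yr) + (k1 - k2) * Yr| <= K * (K * A * `|y|) + L * A * (`|y| * (1 + K * T)).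
  move=> k1K k12; apply: le_trans (ler_normD _ _) _.
  by apply: lerD; rewrite normrM ler_pM// distrC.
have e3c := e3 _ _ (cK t x) cd; have e3f := e3 _ _ (fK t x) fd.
set B := (K * (K * A * `|y|) + L * A * (`|y| * (1 + K * T))) in e3 e3c e3f.
have e4 : `|u0 * (c t x * (y - Yr) + (c t x - c r X) * Yr)| <= K * B.
  by rewrite normrM; apply: ler_pM => //; exact: uK.
rewrite E1; apply: le_trans (ler_normD _ _) _.
have e5 := ler_normD (Yr * g0 + Yr * S) (u0 * (c t x * (y - Yr) + (c t x - c r X) * Yr)).
have e6 := ler_normD (Yr * g0) (Yr * S).
apply: (@le_trans _ _ (`|y| * (1 + K * T) * E + `|y| * (1 + K * T) * (n%:R * (L * A * K)) + (K + 1) * B)).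
  by rewrite (mulrDl K 1 B) mul1r; lra.
have P0 : 0 <= 1 + K * T by rewrite addr_ge0// mulr_ge0// ltW.
have Q0 : 0 <= (1 + K * T) * (n%:R * K * L).
  by apply: mulr_ge0 => //; apply: mulr_ge0 => //; exact: mulr_ge0.
have S0 : 0 <= (K + 1) * (K * K + L * (1 + K * T)).
  by apply: mulr_ge0; apply: addr_ge0 => //; exact: mulr_ge0.
rewrite /flow_const -/L /B.
rewrite -subr_ge0; set lhs := _ - _.
have -> : lhs = `|y| * ((1 + K * T) * A + (1 + K * T) * (n%:R * K * L) * E +
    (K + 1) * (K * K + L * (1 + K * T)) * E) by rewrite /lhs; ring.
apply: mulr_ge0 => //; apply: addr_ge0; last exact: mulr_ge0.
by apply: addr_ge0; exact: mulr_ge0.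
Qed.

Lemma affine_continuous (p k t : R) : continuous (fun q : R => p + k * (q - t)).
Proof.
move=> r; apply/differentiable_continuous/derivable1_diffP.
by have [] := is_derive_affine p k t r.
Qed.

Lemma jump_rate_continuous t x y : continuous (jump_rate t x y).
Proof.
move=> r; apply: cvgM; first exact: affine_continuous.
exact: levy_increment_continuous.
Qed.

Lemma payoff_continuous t x y z : continuous (payoff t x y z).
Proof.
move=> r; apply: cvgD; last exact: affine_continuous.
by apply: cvgM; [exact: u_line_continuous|exact: affine_continuous].
Qed.

Lemma jump_rate_integrable t x y (p q : R) :
  lebesgue_measure.-integrable `[p, q]%classic (EFin \o jump_rate t x y).
Proof.
apply: continuous_compact_integrable; first exact: segment_compact.
by apply: continuous_subspaceT => r; exact: jump_rate_continuous.
Qed.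

(** Mean value theorem for the payoff plus a primitive of [jump_rate], whose derivative
    [payoff_slope_error] bounds. *)
Lemma payoff_increment t x y z t1 t2 : 0 <= t -> t <= t1 -> t1 <= t2 -> t2 <= T ->
  (forall r, t1 < r < t2 -> D (xlin t x r)) ->
  `|payoff t x y z t2 - payoff t x y z t1 +
    \int[lebesgue_measure]_(r in `]t1, t2]%classic) jump_rate t x y r| <=
  (t2 - t1) * (`|y| * flow_const * ((t2 - t) + E)).
Proof.
move=> t0 tt1; rewrite le_eqVlt => /predU1P[<-|t12] t2T Dx.
  by rewrite !subrr set_itv_ge ?bnd_simp// Rintegral_set0 addr0 normr0 mul0r.
(* The primitive starts before [t1], so that [t1] and [t2] are interior points for the fundamental
   theorem of calculus. *)
pose Fi (r : R) := \int[lebesgue_measure]_(q in `[t1 - 1, r]%classic) jump_rate t x y q.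
have dF (r : R) : t1 - 1 < r < t2 + 1 -> is_derive r (1 : R) Fi (jump_rate t x y r).
  move=> /andP[r1 r2].
  have [dFr dE] := continuous_FTC1_closed r2
    (jump_rate_integrable t x y (t1 - 1) (t2 + 1)) r1 (@jump_rate_continuous t x y r).
  by split; [exact: dFr|rewrite -[LHS]derive1E; exact: dE].
pose g r := payoff t x y z r + Fi r.
have dg r : r \in `]t1, t2[ ->
    is_derive r (1 : R) g (payoff_slope t x y r + jump_rate t x y r).
  rewrite in_itv/= => r12; apply: is_deriveD.
    by apply: is_derive_payoff; [lra|exact: Dx].
  by apply: dF; lra.
have cg : {within `[t1, t2], continuous g}.
  apply/subspace_continuousP => r; rewrite /= in_itv/= => r12.
  apply: cvg_within_filter; apply: cvgD; first exact: payoff_continuous.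
  apply/differentiable_continuous/derivable1_diffP.
  by have [] := dF r ltac:(lra).
have [r] := MVT t12 dg cg; rewrite in_itv/= => r12 gE.
have -> : payoff t x y z t2 - payoff t x y z t1 +
    \int[lebesgue_measure]_(r in `]t1, t2]%classic) jump_rate t x y r = g t2 - g t1.
  rewrite /g /Fi -(Rintegral_itvB (x := t1) (jump_rate_integrable t x y (t1 - 1) t2)).
  - by ring.
  - by rewrite bnd_simp; lra.
  - by rewrite bnd_simp ltW.
rewrite gE mulrC normrM [`|t2 - t1|]gtr0_norm ?subr_gt0// ler_pM2l ?subr_gt0//.
have slope : `|payoff_slope t x y r + jump_rate t x y r| <=
    `|y| * flow_const * ((r - t) + E).
  by apply: payoff_slope_error; [lra|lra|exact: Dx].
apply: le_trans slope _.
rewrite ler_wpM2l ?mulr_ge0 ?normr_ge0 ?flow_const_ge0//.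
by rewrite lerD2r lerD2r; lra.
Qed.

Section exit.
Hypothesis openD : open D.

(* The first exit time of the segment issued from [x] at time [t], capped at
   [T]; for [T < t] it is the junk value [t]. *)
Definition exit (t : R) (x : 'rV[R]_n) : R :=
  if t <= T then sup [set r | t <= r <= T /\ forall q, t <= q < r -> D (xlin t x q)]
  else t.

Lemma xlin_t t x : xlin t x t = x.
Proof. by rewrite /xlin subrr scale0r addr0. Qed.

Lemma xlin_near t x r : D (xlin t x r) -> exists2 d : R, 0 < d &
  forall q, `|q - r| < d -> D (xlin t x q).
Proof.
move=> Dx; have [e e0 He] := open_rVP openD Dx.
have HK := K0; exists (e / (K + 1)); first by rewrite divr_gt0//; lra.
move=> q; rewrite ltr_pdivlMr; last by lra.
move=> qr; apply: He => i; rewrite /xlin !mxE.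
have -> : x ord0 i + (r - t) * b t x ord0 i - (x ord0 i + (q - t) * b t x ord0 i) =
   - ((q - r) * b t x ord0 i) by ring.
rewrite normrN normrM; apply: le_lt_trans qr.
by rewrite ler_wpM2l// (le_trans (bK _ _ _))// lerDl.
Qed.

Section exit_facts.
Variables (t : R) (x : 'rV[R]_n).
Hypothesis tT : t <= T.
Let A := [set r | t <= r <= T /\ forall q, t <= q < r -> D (xlin t x q)].
Let At : A t.
Proof. by split => [|q]; [rewrite lexx|lra]. Qed.
Let ubA : ubound A T.
Proof. by move=> r [/andP[]]. Qed.
Let supA : has_sup A.
Proof. by split; [exists t|exists T]. Qed.
Let exitE : exit t x = sup A.
Proof. by rewrite /exit tT. Qed.

Lemma exit_ge : t <= exit t x.
Proof. by rewrite exitE; apply: ub_le_sup => //; exists T. Qed.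

Lemma exit_le : exit t x <= T.
Proof. by rewrite exitE; apply: ge_sup => //; exists t. Qed.

Lemma exit_before q : t <= q < exit t x -> D (xlin t x q).
Proof.
rewrite exitE => /andP[tq qe]; have e0 : 0 < sup A - q by rewrite subr_gt0.
have [r [_ Ar] qr] := sup_adherent e0 supA.
by apply: Ar; rewrite tq/=; lra.
Qed.

Lemma le_exit r : t <= r <= T -> (forall q, t <= q < r -> D (xlin t x q)) ->
  r <= exit t x.
Proof. by move=> rT Hr; rewrite exitE; apply: ub_le_sup => //; exists T. Qed.

(** If the flow were still in the open set at its exit time, it would stay there a little longer. *)
Lemma exit_at : exit t x < T -> ~ D (xlin t x (exit t x)).
Proof.
move=> eT De; have [d d0 Hd] := xlin_near De.
have te := exit_ge.
pose r := Num.min T (exit t x + d / 2).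
have : r <= exit t x.
  apply: le_exit => [|q /andP[tq qr]].
    by rewrite ge_min lexx andbT le_min tT/=; lra.
  have [qe|eq] := ltP q (exit t x); first by apply: exit_before; rewrite tq.
  apply: Hd; rewrite ger0_norm ?subr_ge0//.
  by move: qr; rewrite lt_min => /andP[_]; lra.
by rewrite ge_min => /orP[]; lra.
Qed.

End exit_facts.

(* The max-norm distance from [x] to the complement of [D], capped at 1. It is
   Lipschitz, so that staying in [D] along a segment is a countable condition on
   rational parameters, whence the measurability of [exit]. *)
Definition depth (x : 'rV[R]_n) : R := sup [set e | 0 <= e <= 1 /\
  forall y : 'rV[R]_n, (forall i, `|x ord0 i - y ord0 i| < e) -> D y].

Section depth_facts.
Variable x : 'rV[R]_n.
Let A := [set e : R | 0 <= e <= 1 /\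
  forall y : 'rV[R]_n, (forall i, `|x ord0 i - y ord0 i| < e) -> D y].
Hypothesis n0 : (0 < n)%N.
Let A0 : A 0.
Proof.
split; first by rewrite lexx ler01.
by move=> y /(_ (Ordinal n0)); rewrite ltNge normr_ge0.
Qed.
Let supA : has_sup A.
Proof. by split; [exists 0|exists 1 => e [/andP[]]]. Qed.

Lemma depth_gt0 : D x -> 0 < depth x.
Proof.
move=> Dx; have [e e0 He] := open_rVP openD Dx.
apply: (@lt_le_trans _ _ (Num.min e 1)); first by rewrite lt_min e0 ltr01.
apply: ub_le_sup; first by case: supA.
split; first by rewrite le_min (ltW e0) ler01/= ge_min lexx orbT.
move=> y Hy; apply: He => i; apply: lt_le_trans (Hy i) _.
by rewrite ge_min lexx.
Qed.

Lemma depth_in : 0 < depth x -> D x.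
Proof.
move=> d0; have [e [_ He] ed] := sup_adherent d0 supA.
by apply: He => i; rewrite subrr normr0; move: ed; rewrite subrr.
Qed.

Lemma depth_lip (y : 'rV[R]_n) (d : R) : 0 <= d -> (forall i, `|x ord0 i - y ord0 i| <= d) ->
  depth x <= depth y + d.
Proof.
move=> d0 xy; apply: ge_sup; first by case: supA.
move=> e [/andP[e0 e1] He].
have hy : has_sup [set e : R | 0 <= e <= 1 /\
    forall z : 'rV[R]_n, (forall i, `|y ord0 i - z ord0 i| < e) -> D z].
  split; [exists 0|by exists 1 => r [/andP[]]].
  split; first by rewrite lexx ler01.
  by move=> z /(_ (Ordinal n0)); rewrite ltNge normr_ge0.
rewrite -lerBlDr; have [ed|de] := leP e d.
  apply: (@le_trans _ _ 0); first by rewrite subr_le0.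
  apply: ub_le_sup; first by case: hy.
  split; first by rewrite lexx ler01.
  by move=> z /(_ (Ordinal n0)); rewrite ltNge normr_ge0.
apply: ub_le_sup; first by case: hy.
split; first by lra.
move=> z Hz; apply: He => i.
have -> : x ord0 i - z ord0 i = (x ord0 i - y ord0 i) + (y ord0 i - z ord0 i) by ring.
apply: le_lt_trans (ler_normD _ _) _.
by have := Hz i; have := xy i; lra.
Qed.

End depth_facts.

Lemma depth_continuous : (0 < n)%N -> continuous depth.
Proof.
move=> n0 x; apply/(@cvgrPdist_lt _ _ _ (nbhs x)) => e e0.
have e2 : 0 < e / 2 by lra.
apply/nbhs_ballP; exists (e / 2) => //= y [_ xy].
have h1 i : `|x ord0 i - y ord0 i| <= e / 2 by apply: ltW; exact: xy.
have h2 i : `|y ord0 i - x ord0 i| <= e / 2 by rewrite distrC.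
have := depth_lip n0 (ltW e2) h1; have := depth_lip n0 (ltW e2) h2.
by move=> H1 H2; rewrite ltr_norml; lra.
Qed.

(** By compactness the depth has a positive minimum along a segment in the domain; conversely a
    lower bound at rational proportions extends to the whole segment because the depth is
    Lipschitz. *)
Lemma in_segmentP (n0 : (0 < n)%N) t x r : t <= r ->
  (forall q, t <= q <= r -> D (xlin t x q)) <->
  exists j : nat, forall p : rat, 0 <= (ratr p : R) <= 1 ->
    j.+1%:R^-1 <= depth (xlin t x (t + ratr p * (r - t))).
Proof.
move=> tr; pose h q := depth (xlin t x q).
have HK := K0.
have hL q1 q2 : h q1 <= h q2 + K * `|q1 - q2|.
  apply: depth_lip => //; first by rewrite mulr_ge0.
  move=> i; rewrite /xlin !mxE.
  have -> : x ord0 i + (q1 - t) * b t x ord0 i - (x ord0 i + (q2 - t) * b t x ord0 i) =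
     (q1 - q2) * b t x ord0 i by ring.
  by rewrite normrM mulrC ler_wpM2r.
have hc : continuous h.
  move=> q; apply/cvgrPdist_lt => e e0.
  have e1 : 0 < e / (K + 1) by rewrite divr_gt0//; lra.
  exists (e / (K + 1)) => //= q'; rewrite /= ltr_pdivlMr; last by lra.
  move=> qq; have H1 := hL q q'; have H2 := hL q' q; rewrite distrC in H2.
  have H3 : K * `|q - q'| <= `|q - q'| * (K + 1).
    by rewrite mulrDr mulr1 mulrC lerDl.
  by rewrite ltr_norml; lra.
split=> [Dseg|[j Hj] q /andP[tq qr]].
  have [q0 q0r Hq0] := @EVT_min R h t r tr (continuous_subspaceT hc).
  have h0 : 0 < h q0.
    by apply: depth_gt0 => //; apply: Dseg; move: q0r; rewrite in_itv.
  have [j _ /(_ j (leqnn j)) Hj] := near_infty_natSinv_lt (PosNum h0).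
  exists j => p p01; apply: (le_trans (ltW Hj)); apply: Hq0.
  have rt : 0 <= r - t by lra.
  have h1 : 0 <= ratr p * (r - t) by rewrite mulr_ge0//; lra.
  have h2 : ratr p * (r - t) <= 1 * (r - t) by rewrite ler_wpM2r//; lra.
  by rewrite in_itv/=; lra.
apply: (depth_in n0); set e := j.+1%:R^-1 in Hj; have e0 : 0 < e by rewrite invr_gt0.
suff : e / 2 <= h q by rewrite /h; lra.
have [tr0|tr0] := eqVneq t r.
  have -> : q = t + ratr 0 * (r - t) by rewrite rmorph0 mul0r addr0; lra.
  by have := Hj 0; rewrite rmorph0 lexx ler01 => /(_ isT); rewrite -/(h _); lra.
have rt : 0 < r - t by rewrite subr_gt0 lt_neqAle tr0.
(* A proportion within [d] of the true one moves the depth by at most e / 2. *)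
pose d := e / 2 / ((K + 1) * (r - t)).
have d0 : 0 < d by rewrite !divr_gt0// mulr_gt0//; lra.
pose th := (q - t) / (r - t).
have th0 : 0 <= th by rewrite divr_ge0; lra.
have th1 : th <= 1 by rewrite ler_pdivrMr//; lra.
have [p p01 pth] : exists2 p : rat, 0 <= (ratr p : R) <= 1 & `|ratr p - th| < d.
  have [lt1|] := ltP th 1.
    have ab : th < Num.min 1 (th + d) by rewrite lt_min lt1/=; lra.
    have [p] := rat_in_itvoo ab; rewrite in_itv/= lt_min => pp.
    by exists p; [lra|rewrite ltr_norml; lra].
  move=> th1'; exists 1; rewrite rmorph1 ?ler01 ?lexx//.
  have -> : th = 1 by lra.
  by rewrite subrr normr0.
have := Hj p p01; rewrite -/(h _) => H1.
have H2 := hL (t + ratr p * (r - t)) q.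
have qE : q = t + th * (r - t) by rewrite /th divfK ?gt_eqF//; ring.
have H3 : `|t + ratr p * (r - t) - q| = `|ratr p - th| * (r - t).
  have -> : t + ratr p * (r - t) - q = (ratr p - th) * (r - t).
    by rewrite {1}qE; ring.
  by rewrite normrM (gtr0_norm rt).
have H4 : K * `|t + ratr p * (r - t) - q| <= e / 2.
  rewrite H3; apply: (@le_trans _ _ ((K + 1) * (d * (r - t)))).
    apply: ler_pM => //; first by rewrite mulr_ge0// ltW.
      by rewrite lerDl.
    by rewrite ler_wpM2r ?ltW.
  have k1 : K + 1 != 0 by lra.
  have rt' : r - t != 0 by rewrite gt_eqF.
  have -> : (K + 1) * (d * (r - t)) = e / 2 by rewrite /d; field; rewrite ?k1 ?rt'.
  by [].
by lra.
Qed.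

Section measurability.
Context d (W : measurableType d).
Variables (ft : W -> R) (fx : W -> 'rV[R]_n).
Hypotheses (mft : measurable_fun setT ft) (mfx : measurable_fun setT fx).
Hypothesis n_gt0 : (0 < n)%N.

Let mpair : measurable_fun setT (fun w => (ft w, fx w)).
Proof. exact: measurable_fun_pair. Qed.

Lemma measurable_xlin (fr : W -> R) : measurable_fun setT fr ->
  measurable_fun setT (fun w => xlin (ft w) (fx w) (fr w)).
Proof.
move=> mfr; apply: measurable_fun_rV => i.
apply: (@eq_measurable_fun _ _ _ _ _ (fun w => rV_coord i (fx w) +
   (fr w - ft w) * b (ft w) (fx w) ord0 i)).
  by move=> w _; rewrite !mxE.
apply: measurable_funD.
  by apply: measurableT_comp => //; exact: measurable_rV_coord.
apply: measurable_funM; first exact: measurable_funB.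
have mb := @lipschitz_measurable _ _ (fun t x => b t x ord0 i) K K0
  (fun t r x y => bL t r x y i).
have -> : (fun w => b (ft w) (fx w) ord0 i) =
    (fun z : R * 'rV[R]_n => b z.1 z.2 ord0 i) \o (fun w => (ft w, fx w)) by [].
exact: measurableT_comp.
Qed.

Lemma measurable_affine_flow (k : R -> 'rV[R]_n -> R) (fy fz fr : W -> R) :
  (forall t r x y, `|k r y - k t x| <= K * (`|r - t| + enorm (y - x))) ->
  measurable_fun setT fy -> measurable_fun setT fz -> measurable_fun setT fr ->
  measurable_fun setT (fun w => fz w + k (ft w) (fx w) * fy w * (fr w - ft w)).
Proof.
move=> kL mfy mfz mfr; apply: measurable_funD => //.
apply: measurable_funM; last exact: measurable_funB.
apply: measurable_funM => //.
have mk := lipschitz_measurable K0 kL.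
have -> : (fun w => k (ft w) (fx w)) =
    (fun z : R * 'rV[R]_n => k z.1 z.2) \o (fun w => (ft w, fx w)) by [].
exact: measurableT_comp.
Qed.

Lemma measurable_payoff (fy fz fr : W -> R) :
  measurable_fun setT fy -> measurable_fun setT fz -> measurable_fun setT fr ->
  measurable_fun setT (fun w => payoff (ft w) (fx w) (fy w) (fz w) (fr w)).
Proof.
move=> mfy mfz mfr; apply: measurable_funD; last exact: measurable_affine_flow.
apply: measurable_funM; last exact: measurable_affine_flow.
have -> : (fun w => u (fr w) (xlin (ft w) (fx w) (fr w))) =
    (fun z : R * 'rV[R]_n => u z.1 z.2) \o
    (fun w => (fr w, xlin (ft w) (fx w) (fr w))) by [].
apply: measurableT_comp => //; apply: measurable_fun_pair => //.
exact: measurable_xlin.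
Qed.

(** For t <= r < T, the exit comes after [r] exactly when the closed segment up to [r] lies in the
    domain, a countable condition by [in_segmentP]. The event r < t is added apart; it includes the
    junk value for t > T. *)
Lemma measurable_exit : measurable_fun setT (fun w => exit (ft w) (fx w)).
Proof.
apply: (measurability _ (RGenOInfty.measurableE R)) => _ [_ [r ->] <-].
rewrite setTI.
pose C (j : nat) (p : rat) : set W := [set w | 0 <= (ratr p : R) <= 1 ->
   j.+1%:R^-1 <= depth (xlin (ft w) (fx w) (ft w + ratr p * (r - ft w)))].
pose B : set W := if r < T then [set w | ft w <= r] `&` \bigcup_j \bigcap_p C j p
  else set0.
have -> : (fun w => exit (ft w) (fx w)) @^-1` `]r, +oo[ = [set w | r < ft w] `|` B.
  apply/seteqP; split => w; rewrite /= in_itv/= andbT.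
    move=> re; have [rt|tr] := ltP r (ft w); [by left|right].
    have [tT|Tt] := leP (ft w) T; last by move: re; rewrite /exit leNgt Tt/=; lra.
    have rT : r < T by apply: lt_le_trans re (exit_le _ tT).
    rewrite /B rT; split => //.
    have : forall q, ft w <= q <= r -> D (xlin (ft w) (fx w) q).
      by move=> q /andP[tq qr]; apply: exit_before => //; rewrite tq (le_lt_trans qr).
    by move=> /(in_segmentP n_gt0 (fx w) tr)[j Hj]; exists j => // p _; exact: Hj.
  rewrite /B; case=> [rt|].
    have [tT|Tt] := leP (ft w) T; last by rewrite /exit leNgt Tt.
    by apply: (lt_le_trans rt); exact: exit_ge.
  case: ifP => // rT [/= tr [j _ Hj]].
  have tT : ft w <= T by apply: le_trans tr (ltW rT).
  have Hin : forall q, ft w <= q <= r -> D (xlin (ft w) (fx w) q).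
    by apply/(in_segmentP n_gt0 (fx w) tr); exists j => p; exact: (Hj p).
  have : r <= exit (ft w) (fx w).
    apply: le_exit => //; first by rewrite tr ltW.
    by move=> q /andP[tq qr]; apply: Hin; rewrite tq ltW.
  (* Equality is excluded: before [T] the exit point is outside the domain, whereas the closed
     segment lies inside. *)
  rewrite le_eqVlt => /predU1P[rE|//].
  have : exit (ft w) (fx w) < T by rewrite -rE.
  by move=> /(exit_at tT); rewrite -rE; case; apply: Hin; rewrite tr lexx.
apply: measurableU.
  have -> : [set w | r < ft w] = ft @^-1` `]r, +oo[.
    by apply/seteqP; split => w; rewrite /= in_itv/= andbT.
  by rewrite -[X in measurable X]setTI; apply: mft => //; exact: measurable_itv.
rewrite /B; case: ifP => // rT; apply: measurableI.
  have -> : [set w | ft w <= r] = ft @^-1` `]-oo, r].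
    by apply/seteqP; split => w; rewrite /= in_itv.
  by rewrite -[X in measurable X]setTI; apply: mft => //; exact: measurable_itv.
apply: bigcupT_measurable => j.
rewrite -[X in measurable X]setCK setC_bigcap; apply: measurableC.
apply: bigcupT_measurable_rat => p; apply: measurableC.
rewrite /C; case: (boolP (0 <= (ratr p : R) <= 1)) => p01; last first.
  rewrite (_ : [set w | _] = setT)//.
  by apply/seteqP; split => w.
have -> : [set w | true -> j.+1%:R^-1 <= depth (xlin (ft w) (fx w) (ft w + ratr p * (r - ft w)))]
   = (fun w => depth (xlin (ft w) (fx w) (ft w + ratr p * (r - ft w)))) @^-1`
       `[j.+1%:R^-1, +oo[.
  by apply/seteqP; split => w; rewrite /= in_itv/= andbT => H; [exact: H|move=> _].
rewrite -[X in measurable X]setTI.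
have m1 : measurable_fun setT (fun w => ft w + ratr p * (r - ft w)).
  apply: measurable_funD => //; apply: measurable_funM => //.
  exact: measurable_funB.
have : measurable_fun setT (fun w => depth (xlin (ft w) (fx w) (ft w + ratr p * (r - ft w)))).
  apply: measurableT_comp; last exact: measurable_xlin.
  by apply: continuous_measurable_rV; exact: depth_continuous.
by apply => //; exact: measurable_itv.
Qed.

End measurability.

(* The time of the last jump and the values of X, Y, Z at this time. *)
Definition state := (R * 'rV[R]_n * R * R)%type.
Implicit Types (sg : state) (z : R * 'rV[R]_n).

Definition exit_of sg : R := exit sg.1.1.1 sg.1.1.2.

(** The payoff at time [r] of the flow frozen at the state, stopped at its exit. *)
Definition flow_value (r : R) sg : R :=
  payoff sg.1.1.1 sg.1.1.2 sg.1.2 sg.2 (Num.min r (exit_of sg)).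

(* A jump after the exit of the flow is ignored. *)
Definition jump_state sg z : state :=
  if z.1 <= exit_of sg then
    (z.1, xlin sg.1.1.1 sg.1.1.2 z.1 + z.2, ylin sg.1.1.1 sg.1.1.2 sg.1.2 z.1,
     zlin sg.1.1.1 sg.1.1.2 sg.1.2 sg.2 z.1)
  else sg.

Hypothesis n_gt0 : (0 < n)%N.

Lemma measurable_exit_of : measurable_fun setT exit_of.
Proof.
apply: measurable_exit => //.
  apply: measurableT_comp => //; exact: measurableT_comp.
by apply: measurableT_comp => //; exact: measurableT_comp.
Qed.

Lemma measurable_flow_value (r : R) : measurable_fun setT (flow_value r).
Proof.
have m1 : measurable_fun setT (fun sg : state => sg.1.1.1).
  by apply: measurableT_comp => //; exact: measurableT_comp.
have m2 : measurable_fun setT (fun sg : state => sg.1.1.2).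
  by apply: measurableT_comp => //; exact: measurableT_comp.
have m3 : measurable_fun setT (fun sg : state => sg.1.2) by exact: measurableT_comp.
apply: measurable_payoff => //.
by apply: measurable_minr => //; exact: measurable_exit_of.
Qed.

Lemma measurable_jump_state :
  measurable_fun setT (fun sz : state * (R * 'rV[R]_n) => jump_state sz.1 sz.2).
Proof.
have m1 : measurable_fun setT (fun sz : state * (R * 'rV[R]_n) => sz.1.1.1.1).
  by do 3 (apply: measurableT_comp => //).
have m2 : measurable_fun setT (fun sz : state * (R * 'rV[R]_n) => sz.1.1.1.2).
  by do 3 (apply: measurableT_comp => //).
have m3 : measurable_fun setT (fun sz : state * (R * 'rV[R]_n) => sz.1.1.2).
  by do 2 (apply: measurableT_comp => //).
have m4 : measurable_fun setT (fun sz : state * (R * 'rV[R]_n) => sz.1.2).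
  by do 1 (apply: measurableT_comp => //).
have m5 : measurable_fun setT (fun sz : state * (R * 'rV[R]_n) => sz.2.1).
  by do 1 (apply: measurableT_comp => //).
have m6 : measurable_fun setT (fun sz : state * (R * 'rV[R]_n) => sz.2.2).
  by do 1 (apply: measurableT_comp => //).
apply: measurable_fun_ifT => //.
- by apply: measurable_fun_ler => //; apply: measurable_exit.
- apply: measurable_fun_pair; last exact: measurable_affine_flow.
  apply: measurable_fun_pair; last exact: measurable_affine_flow.
  apply: measurable_fun_pair => //; apply: measurable_fun_rV => i.
  apply: (@eq_measurable_fun _ _ _ _ _ (fun sz : state * (R * 'rV[R]_n) =>
     rV_coord i (xlin sz.1.1.1.1 sz.1.1.1.2 sz.2.1) + rV_coord i sz.2.2)).
    by move=> w _; rewrite /rV_coord [RHS]mxE.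
  apply: measurable_funD.
    apply: measurableT_comp; first exact: measurable_rV_coord.
    exact: measurable_xlin.
  by apply: measurableT_comp => //; exact: measurable_rV_coord.
Qed.

Lemma flow_value_dead r1 r2 sg : exit_of sg <= r1 -> exit_of sg <= r2 ->
  flow_value r1 sg = flow_value r2 sg.
Proof. by move=> e1 e2; rewrite /flow_value !min_r. Qed.

(** * Mean increment of the value over one cell *)

Section one_step.
Variable t0 : R.
Hypothesis t0_ge0 : 0 <= t0.

(** Invariant of the states that occur up to time [r]: Gronwall bounds in terms of the time of the
    last jump, hence uniform in the number of jumps. *)
Definition reach (r : R) sg : Prop :=
  [/\ t0 <= sg.1.1.1 <= r, `|sg.1.2| <= expR (K * (sg.1.1.1 - t0)) &
      `|sg.2| <= K * expR (K * T) * (sg.1.1.1 - t0)].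

Let YM := expR (K * T).

(** One linear step multiplies |Y| by at most 1 + K (q - tau) <= e^(K (q - tau)), and the exponents
    add up from jump to jump. *)
Lemma reach_ylin r sg q : reach r sg -> sg.1.1.1 <= q ->
  `|ylin sg.1.1.1 sg.1.1.2 sg.1.2 q| <= expR (K * (q - t0)).
Proof.
move=> [_ HY _] tq; apply: le_trans (ylin_bound _ _ tq) _.
have -> : K * (q - t0) = K * (sg.1.1.1 - t0) + K * (q - sg.1.1.1) by ring.
rewrite expRD; apply: ler_pM => //; last exact: expR_ge1Dx.
by rewrite addr_ge0// mulr_ge0// subr_ge0.
Qed.

Lemma expR_le_YM q : q <= T -> expR (K * (q - t0)) <= YM.
Proof.
by move=> qT; have H := t0_ge0; rewrite ler_expR ler_wpM2l//; lra.
Qed.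

Lemma reach_zlin r sg q : reach r sg -> sg.1.1.1 <= q <= T ->
  `|zlin sg.1.1.1 sg.1.1.2 sg.1.2 sg.2 q| <= K * YM * (q - t0).
Proof.
move=> [/andP[H1 H2] HY HZ] /andP[tq qT].
rewrite /zlin; apply: le_trans (ler_normD _ _) _.
have -> : K * YM * (q - t0) = K * YM * (sg.1.1.1 - t0) + K * YM * (q - sg.1.1.1).
  by ring.
apply: lerD => //; rewrite normrM [`|q - _|]ger0_norm ?subr_ge0//.
rewrite ler_wpM2r ?subr_ge0// normrM ler_pM//.
by apply: le_trans HY _; apply: expR_le_YM; exact: le_trans tq qT.
Qed.

Lemma reach_jump r r' sg z : reach r sg -> r <= z.1 <= r' -> r' <= T ->
  reach r' (jump_state sg z).
Proof.
move=> Hr /andP[rz zr'] r'T; have [/andP[H1 H2] HY HZ] := Hr.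
rewrite /jump_state; case: ifP => _; last by split => //; lra.
have tz : sg.1.1.1 <= z.1 by lra.
split => /=; first by lra.
  exact: reach_ylin Hr tz.
by apply: reach_zlin Hr _; lra.
Qed.

Definition value_bound : R := K * YM + K * YM * T.

Lemma payoff_bound r sg q : reach r sg -> sg.1.1.1 <= q <= T ->
  `|payoff sg.1.1.1 sg.1.1.2 sg.1.2 sg.2 q| <= value_bound.
Proof.
move=> Hr /andP[tq qT]; apply: le_trans (ler_normD _ _) _; apply: lerD.
  rewrite normrM ler_pM//.
  by apply: le_trans (reach_ylin Hr tq) (expR_le_YM qT).
apply: le_trans (reach_zlin Hr _) _; first by rewrite tq.
rewrite ler_wpM2l ?mulr_ge0 ?expR_ge0//.
by have H := t0_ge0; lra.
Qed.

Lemma flow_value_bound r sg q : reach r sg -> r <= T -> sg.1.1.1 <= q ->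
  `|flow_value q sg| <= value_bound.
Proof.
move=> Hr rT tq; have [/andP[H1 H2] _ _] := Hr.
have tT : sg.1.1.1 <= T by lra.
apply: payoff_bound Hr _; rewrite le_min tq (exit_ge _ tT)/=.
by rewrite ge_min (exit_le _ tT) orbT.
Qed.

(** Lipschitz constant of [flow_value] in time. It grows with [lam], but it will only enter through
    terms of order h^2. *)
Definition lip_const : R := YM * flow_const * (T + E) + YM * (2 * K * lam).

Lemma jump_rate_bound r sg q : reach r sg -> sg.1.1.1 <= q <= T ->
  `|jump_rate sg.1.1.1 sg.1.1.2 sg.1.2 q| <= YM * (2 * K * lam).
Proof.
move=> Hr /andP[tq qT]; rewrite normrM ler_pM ?levy_increment_bound//.
exact: le_trans (reach_ylin Hr tq) (expR_le_YM qT).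
Qed.

Lemma YM_flow_const_ge0 : 0 <= YM * flow_const.
Proof. by rewrite mulr_ge0 ?expR_ge0 ?flow_const_ge0. Qed.

Lemma lip_const_ge0 : 0 <= lip_const.
Proof.
have H1 := T0; have H2 := E0.
rewrite addr_ge0//; apply: mulr_ge0; rewrite ?YM_flow_const_ge0 ?expR_ge0//; first by lra.
by rewrite mulr_ge0 ?lam_ge0// mulr_ge0.
Qed.

Lemma flow_increment r sg t1 t2 : reach r sg -> r <= t1 -> t1 <= t2 -> t2 <= T ->
  t1 <= exit_of sg ->
  `|flow_value t2 sg - flow_value t1 sg +
    \int[lebesgue_measure]_(q in `]t1, Num.min t2 (exit_of sg)]%classic)
      jump_rate sg.1.1.1 sg.1.1.2 sg.1.2 q| <=
  (Num.min t2 (exit_of sg) - t1) *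
  (YM * flow_const * ((Num.min t2 (exit_of sg) - sg.1.1.1) + E)).
Proof.
move=> Hr rt1 t12 t2T te; set m := Num.min t2 (exit_of sg); have [/andP[H1 H2] HY _] := Hr.
have H0 := t0_ge0; have HE := E0.
have tT : sg.1.1.1 <= T by lra.
have tm : t1 <= m by rewrite le_min t12 te.
have mT : m <= T by rewrite ge_min t2T.
rewrite /flow_value (min_l te) -/m.
have inc : `|payoff sg.1.1.1 sg.1.1.2 sg.1.2 sg.2 m -
     payoff sg.1.1.1 sg.1.1.2 sg.1.2 sg.2 t1 +
    \int[lebesgue_measure]_(q in `]t1, m]%classic)
      jump_rate sg.1.1.1 sg.1.1.2 sg.1.2 q| <=
  (m - t1) * (`|sg.1.2| * flow_const * ((m - sg.1.1.1) + E)).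
  apply: payoff_increment => //; [lra|lra|].
  move=> q /andP[q1 q2]; apply: exit_before => //; apply/andP; split; first lra.
  by apply: (lt_le_trans q2); rewrite ge_min lexx orbT.
apply: le_trans inc _; rewrite ler_wpM2l ?subr_ge0// ler_wpM2r//.
  by rewrite addr_ge0// subr_ge0; lra.
rewrite ler_wpM2r ?flow_const_ge0//; apply: le_trans HY _.
exact: expR_le_YM.
Qed.

Lemma flow_lip r sg t1 t2 : reach r sg -> r <= t1 -> t1 <= t2 -> t2 <= T ->
  `|flow_value t2 sg - flow_value t1 sg| <= (t2 - t1) * lip_const.
Proof.
move=> Hr rt1 t12 t2T; have [/andP[H1 H2] HY _] := Hr.
have H0 := t0_ge0; have HE := E0; have HT := T0.
have [te|et] := leP t1 (exit_of sg); last first.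
  rewrite (@flow_value_dead t2 t1)//; [|lra|lra].
  by rewrite subrr normr0 mulr_ge0 ?lip_const_ge0// subr_ge0.
have inc := flow_increment Hr rt1 t12 t2T te.
set m := Num.min t2 (exit_of sg) in inc.
have tm : t1 <= m by rewrite le_min t12 te.
have mt2 : m <= t2 by rewrite ge_min lexx.
set I := Rintegral _ _ _ in inc.
have Ib : `|I| <= YM * (2 * K * lam) * (m - t1).
  apply: Rintegral_le_cst => //.
  - by rewrite [X in (X <= _)%E](lebesgue_itv_oc tm).
  - apply: measurable_funTS; apply: continuous_measurable_fun => q.
    exact: jump_rate_continuous.
  - by rewrite mulr_ge0 ?expR_ge0// mulr_ge0 ?lam_ge0// mulr_ge0.
  - move=> q; rewrite /= in_itv/= => /andP[q1 q2].
    by apply: jump_rate_bound Hr _; lra.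
have -> : flow_value t2 sg - flow_value t1 sg =
  (flow_value t2 sg - flow_value t1 sg + I) - I by ring.
apply: le_trans (ler_normB _ _) _.
apply: (@le_trans _ _ ((m - t1) * lip_const)); last first.
  by rewrite ler_wpM2r ?lip_const_ge0//; lra.
rewrite /lip_const mulrDr; apply: lerD; last by rewrite mulrC.
apply: le_trans inc _; rewrite ler_wpM2l ?subr_ge0// ler_wpM2l ?YM_flow_const_ge0//.
by lra.
Qed.

(* The time since the last jump, counted only while the flow is inside [D]. *)
Definition age (r : R) sg : R := if r < exit_of sg then r - sg.1.1.1 else 0.

(** Coefficient of h^2 in the one-step error; it depends on [eps] through [lam], which is harmless
    since the mesh is refined with [eps] fixed. *)
Definition step_const : R := 2 * lip_const * lam + 2 * value_bound * lam * lam.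

Definition jump_integral (t1 t2 : R) (h : state -> R) sg : R :=
  \int[(lebesgue_measure \x nu)%E]_(z in `]t1, t2]%classic `*` setT)
    (h (jump_state sg z) - h sg).

Lemma product_strip (p q : R) : p <= q ->
  (lebesgue_measure \x nu)%E (`]p, q]%classic `*` setT) = ((q - p) * lam)%:E.
Proof. by move=> pq; rewrite product_measure1E// [X in (X * _)%E](lebesgue_itv_oc pq) [X in (_ * X)%E]nuT -EFinM. Qed.

(* [th] stands for the factor e^(- lam h) by which the law of a single jump in
   the cell differs from the intensity. *)
Lemma one_step t1 t2 sg th : reach t1 sg -> t1 <= t2 -> t2 <= T ->
  0 <= th <= 1 -> 1 - th <= lam * (t2 - t1) ->
  `|flow_value t2 sg - flow_value t1 sg + th * jump_integral t1 t2 (flow_value t2) sg| <=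
  (t2 - t1) * (YM * flow_const * (age t1 sg + (t2 - t1) + E)) +
  (t2 - t1) ^+ 2 * step_const.
Proof.
move=> Hr t12 t2T /andP[th0 th1] thl; have [/andP[H1 H2] HY _] := Hr.
have H0 := t0_ge0; have HE := E0; have HT := T0; have HK := K0; have Hl := lam_ge0.
have CL0 := lip_const_ge0.
have PM0 : 0 <= value_bound.
  by rewrite addr_ge0// ?mulr_ge0 ?expR_ge0// ltW.
have CS0 : 0 <= step_const.
  by rewrite addr_ge0// !mulr_ge0.
have tT : sg.1.1.1 <= T by lra.
have h0 : 0 <= t2 - t1 by lra.
pose A : set (R * 'rV[R]_n) := `]t1, t2]%classic `*` setT.
have mA : measurable A by exact: measurableX.
have At z : A z -> t1 < z.1 <= t2 by case=> /=; rewrite in_itv.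
rewrite /age; case: ltP => [te|et]; last first.
  (* The flow has already left the domain: its value no longer changes and later jumps are
     ignored. *)
  rewrite (@flow_value_dead t2 t1)//; last lra.
  rewrite subrr add0r.
  have -> : jump_integral t1 t2 (flow_value t2) sg = 0.
    rewrite /jump_integral (@eq_Rintegral _ _ _ _ _ (cst 0)).
      by rewrite Rintegral_cst// mul0r.
    move=> z /set_mem /At /andP[tz _]; rewrite /jump_state leNgt.
    by rewrite (le_lt_trans et tz)/= subrr.
  rewrite mulr0 normr0; apply: addr_ge0; last by rewrite mulr_ge0 ?sqr_ge0.
  apply: mulr_ge0 => //; apply: mulr_ge0; first exact: YM_flow_const_ge0.
  by rewrite add0r addr_ge0.
set e := exit_of sg in te *; pose m := Num.min t2 e.
have inc := flow_increment Hr (lexx _) t12 t2T (ltW te).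
rewrite -/e -/m in inc.
have tm : t1 <= m by rewrite le_min t12 ltW.
have mt2 : m <= t2 by rewrite ge_min lexx.
(* [H] is the effect of a jump measured at the end of the cell, [J] the same effect measured at the
   time of the jump; the integral of [J] is the one produced by [flow_increment]. *)
pose H z := flow_value t2 (jump_state sg z) - flow_value t2 sg.
pose J z : R := if z.1 <= m then
  ylin sg.1.1.1 sg.1.1.2 sg.1.2 z.1 *
    (u z.1 (xlin sg.1.1.1 sg.1.1.2 z.1 + z.2) - u z.1 (xlin sg.1.1.1 sg.1.1.2 z.1))
  else 0.
have mH : measurable_fun setT H.
  apply: measurable_funB => //.
  have -> : (fun z => flow_value t2 (jump_state sg z)) = flow_value t2 \o
    ((fun sz : state * (R * 'rV[R]_n) => jump_state sz.1 sz.2) \o pair sg) by [].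
  apply: measurableT_comp; first exact: measurable_flow_value.
  apply: measurableT_comp; first exact: measurable_jump_state.
  exact: measurable_pair1.
have mxl : measurable_fun setT (fun z : R * 'rV[R]_n => xlin sg.1.1.1 sg.1.1.2 z.1).
  by apply: measurable_xlin.
have mJ : measurable_fun setT J.
  apply: measurable_fun_ifT => //.
    by apply: measurable_fun_ler.
  apply: measurable_funM; first exact: measurable_affine_flow.
  apply: measurable_funB.
    have -> : (fun z : R * 'rV[R]_n => u z.1 (xlin sg.1.1.1 sg.1.1.2 z.1 + z.2)) =
      (fun z : R * 'rV[R]_n => u z.1 z.2) \o
      (fun z : R * 'rV[R]_n => (z.1, xlin sg.1.1.1 sg.1.1.2 z.1 + z.2)) by [].
    apply: measurableT_comp => //; apply: measurable_fun_pair => //.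
    apply: measurable_fun_rV => i.
    apply: (@eq_measurable_fun _ _ _ _ _ (fun z : R * 'rV[R]_n =>
       rV_coord i (xlin sg.1.1.1 sg.1.1.2 z.1) + rV_coord i z.2)).
      by move=> w _; rewrite /rV_coord [RHS]mxE.
    apply: measurable_funD.
      by apply: measurableT_comp => //; exact: measurable_rV_coord.
    by apply: measurableT_comp => //; exact: measurable_rV_coord.
  have -> : (fun z : R * 'rV[R]_n => u z.1 (xlin sg.1.1.1 sg.1.1.2 z.1)) =
      (fun z : R * 'rV[R]_n => u z.1 z.2) \o
      (fun z : R * 'rV[R]_n => (z.1, xlin sg.1.1.1 sg.1.1.2 z.1)) by [].
  by apply: measurableT_comp => //; exact: measurable_fun_pair.
have HJ z : A z -> `|H z - J z| <= 2 * lip_const * (t2 - t1).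
  move=> /At /andP[tz zt]; rewrite /H /J /jump_state -/e.
  have [ze|ez] := leP z.1 e; last first.
    by rewrite subrr ifF ?subrr ?normr0 ?mulr_ge0// le_min (leNgt z.1 e) ez andbF.
  rewrite ifT; last by rewrite le_min zt.
  set s' := (_, _, _, _).
  have Hr' : reach z.1 s'.
    have := reach_jump (z := z) Hr _ _; rewrite /jump_state ifT//.
    by apply; [rewrite lexx andbT ltW|exact: le_trans t2T].
  have L1 := flow_lip Hr' (lexx _) zt t2T.
  have L2 := flow_lip Hr (ltW tz) zt t2T.
  have E1 : flow_value z.1 s' = u z.1 (xlin sg.1.1.1 sg.1.1.2 z.1 + z.2) *
      ylin sg.1.1.1 sg.1.1.2 sg.1.2 z.1 + zlin sg.1.1.1 sg.1.1.2 sg.1.2 sg.2 z.1.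
    rewrite /flow_value /s' /exit_of /= min_l; last by apply: exit_ge; exact: le_trans t2T.
    by rewrite /payoff xlin_t {1}/ylin {1}/zlin subrr !mulr0 !addr0.
  have E2 : flow_value z.1 sg = u z.1 (xlin sg.1.1.1 sg.1.1.2 z.1) *
      ylin sg.1.1.1 sg.1.1.2 sg.1.2 z.1 + zlin sg.1.1.1 sg.1.1.2 sg.1.2 sg.2 z.1.
    by rewrite /flow_value min_l.
  have -> : flow_value t2 s' - flow_value t2 sg -
    ylin sg.1.1.1 sg.1.1.2 sg.1.2 z.1 *
    (u z.1 (xlin sg.1.1.1 sg.1.1.2 z.1 + z.2) - u z.1 (xlin sg.1.1.1 sg.1.1.2 z.1)) =
    (flow_value t2 s' - flow_value z.1 s') - (flow_value t2 sg - flow_value z.1 sg).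
    by rewrite E1 E2; ring.
  apply: le_trans (ler_normB _ _) _.
  have L3 : (t2 - z.1) * lip_const <= (t2 - t1) * lip_const.
    by rewrite ler_wpM2r// lerD2l lerN2 ltW.
  apply: le_trans (lerD (le_trans L1 L3) (le_trans L2 L3)) _.
  by rewrite -(mulrA 2) (mulrC lip_const) mulr_natl mulr2n.
have HM z : A z -> `|H z| <= 2 * value_bound.
  move=> /At /andP[tz zt]; apply: le_trans (ler_normB _ _) _.
  have F1 : `|flow_value t2 sg| <= value_bound.
    by apply: (flow_value_bound Hr); [exact: le_trans t12 t2T|exact: le_trans H2 t12].
  have Hr' : reach t2 (jump_state sg z) by apply: reach_jump Hr _ _; [rewrite ltW|].
  have F2 : `|flow_value t2 (jump_state sg z)| <= value_bound.
    by have [/andP[_ Hb] _ _] := Hr'; exact: (flow_value_bound Hr' t2T Hb).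
  by rewrite mulr_natl mulr2n; exact: lerD.
have mu_A : ((lebesgue_measure \x nu)%E A <= ((t2 - t1) * lam)%:E)%E.
  by rewrite product_strip.
have A_oo : ((lebesgue_measure \x nu)%E A < +oo)%E by apply: le_lt_trans mu_A (ltry _).
have JM z : A z -> `|J z| <= 2 * value_bound + 2 * lip_const * (t2 - t1).
  move=> Az; have := HJ z Az; have := HM z Az.
  have -> : J z = H z - (H z - J z) by ring.
  have := ler_normB (H z) (H z - J z).
  have -> : H z - (H z - J z) = J z by ring.
  by lra.
have iH : (lebesgue_measure \x nu)%E.-integrable A (EFin \o H).
  by apply: (integrable_bounded (M := 2 * value_bound)) => //; exact: measurable_funTS.
have iJ : (lebesgue_measure \x nu)%E.-integrable A (EFin \o J).
  apply: (integrable_bounded (M := 2 * value_bound + 2 * lip_const * (t2 - t1))) => //.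
  exact: measurable_funTS.
have IH : `|jump_integral t1 t2 (flow_value t2) sg| <= 2 * value_bound * ((t2 - t1) * lam).
  by apply: Rintegral_le_cst => //; [exact: measurable_funTS|rewrite mulr_ge0].
set IJ := \int[(lebesgue_measure \x nu)%E]_(z in A) J z.
have IHJ : `|jump_integral t1 t2 (flow_value t2) sg - IJ| <=
    2 * lip_const * (t2 - t1) * ((t2 - t1) * lam).
  rewrite /jump_integral /IJ -RintegralB//.
  apply: Rintegral_le_cst => //; last by rewrite !mulr_ge0.
  by apply: measurable_funTS; exact: measurable_funB.
have IJE : IJ = \int[lebesgue_measure]_(q in `]t1, m]%classic)
    jump_rate sg.1.1.1 sg.1.1.2 sg.1.2 q.
  pose Jc (z : R * 'rV[R]_n) := J z * \1_(`]t1, t2]%classic) z.1.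
  have mJc : measurable_fun setT Jc.
    apply: measurable_funM => //.
    have mi : measurable_fun setT (\1_(`]t1, t2]%classic) : R -> R).
      by apply: measurable_indic; exact: measurable_itv.
    by apply: (measurableT_comp mi); exact: measurable_fst.
  have -> : IJ = \int[(lebesgue_measure \x nu)%E]_(z in A) Jc z.
    apply: eq_Rintegral => z /set_mem [/= Az _].
    by rewrite /Jc indicE mem_set// mulr1.
  rewrite (@Rintegral_prod_set _ _ _ _ _ _ _ _ _ (2 * value_bound + 2 * lip_const * (t2 - t1)))//; last 2 first.
  - by rewrite [X in (X < _)%E](lebesgue_itv_oc t12) ltry.
  - move=> z; rewrite /Jc indicE; case: (boolP (z.1 \in _)) => [/set_mem z1|_].
      by rewrite mulr1; apply: JM.
    by rewrite mulr0 normr0 addr_ge0 ?mulr_ge0.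
  rewrite [LHS]Rintegral_mkcond [RHS]Rintegral_mkcond.
  apply: eq_Rintegral => q _; rewrite !patchE /Jc /J /=.
  have [q1|q1] := boolP (q \in (`]t1, t2]%classic : set R)); last first.
    rewrite ifN//; apply: contra q1 => /set_mem /=; rewrite in_itv/= => /andP[tq qm].
    by apply/mem_set; rewrite /= in_itv/= tq (le_trans qm).
  have tq : t1 < q by move: q1 => /set_mem/=; rewrite in_itv/= => /andP[].
  have -> : (q \in (`]t1, m]%classic : set R)) = (q <= m).
    by apply/idP/idP => [/set_mem/=|qm]; [rewrite in_itv/= => /andP[]|
      apply/mem_set; rewrite /= in_itv/= tq].
  rewrite indicE q1; case: ifP => _; last first.
    by under eq_Rintegral do rewrite mul0r; rewrite Rintegral_cst// mul0r.
  under eq_Rintegral do rewrite mulr1.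
  by rewrite RintegralZl//; exact: integrable_levy.
rewrite -IJE in inc.
set DI := jump_integral _ _ _ _ in IH IHJ *.
(* Flow error, then the delay in measuring the jump, then the factor [th]. The last two are O(h^2):
   the strip has mass h [lam], the delay costs O(h), and 1 - [th] is at most h [lam]. *)
have -> : flow_value t2 sg - flow_value t1 sg + th * DI =
  (flow_value t2 sg - flow_value t1 sg + IJ) + (DI - IJ) - (1 - th) * DI by ring.
apply: le_trans (ler_normB _ _) _.
have N1 := ler_normD (flow_value t2 sg - flow_value t1 sg + IJ) (DI - IJ).
have N2 : `|(1 - th) * DI| <= lam * (t2 - t1) * (2 * value_bound * ((t2 - t1) * lam)).
  by rewrite normrM ler_pM// ger0_norm// subr_ge0.
have N3 : (m - t1) * (YM * flow_const * (m - sg.1.1.1 + E)) <=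
  (t2 - t1) * (YM * flow_const * (t1 - sg.1.1.1 + (t2 - t1) + E)).
  have h1 : m - sg.1.1.1 <= t1 - sg.1.1.1 + (t2 - t1).
    by rewrite [leRHS](_ : _ = t2 - sg.1.1.1) ?lerD2r//; ring.
  have h2 : 0 <= m - sg.1.1.1 + E by rewrite addr_ge0// subr_ge0 (le_trans H2).
  apply: ler_pM; rewrite ?subr_ge0 ?lerD2r//; first by rewrite mulr_ge0 ?YM_flow_const_ge0.
  by rewrite ler_wpM2l ?YM_flow_const_ge0 ?lerD2r.
rewrite /step_const; set Q := (t2 - t1) * (YM * flow_const * _) in N3 *.
have -> : (t2 - t1) ^+ 2 * (2 * lip_const * lam + 2 * value_bound * lam * lam) =
  2 * lip_const * (t2 - t1) * ((t2 - t1) * lam) +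
  lam * (t2 - t1) * (2 * value_bound * ((t2 - t1) * lam)) by ring.
apply: le_trans (lerD (le_trans N1 (lerD (le_trans inc N3) IHJ)) N2) _.
by rewrite addrA.
Qed.

End one_step.

End exit.
End euler_flow.

(** * Integer-valued measures and independent marks *)

Lemma integral_mrestr (R : realType) d (S : measurableType d)
    (mu : {measure set S -> \bar R}) (A : set S) (mA : measurable A) (g : S -> \bar R) :
  measurable_fun setT g ->
  (\int[mrestr mu mA]_z g z = \int[mu]_(z in A) g z)%E.
Proof.
move=> mg.
have ge0E (h : S -> \bar R) : measurable_fun setT h -> (forall z, 0 <= h z)%E ->
    (\int[mrestr mu mA]_z h z = \int[mu]_(z in A) h z)%E.
  move=> mh h0; rewrite -(setUv A) ge0_integral_setU//=; last 3 first.
  - exact: measurableC.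
  - by rewrite setUv.
  - by rewrite disj_set2E setICr.
  rewrite [X in (_ + X)%E]null_set_integral ?adde0//; last 3 first.
  - exact: measurableC.
  - exact: measurable_funTS.
  - by rewrite /= /mrestr setICl measure0.
  by apply: eq_measure_integral => B mB BA; rewrite /= /mrestr setIidl.
rewrite [LHS]integralE [RHS]integralE !ge0E//.
  exact: measurable_funeneg.
exact: measurable_funepos.
Qed.

Lemma Rintegral_mscale (R : realType) d (S : measurableType d)
    (mu : {measure set S -> \bar R}) (k : {nonneg R}) (g : S -> R) :
  mu.-integrable setT (EFin \o g) ->
  \int[mscale k mu]_z g z = k%:num * \int[mu]_z g z.
Proof.
move=> ig; have [mg _] := integrableP _ _ _ ig.
rewrite /Rintegral integralE !ge0_integral_mscale//; last 2 first.
- exact: measurable_funeneg.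
- exact: measurable_funepos.
have ip := integrable_fin_num measurableT (integrable_funepos measurableT ig).
have im := integrable_fin_num measurableT (integrable_funeneg measurableT ig).
by rewrite [in RHS]integralE -(fineK ip) -(fineK im) -!EFinM -!EFinB /= mulrBr.
Qed.

(** A partial integral is measurable by Fubini; the product with a Dirac mass makes the bounded
    function integrable. *)
Lemma measurable_Rintegral_param (R : realType) d1 d2 (S1 : measurableType d1)
    (S2 : measurableType d2) (mu : {finite_measure set S2 -> \bar R})
    (g : S1 * S2 -> R) (M : R) :
  measurable_fun setT g -> (forall z, `|g z| <= M) ->
  measurable_fun setT (fun x => \int[mu]_z g (x, z)).
Proof.
move=> mg gM; apply: measurableT_comp => //.
have : (dirac (point : S1) \x mu)%E.-integrable setT (EFin \o g).
  apply: (integrable_bounded (M := M)) => //.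
  rewrite -setXTT [X in (X < _)%E]product_measure1E//.
  by rewrite -ge0_fin_numE ?mule_ge0// fin_numM// fin_num_measure.
by move=> /integrable_fubini_F/integrableP[].
Qed.

Section independent_mark.
Context {R : realType} d (Omega : measurableType d) (P : probability Omega R).
Context d1 (S1 : measurableType d1) d2 (S2 : measurableType d2).
Variables (X : Omega -> S1) (xi : Omega -> S2) (H : set Omega) (C : set S2).
Variables (mu : {measure set S2 -> \bar R}) (q : {nonneg R}).
Hypotheses (mX : measurable_fun setT X) (mxi : measurable_fun setT xi).
Hypotheses (mH : measurable H) (mC : measurable C) (Coo : (mu C < +oo)%E).
Hypothesis law : forall A B, measurable A -> measurable B ->
  P (H `&` (X @^-1` A `&` xi @^-1` B)) = (P (X @^-1` A) * (q%:num%:E * mu (B `&` C)))%E.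

(** By [law], on the event [H] the pair ([X], [xi]) is distributed as the product of the law of [X]
    and of [q] times [mu] restricted to [C]; a product measure is determined by rectangles, and
    Fubini concludes. *)
Lemma independent_mark_integral (g : S1 * S2 -> R) (M : R) :
  measurable_fun setT g -> (forall z, `|g z| <= M) ->
  \int[P]_(w in H) g (X w, xi w) =
  q%:num * \int[P]_w \int[mu]_(z in C) g (X w, z).
Proof.
move=> mg gM.
have mXxi : measurable_fun setT (fun w => (X w, xi w)) by exact: measurable_fun_pair.
have Hoo : (P H < +oo)%E by rewrite -ge0_fin_numE// fin_num_measure.
pose m1 : {finite_measure set S1 -> \bar R} := distribution P (HB.pack_for {mfun Omega >-> S1} X (isMeasurableFun.Build _ _ _ _ X mX)).
pose m2 : {finite_measure set S2 -> \bar R} := mscale q (mfrestr mC Coo).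
pose joint : {measure set (S1 * S2) -> \bar R} :=
  pushforward (mrestr P mH) (fun w => (X w, xi w)).
pose m3 := joint mXxi.
have m3E Q : measurable Q -> m3 Q = (m1 \x m2)%E Q.
  move=> mQ; apply/esym.
  apply: (@product_measure_unique _ _ _ _ _ m1 m2 m3) => // A B mA mB.
  rewrite /m3 /= /pushforward /mrestr /m1 /distribution /pushforward /m2 /= /mscale/=.
  rewrite /mfrestr /mrestr -law// setIC; congr (P (_ `&` _)).
have M0 : 0 <= M by exact: le_trans (normr_ge0 _) (gM (X point, xi point)).
have -> : \int[P]_(w in H) g (X w, xi w) = \int[m3]_z g z.
  rewrite /Rintegral; congr fine.
  rewrite integral_pushforward//=; last 2 first.
  - exact/measurable_EFinP.
  - rewrite preimage_setT; apply: (integrable_bounded (M := M)) => //.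
      by rewrite /= /mrestr setTI.
    by apply: (measurableT_comp mg).
  rewrite preimage_setT (integral_mrestr _ mH)//.
  by apply/measurable_EFinP; apply: measurableT_comp.
have -> : \int[m3]_z g z = \int[(m1 \x m2)%E]_(z in setT `*` setT) g z.
  rewrite setXTT /Rintegral; congr fine.
  by apply: eq_measure_integral => Q mQ _; exact: m3E.
rewrite (@Rintegral_prod_set _ _ _ _ _ m1 m2 setT g M)//; last first.
  by rewrite -ge0_fin_numE// fin_num_measure.
have mS2 x : measurable_fun setT (fun z : S2 => g (x, z)).
  have -> : (fun z => g (x, z)) = g \o pair x by [].
  by apply: measurableT_comp => //; exact: measurable_pair1.
have inner x : \int[m2]_z g (x, z) = q%:num * \int[mu]_(z in C) g (x, z).
  rewrite /m2 Rintegral_mscale; last first.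
    apply: (integrable_bounded (M := M)) => //.
    by rewrite -ge0_fin_numE// fin_num_measure.
  congr (_ * _); rewrite /Rintegral; congr fine.
  by rewrite (integral_mrestr _ mC)//; exact/measurable_EFinP.
have JE x : \int[mu]_(z in C) g (x, z) = \int[mfrestr mC Coo]_z g (x, z).
  by rewrite /Rintegral (integral_mrestr _ mC)//; exact/measurable_EFinP.
have iJ : P.-integrable setT (EFin \o (fun w => \int[mu]_(z in C) g (X w, z))).
  apply: (integrable_bounded (M := M * fine (mu C))) => //.
  - by rewrite -ge0_fin_numE// fin_num_measure.
  - under eq_fun do rewrite JE.
    pose mC' : {finite_measure set S2 -> \bar R} := mfrestr mC Coo.
    have mJ := measurable_Rintegral_param mC' mg gM.
    by have := measurableT_comp mJ mX.
  - move=> w _; apply: Rintegral_le_cst => //; last exact: measurable_funTS.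
    by rewrite fineK// ge0_fin_numE.
rewrite -RintegralZl//; transitivity (\int[P]_w \int[m2]_z g (X w, z)).
  rewrite /Rintegral; congr fine.
  rewrite /m1 /distribution integral_pushforward//=.
    by apply/measurable_EFinP; exact: measurable_Rintegral_param gM.
  rewrite preimage_setT.
  have := integrableZl measurableT q%:num iJ; apply: eq_integrable => // w _.
  by rewrite -[RHS]/((\int[m2]_z g (X w, z))%:E) inner EFinM.
by under eq_Rintegral do rewrite inner.
Qed.
End independent_mark.

Section mark.
Context {R : realType} {n : nat}.
Implicit Types (M : {measure set (R * 'rV[R]_n) -> \bar R}) (C B : set (R * 'rV[R]_n)).

Definition is_mark M C z : Prop :=
  C z /\ forall B, measurable B -> M (B `&` C) = \d_z B.

(* The atom of [M] in [C] when [M C = 1], and a junk value otherwise. *)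
Definition mark M C : R * 'rV[R]_n := xget point [set z | is_mark M C z].

Definition space_coord (o : option 'I_n) (z : R * 'rV[R]_n) : R :=
  if o is Some i then z.2 ord0 i else z.1.

Lemma measurable_space_coord o : measurable_fun setT (space_coord o).
Proof.
case: o => [i|]; last exact: measurable_fst.
have -> : space_coord (Some i) = rV_coord i \o snd by [].
by apply: measurableT_comp; [exact: measurable_rV_coord|exact: measurable_snd].
Qed.

Lemma mark_junk M C : M C != 1%E -> mark M C = point.
Proof.
move=> MC; rewrite /mark; case: xgetP => // z _ [Cz /(_ _ measurableT)].
by rewrite setTI diracT => M1; rewrite M1 eqxx in MC.
Qed.

(** An integer-valued measure of total mass 1 takes only the values 0 and 1. As half-spaces with
    rational bounds are countable and separate points, such a measure is a Dirac mass. *)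
Lemma markP M C : measurable C -> M C = 1%E ->
  (forall B, measurable B -> B `<=` C -> M B = +oo%E \/ exists k : nat, M B = k%:R%:E) ->
  is_mark M C (mark M C).
Proof.
move=> mC MC1 MZ.
have splitC B : measurable B -> M (B `&` C) = 0%E /\ M (C `\` B) = 1%E \/
    M (B `&` C) = 1%E /\ M (C `\` B) = 0%E.
  move=> mB; have mBC : measurable (B `&` C) by exact: measurableI.
  have mCB : measurable (C `\` B) by exact: measurableD.
  have E : (M (B `&` C) + M (C `\` B) = 1)%E.
    rewrite -MC1 -measureU//; first by rewrite setIC setUIDK.
    by apply/seteqP; split => // z [[Bz _] [_]].
  have [] := MZ _ mBC (@subIsetr _ _ _).
    by move=> E1; move: E; rewrite E1 addye// gt_eqF// (lt_le_trans _ (measure_ge0 _ _)).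
  move=> [k E1]; have [] := MZ _ mCB (@subDsetl _ _ _).
    by move=> E2; move: E; rewrite E1 E2.
  move=> [l E2]; move: E; rewrite E1 E2 -EFinD -natrD => /eqP.
  rewrite -[1%E]/(1%:R%:E) eqe eqr_nat => /eqP.
  by case: k {E1} => [|[|k]]; case: l {E2} => [|[|l]] => //=; [left|right].
(* For each rational r, one of the events [coordinate < r], [coordinate >= r] is
   null; off the union of these null sets, all the coordinates are constant. *)
pose A (p : option 'I_n * rat) := [set z | space_coord p.1 z < ratr p.2].
have mA p : measurable (A p).
  have -> : A p = space_coord p.1 @^-1` [set` `]-oo, ratr p.2[].
    by apply/seteqP; split => z; rewrite /A /= in_itv.
  by rewrite -[X in measurable X]setTI; apply: measurable_space_coord.
pose N k := if unpickle k is Some p then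
  if M (A p `&` C) == 0%E then A p `&` C else C `\` A p else set0.
have N0 : M.-negligible (\bigcup_k N k).
  apply: negligible_bigcup => k; rewrite /N; case: unpickle => [p|]; last exact: negligible_set0.
  have [[p0 _]|[p1 q0]] := splitC _ (mA p).
    by rewrite p0 eqxx; apply/negligibleP => //; exact: measurableI.
  rewrite p1 ifF; last by apply/eqP => /eqP; rewrite eqe oner_eq0.
  by apply/negligibleP => //; exact: measurableD.
have NE z y : (C `\` \bigcup_k N k) z -> (C `\` \bigcup_k N k) y -> z = y.
  move=> Hz Hy.
  have lt_iff z' y' o r : (C `\` \bigcup_k N k) z' -> (C `\` \bigcup_k N k) y' ->
      space_coord o z' < ratr r -> space_coord o y' < ratr r.
    move=> [Cz Nz] [Cy Ny] zr; rewrite ltNge; apply/negP => ry.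
    have Nzk : ~ N (pickle (o, r)) z' by move=> ?; apply: Nz; exists (pickle (o, r)).
    have Nyk : ~ N (pickle (o, r)) y' by move=> ?; apply: Ny; exists (pickle (o, r)).
    move: Nzk Nyk; rewrite /N pickleK; case: ifP => _ Nzk Nyk; first by apply: Nzk.
    by apply: Nyk; split => // yr; move: ry; rewrite leNgt => /negP; apply.
  have coordE o : space_coord o z = space_coord o y.
    apply/eqP; rewrite eq_le; apply/andP; split; rewrite leNgt; apply/negP => lt.
      have [r] := rat_in_itvoo lt; rewrite in_itv/= => /andP[yr rz].
      by have := lt_iff _ _ _ _ Hy Hz yr; rewrite ltNge (ltW rz).
    have [r] := rat_in_itvoo lt; rewrite in_itv/= => /andP[yr rz].
    by have := lt_iff _ _ _ _ Hz Hy yr; rewrite ltNge (ltW rz).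
  rewrite (surjective_pairing z) (surjective_pairing y); congr (_, _).
    exact: (coordE None).
  by apply/rowP => i; exact: (coordE (Some i)).
have null B : measurable B -> B `<=` \bigcup_k N k -> M B = 0%E.
  by move=> mB BN; apply/negligibleP => //; exact: negligibleS BN N0.
suff [z [Cz Nz]] : exists z, (C `\` \bigcup_k N k) z.
  suff mz : is_mark M C z by apply: (xgetPex point); exists z.
  split => // B mB; rewrite diracE; case: (boolP (z \in B)) => [/set_mem Bz|zB].
    have [[_ C1]|[//]] := splitC _ mB.
    suff : M (C `\` B) = 0%E by rewrite C1 => /eqP; rewrite eqe oner_eq0.
    apply: null; first exact: measurableD.
    move=> y [Cy By]; apply: contrapT => Ny; apply: By.
    by rewrite -(NE z y).
  apply: null; first exact: measurableI.
  move=> y [By Cy]; apply: contrapT => Ny.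
  by move/negP: zB; apply; apply/mem_set; rewrite (NE z y).
apply: contrapT => /forallNP H.
suff : M C = 0%E by rewrite MC1 => /eqP; rewrite eqe oner_eq0.
apply: null => // z Cz; apply: contrapT => Nz; exact: (H z).
Qed.

End mark.

(** * The Poisson random measure on a mesh *)

Lemma measure_splitC (R : realType) d (S : measurableType d)
    (mu : {measure set S -> \bar R}) (A B : set S) : measurable A -> measurable B ->
  (mu (A `&` B) + mu (~` A `&` B) = mu B)%E.
Proof.
move=> mA mB; rewrite -measureU.
- by rewrite -setIUl setUv setTI.
- exact: measurableI.
- by apply: measurableI => //; exact: measurableC.
- by rewrite setIACA setICr set0I.
Qed.

Section cell.
Context {R : realType} {n : nat}.
Variables (s : R) (hs : 0 < s < 1) (eps : R) (he : 0 < eps).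
Implicit Types (p q T : R) (B : set (R * 'rV[R]_n)).

(** Half-open in time, so that consecutive cells are disjoint and cover the interval. *)
Definition cell (e p q : R) : set (R * 'rV[R]_n) :=
  `]p, q]%classic `*` [set y | e < enorm y].

Lemma measurable_cell e p q : measurable (cell e p q).
Proof. by apply: measurableX => //; exact: measurable_enorm_gt. Qed.

Lemma cell_sub p q T : 0 <= p -> q <= T ->
  cell eps p q `<=` jump_space T `&` (`]p, T]%classic `*` setT).
Proof.
move=> p0 qT [r y] [/=]; rewrite in_itv/= => /andP[pr rq] ey.
rewrite /jump_space; split; split => //=; rewrite ?in_itv/=.
- by rewrite (le_trans p0 (ltW pr)) (le_trans rq).
- apply/eqP => y0; move: ey; rewrite y0 ltNge; have := he.
  rewrite /enorm big1 ?sqrtr0 => [/ltW ->//|i _].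
  by rewrite mxE expr0n.
- by rewrite pr (le_trans rq).
Qed.

Local Notation nu := (levy_measure (n := n) hs he).
Local Notation lam := (levy_mass (n := n) hs he).

(** The constraint |y| > [eps] moves from the set into the measure, which becomes a product with a
    finite factor. *)
Lemma levy_intensity_cell p q B : measurable B ->
  levy_intensity s (B `&` cell eps p q) =
  (lebesgue_measure \x nu)%E (B `&` (`]p, q]%classic `*` setT)).
Proof.
move=> mB; rewrite /levy_intensity integral_mkcond.
have mBC : measurable (B `&` cell eps p q).
  by apply: measurableI => //; exact: measurable_cell.
have md : measurable_fun setT (fun z : R * 'rV[R]_n => (levy_density s z.2)%:E).
  apply/measurable_EFinP.
  have -> : (fun z : R * 'rV[R]_n => levy_density s z.2) = levy_density s \o snd by [].
  by apply: measurableT_comp; [exact: measurable_levy_density|exact: measurable_snd].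
rewrite fubini_tonelli1; last 2 first.
- by apply/(measurable_restrictT _ mBC); exact: measurable_funTS.
- by move=> z; rewrite patchE; case: ifP => // _; rewrite lee_fin levy_density_ge0.
transitivity (\int[lebesgue_measure]_x
    nu (xsection (B `&` (`]p, q]%classic `*` setT)) x))%E; last by [].
apply: eq_integral => r _; rewrite /fubini_F levy_measureE [RHS]integral_mkcond.
apply: eq_integral => y _; rewrite !patchE.
suff -> : ((r, y) \in B `&` cell eps p q) =
  (y \in xsection (B `&` (`]p, q]%classic `*` setT)) r `&` [set y | eps < enorm y]).
  by [].
apply/idP/idP => /set_mem.
  by move=> [By [/= rpq ey]]; apply/mem_set; split => //; apply/xsectionP.
by move=> [/xsectionP[By [/= rpq _]] ey]; apply/mem_set.
Qed.

Lemma strip_measure p q : p <= q ->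
  (lebesgue_measure \x nu)%E (`]p, q]%classic `*` [set: 'rV[R]_n]) = ((q - p) * lam)%:E.
Proof.
move=> pq; rewrite product_measure1E// [X in (X * _)%E](lebesgue_itv_oc pq).
by rewrite [X in (_ * X)%E]levy_measureT -EFinM.
Qed.

Lemma strip_measure_fin p q B : p <= q -> measurable B ->
  (lebesgue_measure \x nu)%E (B `&` (`]p, q]%classic `*` [set: 'rV[R]_n])) \is a fin_num.
Proof.
move=> pq mB; have mS : measurable (`]p, q]%classic `*` [set: 'rV[R]_n]).
  by apply: measurableX.
rewrite ge0_fin_numE//; apply: (@le_lt_trans _ _ ((q - p) * lam)%:E); last exact: ltry.
rewrite -(strip_measure pq); apply: le_measure; rewrite ?inE//.
exact: measurableI.
Qed.

End cell.

Section poisson.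
Context {R : realType} {n : nat}.
Variables (s : R) (hs : 0 < s < 1) (eps : R) (he : 0 < eps) (T : R).
Context d (Omega : measurableType d) (P : probability Omega R).
Variables (F : R -> set (set Omega)) (N : R.-ker Omega ~> (R * 'rV[R]_n)%type).
Hypothesis hF : usual_conditions P T F.
Hypothesis hN : is_poisson_random_measure P (jump_space T) (levy_intensity s) N.
Hypothesis hNF : compatible_with_filtration P T F (jump_space T) N.

Local Notation nu := (levy_measure (n := n) hs he).
Local Notation lam := (levy_mass (n := n) hs he).
Local Notation cell := (cell (n := n) eps).

Lemma poisson_integer p q w B : 0 <= p -> q <= T -> measurable B ->
  B `<=` cell p q -> N w B = +oo%E \/ exists k : nat, N w B = k%:R%:E.
Proof.
move=> p0 qT mB Bc; have [+ _ _ _] := hN; apply => //.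
by move=> z /Bc /(cell_sub he p0 qT)[].
Qed.

Lemma poisson_law p q B k : 0 <= p -> p <= q -> q <= T -> measurable B ->
  let m := fine ((lebesgue_measure \x nu)%E (B `&` (`]p, q]%classic `*` setT))) in
  P [set w | N w (B `&` cell p q) = k%:R%:E] = (m ^+ k / k`!%:R * expR (- m))%:E.
Proof.
move=> p0 pq qT mB m; have [_ + _ _] := hN.
have mc : measurable (B `&` cell p q) by apply: measurableI => //; exact: measurable_cell.
move=> /(_ _ mc) ->; rewrite ?levy_intensity_cell//.
  by move=> z [_ /(cell_sub he p0 qT)[]].
by rewrite -ge0_fin_numE// strip_measure_fin.
Qed.

(** Expresses the position of a single jump by the counts of two disjoint sets, to which the laws
    and independence of the Poisson measure apply. *)
Lemma mark_event p q w B : 0 <= p -> q <= T -> measurable B ->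
  (N w (cell p q) = 1%E /\ B (mark (N w) (cell p q))) <->
  (N w (B `&` cell p q) = 1%E /\ N w (~` B `&` cell p q) = 0%E).
Proof.
move=> p0 qT mB; have mc : measurable (cell p q) by exact: measurable_cell.
have mBC := measurableC mB; split=> [[N1 Bm]|[N1 N0]].
  have [Cm H] := markP mc N1 (fun B => @poisson_integer p q w B p0 qT).
  by rewrite (H _ mB) (H _ mBC) !diracE mem_set// memNset//; split => // /(_ Bm).
have NC : N w (cell p q) = 1%E.
  by rewrite -(measure_splitC (N w) mB mc) [X in (X + _)%E]N1 [X in (_ + X)%E]N0 adde0.
split => //; have [Cm H] := markP mc NC (fun B => @poisson_integer p q w B p0 qT).
move: N1; rewrite (H _ mB) diracE; case: (boolP (_ \in B)) => [/set_mem//|_ /eqP].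
by rewrite eqe eq_sym oner_eq0.
Qed.

Lemma mark_eventE p q B : 0 <= p -> q <= T -> measurable B ->
  [set w | N w (cell p q) = 1%E] `&` (fun w => mark (N w) (cell p q)) @^-1` B =
  [set w | N w (B `&` cell p q) = 1%E] `&` [set w | N w (~` B `&` cell p q) = 0%E].
Proof. by move=> p0 qT mB; apply/seteqP; split => w /=; rewrite mark_event. Qed.

(** The counts in the parts of the cell inside and outside B are independent Poisson of means a and
    a' with a + a' = (q - p) [lam]; one and none have probability a e^(-a) e^(-a'). The cell lies
    after time p, whence the independence of [G]. *)
Lemma poisson_mark p q B G : 0 <= p -> p <= q -> q <= T -> measurable B -> F p G ->
  P (G `&` ([set w | N w (cell p q) = 1%E] `&`
            (fun w => mark (N w) (cell p q)) @^-1` B)) =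
  (P G * ((expR (- ((q - p) * lam)))%:E *
          (lebesgue_measure \x nu) (B `&` (`]p, q]%classic `*` setT))))%E.
Proof.
move=> p0 pq qT mB FG; rewrite mark_eventE//.
have mc : measurable (cell p q) by exact: measurable_cell.
have mBC := measurableC mB.
pose As (i : 'I_2) := if i == ord0 then B `&` cell p q else ~` B `&` cell p q.
pose Bs (i : 'I_2) : set (\bar R) := if i == ord0 then [set 1%E] else [set 0%E].
have E : [set w | N w (B `&` cell p q) = 1%E] `&` [set w | N w (~` B `&` cell p q) = 0%E] =
    [set w | forall i, Bs i (N w (As i))].
  apply/seteqP; split => w /=.
    by move=> [N1 N0] i; rewrite /As /Bs; case: ifP.
  by move=> H; split; [exact: (H ord0)|exact: (H ord_max)].
have mAs i : measurable (As i) by rewrite /As; case: ifP => _; exact: measurableI.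
have mBs i : measurable (Bs i) by rewrite /Bs; case: ifP => _; exact: emeasurable_set1.
have sAs i : As i `<=` cell p q by rewrite /As; case: ifP => _ z [].
rewrite E; have [_ H2] := hNF; rewrite (H2 p)//; last 2 first.
- by rewrite p0 (le_trans pq).
- by move=> i; split => // z /sAs /(cell_sub he p0 qT)[z1 z2].
- congr (_ * _)%E; have [_ _ _ ->//] := hN; last 2 first.
  + by move=> i; split => // z /sAs /(cell_sub he p0 qT)[].
  + apply/trivIsetP => i j _ _ ij; rewrite /As; case: ifP => i0; case: ifP => j0.
    * by rewrite (eqP i0) (eqP j0) eqxx in ij.
    * by rewrite setIACA setICr set0I.
    * by rewrite setIACA setICl set0I.
    * by move: i i0 j j0 ij => [[|[|]]//= i1] _ [[|[|]]//= j1] _.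
  rewrite big_ord_recl big_ord1 /= /As /Bs /=.
  pose a := (lebesgue_measure \x nu)%E (B `&` (`]p, q]%classic `*` setT)).
  pose a' := (lebesgue_measure \x nu)%E (~` B `&` (`]p, q]%classic `*` setT)).
  have E1 : P [set w | N w (B `&` cell p q) = 1%E] = (fine a * expR (- fine a))%:E.
    by have := poisson_law 1 p0 pq qT mB; rewrite /= expr1 divr1.
  have E0 : P [set w | N w (~` B `&` cell p q) = 0%E] = (expR (- fine a'))%:E.
    by have := poisson_law 0 p0 pq qT mBC; rewrite /= expr0 divr1 mul1r.
  have f1 : a \is a fin_num by exact: strip_measure_fin.
  have f2 : a' \is a fin_num by exact: strip_measure_fin.
  rewrite [X in (X * _)%E]E1 [X in (_ * X)%E]E0.
  have mS : measurable (`]p, q]%classic `*` [set: 'rV[R]_n]) by exact: measurableX.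
  have aa : (a + a' = ((q - p) * lam)%:E)%E.
    by rewrite -(strip_measure hs he pq); exact: (measure_splitC (lebesgue_measure \x nu)%E mB mS).
  transitivity ((expR (- ((q - p) * lam)))%:E * a)%E; last by [].
  clearbody a a'.
  have {}aa : fine a + fine a' = (q - p) * lam by rewrite -fineD// aa.
  rewrite -aa opprD expRD -[in RHS](fineK f1) -!EFinM; congr (_%:E); ring.
Qed.

Lemma filtration_measurableE r : 0 <= r <= T -> F r = (F r).-sigma.-measurable.
Proof.
move=> rT; have [_ /(_ _ rT)[sF _] _ _ _] := hF.
by rewrite measurable_g_measurableTypeE.
Qed.

Lemma filtration_sub r G : 0 <= r <= T -> F r G -> measurable G.
Proof. by move=> rT; have [_ /(_ _ rT)[_ sF] _ _ _] := hF; exact: sF. Qed.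

Definition adapted r d' (S : measurableType d') (X : Omega -> S) : Prop :=
  forall B, measurable B -> F r (X @^-1` B).

Section adapted.
Context d1 (S1 : measurableType d1) d2 (S2 : measurableType d2).

Lemma adaptedP r (X : Omega -> S1) : 0 <= r <= T ->
  adapted r X <-> measurable_fun (setT : set (g_sigma_algebraType (F r))) X.
Proof.
move=> rT; split=> [aX _ B mB|mX B mB].
  by rewrite setTI -(filtration_measurableE rT); exact: aX.
by rewrite (filtration_measurableE rT) -[_ @^-1` _]setTI; exact: mX.
Qed.

Lemma adapted_pair r (X : Omega -> S1) (Y : Omega -> S2) : 0 <= r <= T ->
  adapted r X -> adapted r Y -> adapted r (fun w => (X w, Y w)).
Proof.
move=> rT aX aY B mB; rewrite (filtration_measurableE rT) -[_ @^-1` _]setTI.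
have mX := (adaptedP X rT).1 aX.
have mY : measurable_fun (setT : set (g_sigma_algebraType (F r))) Y.
  by move=> _ C mC; rewrite setTI -(filtration_measurableE rT); exact: aY.
exact: (measurable_fun_pair mX mY measurableT mB).
Qed.

Lemma adapted_comp r (X : Omega -> S1) (h : S1 -> S2) :
  measurable_fun setT h -> adapted r X -> adapted r (h \o X).
Proof.
move=> mh aX B mB; rewrite comp_preimage; apply: aX.
by rewrite -[X in measurable X]setTI; exact: mh.
Qed.

Lemma adapted_le p q (X : Omega -> S1) : 0 <= p -> p <= q -> q <= T ->
  adapted p X -> adapted q X.
Proof.
move=> p0 pq qT aX B mB; have [_ _ sF _ _] := hF.
by apply: (sF p q) => //; exact: aX.
Qed.

Lemma adapted_measurable r (X : Omega -> S1) : 0 <= r <= T -> adapted r X ->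
  measurable_fun setT X.
Proof.
by move=> rT aX _ B mB; rewrite setTI; apply: filtration_sub rT _; exact: aX.
Qed.

Lemma adapted_if r (H : set Omega) (X Y Z : Omega -> S1) : 0 <= r <= T -> F r H ->
  (forall B, measurable B -> F r (H `&` X @^-1` B)) -> adapted r Y ->
  (forall w, H w -> Z w = X w) -> (forall w, ~ H w -> Z w = Y w) -> adapted r Z.
Proof.
move=> rT FH FX aY ZX ZY B mB.
have -> : Z @^-1` B = (H `&` X @^-1` B) `|` (~` H `&` Y @^-1` B).
  apply/seteqP; split => w /=.
    by have [Hw|Hw] := pselect (H w); [rewrite ZX//; left|rewrite ZY//; right].
  by move=> [[Hw]|[Hw]]; [rewrite ZX|rewrite ZY].
move: FH (FX _ mB) (aY _ mB); rewrite (filtration_measurableE rT) => FH FXB FYB.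
by apply: measurableU => //; apply: measurableI => //; exact: measurableC.
Qed.

End adapted.

Lemma filtration_count p q B k : 0 <= p -> p <= q -> q <= T -> measurable B ->
  B `<=` cell p q -> F q [set w | N w B = k%:R%:E].
Proof.
move=> p0 pq qT mB Bc; have [H _] := hNF.
apply: (H q B [set k%:R%:E]) => //.
- by rewrite (le_trans p0).
- move=> [r y] /Bc ry; split; first by have [] := cell_sub he p0 qT ry.
  have [/= + _] := ry; rewrite in_itv/= => /andP[pr rq].
  by split => //=; rewrite in_itv/= rq (le_trans p0 (ltW pr)).
Qed.

Lemma filtration_one_jump p q : 0 <= p -> p <= q -> q <= T ->
  F q [set w | N w (cell p q) = 1%E].
Proof.
move=> p0 pq qT.
exact: (filtration_count 1 p0 pq qT (measurable_cell eps p q) (@subset_refl _ _)).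
Qed.

Lemma filtration_mark p q B : 0 <= p -> p <= q -> q <= T -> measurable B ->
  F q ([set w | N w (cell p q) = 1%E] `&` (fun w => mark (N w) (cell p q)) @^-1` B).
Proof.
move=> p0 pq qT mB; rewrite mark_eventE//.
have qT' : 0 <= q <= T by rewrite (le_trans p0).
have mc : measurable (cell p q) by exact: measurable_cell.
have F1 : F q [set w | N w (B `&` cell p q) = 1%:R%:E].
  apply: (filtration_count _ p0 pq qT); last exact: subIsetr.
  exact: measurableI.
have F0 : F q [set w | N w (~` B `&` cell p q) = 0%:R%:E].
  apply: (filtration_count _ p0 pq qT); last exact: subIsetr.
  by apply: measurableI => //; exact: measurableC.
by move: F1 F0; rewrite (filtration_measurableE qT') => F1 F0; exact: measurableI.
Qed.

(** On the event of one jump the mark is read off counts; elsewhere it is the constant junk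
    value. *)
Lemma adapted_mark p q : 0 <= p -> p <= q -> q <= T ->
  adapted q (fun w => mark (N w) (cell p q)).
Proof.
move=> p0 pq qT; have qT' : 0 <= q <= T by rewrite (le_trans p0).
apply: (adapted_if qT' (filtration_one_jump p0 pq qT) (X := fun w => mark (N w) (cell p q))
  (Y := cst point)) => //.
- by move=> B mB; exact: filtration_mark.
- by apply/(adaptedP _ qT'); exact: measurable_cst.
- by move=> w Nw; apply: mark_junk; apply/eqP.
Qed.

(** With x the mean count, 1 - e^(-x) (1 + x) <= 1 - (1 - x) (1 + x) = x^2. *)
Lemma prob_many_jumps p q : 0 <= p -> p <= q -> q <= T ->
  (P (~` ([set w | N w (cell p q) = 0%E] `|` [set w | N w (cell p q) = 1%E])) <=
   (((q - p) * lam) ^+ 2)%:E)%E.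
Proof.
move=> p0 pq qT; have qT' : 0 <= q <= T by rewrite (le_trans p0).
have mc : measurable (cell p q) by exact: measurable_cell.
set x := (q - p) * lam.
have x0 : 0 <= x by rewrite mulr_ge0 ?subr_ge0// fine_ge0.
have m0 : measurable [set w | N w (cell p q) = 0%E].
  exact: (filtration_sub qT' (filtration_count 0 p0 pq qT mc (@subset_refl _ _))).
have m1 : measurable [set w | N w (cell p q) = 1%E].
  exact: (filtration_sub qT' (filtration_one_jump p0 pq qT)).
have E k : P [set w | N w (cell p q) = k%:R%:E] = (x ^+ k / k`!%:R * expR (- x))%:E.
  have := poisson_law k p0 pq qT measurableT.
  by rewrite !setTI /= => ->; rewrite strip_measure.
rewrite probability_setC; last exact: measurableU.
rewrite measureU//; last first.
  by apply/seteqP; split => // w [/= -> /eqP]; rewrite eqe eq_sym oner_eq0.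
rewrite [X in (_ - (X + _))%E](E 0%N) [X in (_ - (_ + X))%E](E 1%N).
rewrite expr0 expr1 !divr1 mul1r -EFinD.
rewrite -[leLHS]/((1 - (expR (- x) + x * expR (- x)))%:E) lee_fin.
have e1 := expR_ge1Dx (- x).
have : (1 - x) * (1 + x) <= expR (- x) * (1 + x) by rewrite ler_wpM2r//; lra.
by lra.
Qed.

(** * The Markov chain of the single jumps *)

Section chain.
Context d' (S : measurableType d') (J : S * (R * 'rV[R]_n) -> S) (s0 : S).
Variable tk : nat -> R.
Hypothesis mJ : measurable_fun setT J.
Hypotheses (tk0 : 0 <= tk 0%N) (tkS : forall k, tk k <= tk k.+1).

Local Notation cellk k := (cell (tk k) (tk k.+1)).

(* A cell containing at least two jumps is treated as if it contained none. *)
Fixpoint chain (M : {measure set (R * 'rV[R]_n) -> \bar R}) (k : nat) : S :=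
  if k is j.+1 then
    if M (cellk j) == 1%E then J (chain M j, mark M (cellk j)) else chain M j
  else s0.

Local Notation X k := (fun w => chain (N w) k).
Local Notation xi k := (fun w => mark (N w) (cellk k)).
Local Notation H k := [set w | N w (cellk k) = 1%E].

Lemma tk_ge0 k : 0 <= tk k.
Proof. by elim: k => // k ih; exact: le_trans ih (tkS k). Qed.

Lemma tk_itv k : tk k <= T -> 0 <= tk k <= T.
Proof. by move=> kT; rewrite tk_ge0. Qed.

Lemma chainS k w : chain (N w) k.+1 =
  if N w (cellk k) == 1%E then J (chain (N w) k, mark (N w) (cellk k)) else chain (N w) k.
Proof. by []. Qed.

Lemma adapted_chain k : tk k <= T -> adapted (tk k) (X k).
Proof.
elim: k => [|k ih] kT.
  by apply/(adaptedP _ (tk_itv kT)); exact: measurable_cst.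
have kT' : tk k <= T by exact: le_trans (tkS k) kT.
have aXk : adapted (tk k.+1) (X k) by apply: adapted_le (ih kT') => //; exact: tk_ge0.
have axi : adapted (tk k.+1) (xi k) by apply: adapted_mark => //; exact: tk_ge0.
have FH : F (tk k.+1) (H k) by apply: filtration_one_jump => //; exact: tk_ge0.
apply: (adapted_if (tk_itv kT) FH (X := J \o (fun w => (chain (N w) k, mark (N w) (cellk k))))
  (Y := X k)) => //.
- move=> B mB.
  have : adapted (tk k.+1) (J \o (fun w => (chain (N w) k, mark (N w) (cellk k)))).
    by apply: adapted_comp => //; apply: adapted_pair => //; exact: tk_itv.
  move=> /(_ _ mB); move: FH; rewrite (filtration_measurableE (tk_itv kT)) => FH FB.
  exact: measurableI.
- by move=> w /= Hw; rewrite Hw eqxx.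
- by move=> w /= /eqP/negbTE ->.
Qed.

Lemma measurable_chain k : tk k <= T -> measurable_fun setT (X k).
Proof. by move=> kT; apply: adapted_measurable (tk_itv kT) (adapted_chain kT). Qed.

Lemma measurable_one_jump k : tk k.+1 <= T -> measurable (H k).
Proof.
move=> kT; apply: filtration_sub (tk_itv kT) _.
by apply: filtration_one_jump => //; exact: tk_ge0.
Qed.

(** The state at the start of the cell is known at that time, so [poisson_mark] supplies the product
    law required by [independent_mark_integral]. *)
Lemma chain_mark_integral k (g : S * (R * 'rV[R]_n) -> R) (M : R) :
  tk k.+1 <= T -> measurable_fun setT g -> (forall z, `|g z| <= M) ->
  \int[P]_(w in H k) g (X k w, xi k w) =
  expR (- ((tk k.+1 - tk k) * lam)) *
  \int[P]_w \int[(lebesgue_measure \x nu)%E]_(z in `]tk k, tk k.+1]%classic `*` setT)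
    g (X k w, z).
Proof.
move=> kT mg gM; have kT' : tk k <= T by exact: le_trans (tkS k) kT.
have mS : measurable (`]tk k, tk k.+1]%classic `*` [set: 'rV[R]_n]) by exact: measurableX.
have e0 : 0 <= expR (- ((tk k.+1 - tk k) * lam)) by exact: expR_ge0.
pose S2 : measurableType _ :=
  (g_sigma_algebraType (@measurable _ (@ocitv_type R)) * 'rV[R]_n)%type.
pose mu : {measure set S2 -> \bar R} := (lebesgue_measure \x nu)%E.
pose q := NngNum e0.
pose st : set S2 := `]tk k, tk k.+1]%classic `*` [set: 'rV[R]_n].
have mX : measurable_fun setT (X k) by exact: measurable_chain.
have mxi : measurable_fun setT (xi k).
  by apply: adapted_measurable (tk_itv kT) _; apply: adapted_mark => //; exact: tk_ge0.
have mxi' : @measurable_fun _ _ Omega S2 setT (xi k) by exact: mxi.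
have mH := measurable_one_jump kT.
have mS' : measurable st by exact: mS.
have Soo : (mu st < +oo)%E.
  have H1 := strip_measure (n := n) hs he (tkS k).
  have : ((lebesgue_measure \x nu)%E (`]tk k, tk k.+1]%classic `*` [set: 'rV[R]_n]) < +oo)%E.
    by rewrite H1 ltry.
  exact.
have law (A : set S) (B : set S2) : measurable A -> measurable B ->
  P (H k `&` (X k @^-1` A `&` xi k @^-1` B)) =
  (P (X k @^-1` A) * (q%:num%:E * mu (B `&` st)))%E.
  move=> mA mB; rewrite setICA.
  exact: (poisson_mark (tk_ge0 k) (tkS k) kT mB (adapted_chain kT' mA)).
have mg' : @measurable_fun _ _ (S * S2)%type R setT g by exact: mg.
exact: (independent_mark_integral mX mxi' mH mS' Soo law mg' gM).
Qed.

Lemma strip_integralP k (g : S * (R * 'rV[R]_n) -> R) (M : R) : 0 <= M ->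
  measurable_fun setT g -> (forall z, `|g z| <= M) ->
  let I sg := \int[(lebesgue_measure \x nu)%E]_(z in `]tk k, tk k.+1]%classic `*` setT)
    g (sg, z) in
  measurable_fun setT I /\
  forall sg, `|I sg| <= M * ((tk k.+1 - tk k) * lam).
Proof.
move=> M0 mg gM I.
pose S2 : measurableType _ :=
  (g_sigma_algebraType (@measurable _ (@ocitv_type R)) * 'rV[R]_n)%type.
pose mu : {measure set S2 -> \bar R} := (lebesgue_measure \x nu)%E.
pose st : set S2 := `]tk k, tk k.+1]%classic `*` [set: 'rV[R]_n].
have mS : measurable st by exact: measurableX.
have muS : mu st = ((tk k.+1 - tk k) * lam)%:E.
  by have := strip_measure (n := n) hs he (tkS k).
have Soo : (mu st < +oo)%E by rewrite muS ltry.
have mg' : @measurable_fun _ _ (S * S2)%type R setT g by exact: mg.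
have mgs sg : @measurable_fun _ _ S2 R setT (fun z => g (sg, z)).
  have -> : (fun z => g (sg, z)) = g \o pair sg by [].
  by apply: measurableT_comp => //; exact: measurable_pair1.
split; last first.
  move=> sg; apply: (@Rintegral_le_cst _ _ S2 mu st) => //.
    by rewrite muS.
  exact: measurable_funTS.
pose muC : {finite_measure set S2 -> \bar R} := mfrestr mS Soo.
have := measurable_Rintegral_param muC mg' gM.
apply: eq_measurable_fun => sg _; rewrite /Rintegral (integral_mrestr mu mS)//.
exact/measurable_EFinP.
Qed.

Lemma integrable_bounded_proba (Y : Omega -> R) (M : R) :
  measurable_fun setT Y -> (forall w, `|Y w| <= M) -> P.-integrable setT (EFin \o Y).
Proof.
move=> mY YM; apply: (integrable_bounded (M := M)) => //.
by rewrite -ge0_fin_numE// fin_num_measure.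
Qed.

(** An invariant of the chain, needed because values and ages are bounded on reachable states
    only. *)
Variable (reach : nat -> S -> Prop).
Hypothesis reach0 : reach 0 s0.
Hypothesis reachS : forall k sg, tk k.+1 <= T -> reach k sg -> reach k.+1 sg.
Hypothesis reachJ : forall k sg z, tk k.+1 <= T -> reach k sg ->
  tk k < z.1 <= tk k.+1 -> reach k.+1 (J (sg, z)).

Lemma one_jump_mark k w : tk k.+1 <= T -> H k w -> tk k < (xi k w).1 <= tk k.+1.
Proof.
move=> kT Hw; have mc : measurable (cellk k) by exact: measurable_cell.
have [[/=]] := markP mc Hw (fun B => @poisson_integer _ _ w B (tk_ge0 k) kT).
by rewrite in_itv.
Qed.

Lemma chain_reach k w : tk k <= T -> reach k (X k w).
Proof.
elim: k => // k ih kT; have kT' := le_trans (tkS k) kT.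
rewrite chainS; case: ifPn => [/eqP Nw|_]; last by apply: reachS => //; exact: ih.
by apply: reachJ => //; [exact: ih|exact: one_jump_mark].
Qed.

Lemma clip_measurable d1 (S1 : measurableType d1) (g : S1 -> R) (M : R) :
  measurable_fun setT g -> measurable_fun setT (fun x => Num.max (- M) (Num.min M (g x))).
Proof. by move=> mg; apply: measurable_maxr => //; exact: measurable_minr. Qed.

Lemma clip_bound (M r : R) : 0 <= M -> `|Num.max (- M) (Num.min M r)| <= M.
Proof.
move=> M0; rewrite ler_norml le_max lexx/= ge_max ge_min lexx/=.
by rewrite andbT; lra.
Qed.

Lemma clip_id (M r : R) : `|r| <= M -> Num.max (- M) (Num.min M r) = r.
Proof. by rewrite ler_norml => /andP[Mr rM]; rewrite min_r// max_r. Qed.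

(** The state changes only on the event of one jump, where the increment is a function of the state
    and the mark. *)
Lemma mean_step k (phi : S -> R) (M : R) : 0 <= M -> tk k.+1 <= T ->
  measurable_fun setT phi -> (forall sg, reach k.+1 sg -> `|phi sg| <= M) ->
  \int[P]_w phi (X k.+1 w) = \int[P]_w phi (X k w) +
  expR (- ((tk k.+1 - tk k) * lam)) *
  \int[P]_w \int[(lebesgue_measure \x nu)%E]_(z in `]tk k, tk k.+1]%classic `*` setT)
    (phi (J (X k w, z)) - phi (X k w)).
Proof.
move=> M0 kT mphi phiM; have kT' := le_trans (tkS k) kT.
(* [phi] is bounded on reachable states only. *)
pose c sg := Num.max (- M) (Num.min M (phi sg)).
have cE sg : reach k.+1 sg -> c sg = phi sg by move=> /phiM; exact: clip_id.
have mc : measurable_fun setT c by exact: clip_measurable.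
pose g (z : S * (R * 'rV[R]_n)) := c (J z) - c z.1.
have mg : measurable_fun setT g.
  apply: measurable_funB; first exact: (measurableT_comp mc mJ).
  by apply: (measurableT_comp mc); exact: measurable_fst.
have gM z : `|g z| <= 2 * M.
  apply: le_trans (ler_normB _ _) _.
  have := clip_bound (phi (J z)) M0; have := clip_bound (phi z.1) M0.
  by rewrite /c; lra.
have Xr w := chain_reach w kT'.
have mX := measurable_chain kT'.
have mxi : measurable_fun setT (xi k).
  by apply: adapted_measurable (tk_itv kT) _; apply: adapted_mark => //; exact: tk_ge0.
have mgX : measurable_fun setT (fun w => g (X k w, xi k w)).
  by apply: (measurableT_comp mg); exact: measurable_fun_pair.
have -> : \int[P]_w \int[(lebesgue_measure \x nu)%E]_(z in `]tk k, tk k.+1]%classic `*` setT)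
    (phi (J (X k w, z)) - phi (X k w)) =
  \int[P]_w \int[(lebesgue_measure \x nu)%E]_(z in `]tk k, tk k.+1]%classic `*` setT)
    g (X k w, z).
  apply: eq_Rintegral => w _; apply: eq_Rintegral => z /set_mem[/= + _].
  rewrite in_itv/= => z1; rewrite /g !cE//; last exact: (reachJ kT (Xr w)).
  exact: (reachS kT (Xr w)).
rewrite -(chain_mark_integral kT mg gM) (Rintegral_mkcond P (H k)).
rewrite -RintegralD//.
- apply: eq_Rintegral => w _; rewrite patchE /=.
  case: (eqVneq (N w (cellk k)) 1%E) => [Nw|Nw].
    rewrite mem_set//= /g !cE//; first by rewrite addrC subrK.
      exact: (reachS kT (Xr w)).
    exact: (reachJ kT (Xr w) (one_jump_mark kT Nw)).
  by rewrite memNset ?addr0//= => /eqP; rewrite (negbTE Nw).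
- have : P.-integrable setT (EFin \o (c \o X k)).
    apply: (integrable_bounded_proba (M := M)); first exact: (measurableT_comp mc).
    by move=> w; exact: clip_bound.
  apply: eq_integrable => // w _ /=; rewrite cE//; exact: (reachS kT (Xr w)).
- apply: (integrable_bounded_proba (M := 2 * M)).
    apply/(measurable_restrictT _ (measurable_one_jump kT)).
    exact: measurable_funTS.
  by move=> w; rewrite patchE; case: ifP => // _; rewrite normr0 mulr_ge0.
Qed.

Variables (h : R) (ag : nat -> S -> R) (A : R).
Hypotheses (h0 : 0 <= h) (A0 : 0 <= A) (lam0 : 0 < lam).
Hypothesis tkh : forall k, tk k.+1 - tk k = h.
Hypothesis mag : forall k, measurable_fun setT (ag k).
Hypothesis ag0 : ag 0 s0 = 0.
Hypothesis agA : forall k sg, tk k <= T -> reach k sg -> 0 <= ag k sg <= A.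
Hypothesis agS : forall k sg, tk k.+1 <= T -> reach k sg -> ag k.+1 sg <= ag k sg + h.
Hypothesis agJ : forall k sg z, tk k.+1 <= T -> reach k sg ->
  tk k < z.1 <= tk k.+1 -> ag k.+1 (J (sg, z)) <= h.

Lemma ag_integrable k : tk k <= T -> P.-integrable setT (EFin \o (ag k \o X k)).
Proof.
move=> kT; apply: (integrable_bounded_proba (M := A)).
  by apply: (measurableT_comp (mag k)); exact: measurable_chain.
by move=> w; have /andP[a0 aA] := agA kT (chain_reach w kT); rewrite ger0_norm.
Qed.

(* The expected age is kept bounded by the jumps: with p = lam h e^(-lam h) the *)
(* probability of one jump in a cell, E ag_{k+1} <= h + (1 - p) E ag_k.         *)
Lemma mean_age k : tk k <= T -> \int[P]_w ag k (X k w) <= expR (lam * h) / lam.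
Proof.
elim: k => [_|k ih kT].
  rewrite /= ag0 Rintegral_cst// mul0r divr_ge0// ?expR_ge0//; exact: ltW.
have kT' := le_trans (tkS k) kT.
have Xr w := chain_reach w kT'.
have ia := ag_integrable kT'; have iaS := ag_integrable kT.
have P1 : fine (P setT) = 1 by rewrite probability_setT.
pose g (z : S * (R * 'rV[R]_n)) := Num.max (- A) (Num.min A (ag k z.1)).
have mg : measurable_fun setT g.
  by apply: clip_measurable; apply: (measurableT_comp (mag k)); exact: measurable_fst.
have gM z : `|g z| <= A by exact: clip_bound.
have gE w z : g (X k w, z) = ag k (X k w).
  rewrite /g /= clip_id//; have /andP[a0 aA] := agA kT' (Xr w).
  by rewrite ger0_norm.
(* The age at the start of the cell is independent of the event of one jump in it. *)
have HE : \int[P]_(w in H k) ag k (X k w) =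
    expR (- (h * lam)) * (h * lam) * \int[P]_w ag k (X k w).
  transitivity (\int[P]_(w in H k) g (X k w, xi k w)).
    by apply: eq_Rintegral => w _; rewrite gE.
  rewrite (chain_mark_integral kT mg gM) tkh -mulrA -(RintegralZl _ measurableT ia).
  congr (_ * _); apply: eq_Rintegral => w _.
  have -> : (fun z => g (X k w, z)) = cst (ag k (X k w)) by apply/funext => z; exact: gE.
  rewrite Rintegral_cst; last exact: measurableX.
  have -> : h * lam = (tk k.+1 - tk k) * lam by rewrite tkh.
  rewrite mulrC; congr (_ * _).
  by have /(congr1 fine) := strip_measure (n := n) hs he (tkS k).
have mH := measurable_one_jump kT.
have iaH : P.-integrable setT (EFin \o ((ag k \o X k) \_ (H k))).
  have := (integrable_mkcond _ mH).1 (integrableS measurableT mH (@subsetT _ _) ia).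
  by apply: eq_integrable => // w _ /=; rewrite !patchE; case: ifP.
have ih0 : P.-integrable setT (EFin \o cst h).
  by apply: (integrable_bounded_proba (M := `|h|)).
have ias : P.-integrable setT (EFin \o (fun w => h + ag k (X k w))).
  by have := integrableD measurableT ih0 ia; apply: eq_integrable.
apply: (@le_trans _ _ (\int[P]_w (h + ag k (X k w) - ((ag k \o X k) \_ (H k)) w))).
  apply: le_Rintegral => //.
    by have := integrableB measurableT ias iaH; apply: eq_integrable.
  move=> w _; rewrite chainS patchE /=.
  case: (eqVneq (N w (cellk k)) 1%E) => [Nw|Nw].
    rewrite mem_set// addrK; exact: (agJ kT (Xr w) (one_jump_mark kT Nw)).
  rewrite memNset ?subr0; first by rewrite addrC; exact: (agS kT (Xr w)).
  by move=> /= /eqP; rewrite (negbTE Nw).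
rewrite RintegralB// RintegralD// Rintegral_cst// P1 mulr1 -Rintegral_mkcond HE.
have ih' := ih kT'; set a := \int[P]_w ag k (X k w) in ih' *.
have e1 : expR (lam * h) * expR (- (h * lam)) = 1.
  by rewrite -expRD mulrC subrr expR0.
have x0 : 0 <= h * lam by rewrite mulr_ge0// ltW.
have p1 : 0 <= 1 - expR (- (h * lam)) * (h * lam).
  rewrite subr_ge0 -[leRHS]e1 mulrC ler_wpM2r ?expR_ge0// (mulrC lam).
  by have := expR_ge1Dx (h * lam); lra.
(* The claimed bound is the fixed point of the recursion a -> h + (1 - p) a. *)
have pe : expR (- (h * lam)) * (h * lam) * (expR (lam * h) / lam) = h.
  rewrite -[RHS]mul1r -e1; field; exact: lt0r_neq0.
move: pe (ler_wpM2r p1 ih'); set p := expR (- (h * lam)) * (h * lam).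
by rewrite !mulrBr !mulr1 (mulrC a) (mulrC (_ / lam)) => ->; lra.
Qed.

Variables (V : nat -> S -> R) (M c e : R).
Hypotheses (M0 : 0 <= M) (c0 : 0 <= c).
Hypothesis mV : forall k, measurable_fun setT (V k).
Hypothesis VM : forall k sg, tk k <= T -> reach k sg -> `|V k sg| <= M.
Hypothesis step : forall k sg, tk k.+1 <= T -> reach k sg ->
  `|V k.+1 sg - V k sg + expR (- (h * lam)) *
    \int[(lebesgue_measure \x nu)%E]_(z in `]tk k, tk k.+1]%classic `*` setT)
       (V k.+1 (J (sg, z)) - V k.+1 sg)| <= h * (c * ag k sg + e).

(** Telescoping: [mean_step] turns each mean increment into the integral of the one-step error,
    whose only random part is the age, bounded in the mean by [mean_age]. *)
Lemma mean_value k : tk k <= T ->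
  `|\int[P]_w V k (X k w) - V 0%N s0| <= k%:R * (h * (c * (expR (lam * h) / lam) + e)).
Proof.
have P1 : fine (P setT) = 1 by rewrite probability_setT.
elim: k => [_|k ih kT].
  by rewrite /= Rintegral_cst// P1 mulr1 subrr normr0 mul0r.
have kT' := le_trans (tkS k) kT.
have Xr w := chain_reach w kT'.
have mX := measurable_chain kT'.
have iV : P.-integrable setT (EFin \o (V k \o X k)).
  apply: (integrable_bounded_proba (M := M)); first exact: (measurableT_comp (mV k)).
  by move=> w; apply: VM.
have iV' : P.-integrable setT (EFin \o (V k.+1 \o X k)).
  apply: (integrable_bounded_proba (M := M)); first exact: (measurableT_comp (mV k.+1)).
  by move=> w; apply: VM => //; exact: (reachS kT (Xr w)).
set K := fun w => \int[(lebesgue_measure \x nu)%E]_(z in `]tk k, tk k.+1]%classic `*` setT)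
       (V k.+1 (J (X k w, z)) - V k.+1 (X k w)).
have iK : P.-integrable setT (EFin \o K).
  pose C sg := Num.max (- M) (Num.min M (V k.+1 sg)).
  have CE sg : reach k.+1 sg -> C sg = V k.+1 sg by move=> r; apply: clip_id; exact: VM.
  have mC : measurable_fun setT C by apply: clip_measurable.
  pose g (z : S * (R * 'rV[R]_n)) := C (J z) - C z.1.
  have mg : measurable_fun setT g.
    apply: measurable_funB; first exact: (measurableT_comp mC mJ).
    by apply: (measurableT_comp mC); exact: measurable_fst.
  have gM z : `|g z| <= 2 * M.
    apply: le_trans (ler_normB _ _) _.
    have := clip_bound (V k.+1 (J z)) M0; have := clip_bound (V k.+1 z.1) M0.
    by rewrite /C; lra.
  have [mI IM] := @strip_integralP k g (2 * M) (mulr_ge0 (ler0n _ 2) M0) mg gM.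
  have := integrable_bounded_proba (measurableT_comp mI mX) (fun w => IM (X k w)).
  apply: eq_integrable => // w _ /=; congr (_%:E).
  apply: eq_Rintegral => z /set_mem[/= + _].
  rewrite in_itv/= => z1; rewrite /g !CE//; last exact: (reachJ kT (Xr w)).
  exact: (reachS kT (Xr w)).
have -> : \int[P]_w V k.+1 (X k.+1 w) - V 0%N s0 =
  \int[P]_w (V k.+1 (X k w) - V k (X k w) + expR (- (h * lam)) * K w) +
  (\int[P]_w V k (X k w) - V 0%N s0).
  rewrite (mean_step (M := M))//; last by move=> sg; apply: VM.
  rewrite tkh -/K RintegralD//; last 2 first.
  - by have := integrableB measurableT iV' iV; apply: eq_integrable.
  - by have := integrableZl measurableT (expR (- (h * lam))) iK; apply: eq_integrable.
  rewrite RintegralB// (RintegralZl _ measurableT iK); ring.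
rewrite -(natr1 k) mulrDl mul1r [leRHS]addrC.
apply: le_trans (ler_normD _ _) _; apply: lerD; last exact: ih.
have ia := ag_integrable kT'.
have ic : P.-integrable setT (EFin \o (fun w => c * ag k (X k w))).
  by have := integrableZl measurableT c ia; apply: eq_integrable.
have ie : P.-integrable setT (EFin \o cst e).
  by apply: (integrable_bounded_proba (M := `|e|)).
have ice : P.-integrable setT (EFin \o (fun w => c * ag k (X k w) + e)).
  by have := integrableD measurableT ic ie; apply: eq_integrable.
have ib : P.-integrable setT (EFin \o (fun w => h * (c * ag k (X k w) + e))).
  by have := integrableZl measurableT h ice; apply: eq_integrable.
have iD : P.-integrable setT (EFin \o (fun w => V k.+1 (X k w) - V k (X k w))).
  by have := integrableB measurableT iV' iV; apply: eq_integrable.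
have iqK : P.-integrable setT (EFin \o (fun w => expR (- (h * lam)) * K w)).
  by have := integrableZl measurableT (expR (- (h * lam))) iK; apply: eq_integrable.
have iS : P.-integrable setT (EFin \o (fun w => V k.+1 (X k w) - V k (X k w) +
    expR (- (h * lam)) * K w)).
  by have := integrableD measurableT iD iqK; apply: eq_integrable.
apply: (@le_trans _ _ (\int[P]_w (h * (c * ag k (X k w) + e)))).
  apply: le_trans (le_normr_Rintegral measurableT iS) _.
  apply: le_Rintegral => //.
    by have := integrable_abse iS; apply: eq_integrable.
  by move=> w _; exact: (step kT (Xr w)).
rewrite (RintegralZl _ measurableT ice) ler_wpM2l//.
rewrite RintegralD// (RintegralZl _ measurableT ia) Rintegral_cst// P1 mulr1.
by rewrite lerD2r ler_wpM2l//; exact: mean_age.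
Qed.

End chain.

End poisson.

(** * Paths of the scheme *)

Section path.
Context {R : realType} {n : nat}.
Variables (T t : R) (D : set 'rV[R]_n) (b : R -> 'rV[R]_n -> 'rV[R]_n).
Variables (c f u : R -> 'rV[R]_n -> R) (K : R).
Variables (x : 'rV[R]_n) (L X : R -> 'rV[R]_n) (Y Z : R -> R) (tau : nat -> R).
Hypotheses (tT : t <= T) (K0 : 0 <= K) (openD : open D).
Hypothesis bK : forall t x i, `|b t x ord0 i| <= K.
Hypothesis He : jump_adapted_euler D b c f T L t x X Y Z tau.

Local Notation theta := (stop_time D T t X).

Lemma exit_time_ge : (t%:E <= exit_time D t X)%E.
Proof. by apply: le_ereal_inf_tmp => _ [r [tr _] <-]; rewrite lee_fin. Qed.

Lemma stop_timeE : theta%:E = mine T%:E (exit_time D t X).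
Proof.
rewrite /stop_time fineK// fin_numE.
have H : (t%:E <= mine T%:E (exit_time D t X))%E by rewrite le_min lee_fin tT exit_time_ge.
apply/andP; split; apply/eqP => E.
  by move: H; rewrite E leeNy_eq.
have : (mine T%:E (exit_time D t X) <= T%:E)%E by rewrite ge_min lexx.
by rewrite E leye_eq.
Qed.

Lemma stop_time_itv : t <= theta <= T.
Proof.
rewrite -!lee_fin stop_timeE le_min exit_time_ge lee_fin tT /=.
by rewrite ge_min lexx.
Qed.

Lemma stop_time_le r : t <= r -> ~ D (X r) -> theta <= r.
Proof.
move=> tr Dr; rewrite -lee_fin stop_timeE ge_min; apply/orP; right.
by apply: ereal_inf_lbound; exists r.
Qed.

Lemma stop_before r : t <= r -> r < theta -> D (X r).
Proof. by move=> tr rth; apply: contrapT => /(stop_time_le tr); rewrite leNgt rth. Qed.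

(** Otherwise a point of the path outside the domain would occur after the stopping time, where the
    path is constant and equal to a point of the domain; so there would be no exit before [T]. *)
Lemma stop_exit : theta < T -> ~ D (X theta).
Proof.
move=> thT Dth; have : (T%:E <= exit_time D t X)%E.
  apply: le_ereal_inf_tmp => _ [r [tr Dr] <-]; have := stop_time_le tr Dr.
  by move=> /(euler_stop He) Xr; rewrite Xr in Dr.
move=> /min_idPl E; move: stop_timeE; rewrite E => -[thE].
by rewrite thE ltxx in thT.
Qed.

Lemma next_jump_ge a : (a%:E <= next_jump_time L a)%E.
Proof. by apply: le_ereal_inf_tmp => _ [r [ar _] <-]; rewrite lee_fin ltW. Qed.

Lemma tauSE i : (tau i.+1)%:E = mine (next_jump_time L (tau i)) theta%:E.
Proof.
have -> : (tau i.+1)%:E = (fine (mine (next_jump_time L (tau i)) theta%:E))%:E.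
  by rewrite (euler_tauS He) stop_timeE -minA (minC T%:E).
rewrite fineK// fin_numE; apply/andP; split; apply/eqP => E.
  have : (mine (tau i)%:E theta%:E <= mine (next_jump_time L (tau i)) theta%:E)%E.
    by rewrite le_min !ge_min lexx next_jump_ge orbT.
  by rewrite E leeNy_eq; case: leP.
have : (mine (next_jump_time L (tau i)) theta%:E <= theta%:E)%E.
  by rewrite ge_min lexx orbT.
by rewrite E leye_eq.
Qed.

Lemma tauS_le i : tau i.+1 <= theta.
Proof. by rewrite -lee_fin tauSE ge_min lexx orbT. Qed.

Lemma tauS_ge i e : tau i <= e -> (forall q, tau i < q -> q <= e -> jump L q = 0) ->
  Num.min e theta <= tau i.+1.
Proof.
move=> ae noj; rewrite -lee_fin tauSE EFin_min le_min !ge_min lexx orbT andbT.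
apply/orP; left; apply: le_ereal_inf_tmp => _ [r [ar jr] <-]; rewrite lee_fin leNgt.
by apply/negP => re; rewrite noj ?eqxx// ltW in jr.
Qed.

Lemma tauS_le_jump i q : tau i < q -> jump L q != 0 -> tau i.+1 <= q.
Proof.
move=> aq jq; rewrite -lee_fin tauSE ge_min; apply/orP; left.
by apply: ereal_inf_lbound; exists q.
Qed.

Lemma euler_linear i r : tau i < theta -> tau i < r < tau i.+1 ->
  X r = xlin b (tau i) (X (tau i)) r.
Proof. by move=> ath ar; rewrite (euler_X He ath ar). Qed.

Lemma euler_end i : tau i < theta -> tau i < tau i.+1 ->
  X (tau i.+1) = xlin b (tau i) (X (tau i)) (tau i.+1) + jump L (tau i.+1).
Proof.
move=> ath ai; rewrite (euler_X_jump He ath); congr (_ + _).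
apply/cvg_lim => //; apply: cvg_trans (_ : xlin b (tau i) (X (tau i)) r @[r --> (tau i.+1)^'-] --> _).
  apply: near_eq_cvg; near=> r; apply/esym/euler_linear => //; apply/andP; split.
    by near: r; exact: nbhs_left_gt.
  by near: r; exact: nbhs_left_lt.
apply: cvg_at_left_filter; rewrite /xlin; apply: cvgD; first exact: cvg_cst.
by apply: cvgZr_tmp; apply: cvgB; [exact: cvg_id|exact: cvg_cst].
Unshelve. all: by end_near. Qed.

Lemma euler_YZ i r : tau i < theta -> tau i < r <= tau i.+1 ->
  Y r = ylin c (tau i) (X (tau i)) (Y (tau i)) r /\
  Z r = zlin f (tau i) (X (tau i)) (Y (tau i)) (Z (tau i)) r.
Proof. by move=> ath ar; rewrite (euler_Y He ath ar) (euler_Z He ath ar). Qed.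

(* [sg] is the state of the scheme at some grid time before [r], and the driving
   path has not jumped since, up to [r] or to the exit of the frozen flow. *)
Definition at_state (r : R) (sg : state) : Prop := exists i,
  [/\ (tau i, X (tau i), Y (tau i), Z (tau i)) = sg, t <= tau i, tau i <= r,
      tau i <= theta &
      forall q, tau i < q -> q <= r -> q <= exit_of T D b sg -> jump L q = 0].

Lemma at_state0 : at_state t (t, x, 1, 0).
Proof.
exists 0%N; rewrite (euler_tau0 He) (euler_X0 He) (euler_Y0 He) (euler_Z0 He).
have /andP[tth _] := stop_time_itv.
by split => // q tq qt; move: (lt_le_trans tq qt); rewrite ltxx.
Qed.

(** A stopped state is dead: its frozen flow exits at its own starting time, so that later jumps are
    ignored by [jump_state]. *)
Lemma exit_stopped i : t <= tau i -> tau i = theta ->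
  exit T D b (tau i) (X (tau i)) = theta.
Proof.
move=> ti ith; have /andP[_ thT] := stop_time_itv.
have iT : tau i <= T by rewrite ith.
have [lo hi] := (exit_ge D b (X (tau i)) iT, exit_le D b (X (tau i)) iT).
apply/eqP; rewrite eq_le -{2}ith lo andbT.
have [->//|neT] := eqVneq theta T.
have {neT} thT : theta < T by rewrite lt_neqAle neT.
rewrite leNgt; apply/negP => ex; apply: (stop_exit thT).
rewrite -ith in ex; have := @exit_before _ _ _ D b _ (X (tau i)) iT (tau i).
by rewrite lexx ex xlin_t => /(_ isT); rewrite ith.
Qed.

Lemma at_state_mono r r' sg : at_state r sg -> r <= r' ->
  (forall q, r < q -> q <= r' -> q <= exit_of T D b sg -> jump L q = 0) ->
  at_state r' sg.
Proof.
move=> [i [sgE ti ir ith noj]] rr' noj'; exists i; split => //.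
  exact: le_trans rr'.
move=> q iq qr' qe; have [qr|rq] := leP q r; first exact: noj.
exact: noj'.
Qed.

Lemma at_state_jump r r' sg q : at_state r sg -> r < q -> q <= r' -> r' <= T ->
  q <= exit_of T D b sg -> jump L q != 0 ->
  (forall q', r < q' -> q' <= r' -> q' != q -> jump L q' = 0) ->
  at_state r' (jump_state T D b c f sg (q, jump L q)).
Proof.
move=> [i [sgE ti ir ith noj]] rq qr' r'T qe jq noj'.
have iq : tau i < q by exact: le_lt_trans rq.
move: qe noj; rewrite -{1 2}sgE /exit_of /= => qe noj.
have ith' : tau i < theta.
  rewrite lt_neqAle ith andbT; apply/eqP => E.
  by move: qe; rewrite (exit_stopped ti E) -E leNgt iq.
have tS1 := tauS_le_jump iq jq; have tS2 := tauS_le i.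
have iT : tau i <= T by lra.
(* Otherwise the midpoint would be a time with no jump up to it, and the next grid time would lie at
   or beyond it. *)
have tS3 : Num.min q theta <= tau i.+1.
  have [//|lt] := leP (Num.min q theta) (tau i.+1).
  have iS : tau i <= tau i.+1.
    by rewrite -lee_fin tauSE le_min next_jump_ge lee_fin.
  have := @tauS_ge i ((tau i.+1 + Num.min q theta) / 2).
  have m1 : Num.min q theta <= q by rewrite ge_min lexx.
  have m2 : Num.min q theta <= theta by rewrite ge_min lexx orbT.
  move=> H; suff : Num.min ((tau i.+1 + Num.min q theta) / 2) theta <= tau i.+1.
    by rewrite ge_min => /orP[]; lra.
  apply: H; first lra.
  move=> q' iq' q'e; have [q'r|rq'] := leP q' r.
    by apply: noj => //; lra.
  by apply: noj' => //; [lra|rewrite lt_eqF//; lra].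
have qth : q <= theta.
  rewrite leNgt; apply/negP => thq.
  have E : tau i.+1 = theta.
    by apply/eqP; rewrite eq_le tS2/=; move: tS3; rewrite min_r// ltW.
  have iS : tau i < tau i.+1 by rewrite E.
  have := euler_end ith' iS; rewrite E => Xth.
  have j0 : jump L theta = 0.
    have [thr|rth] := leP theta r; first by apply: noj => //; lra.
    by apply: noj' => //; [lra|rewrite lt_eqF].
  have thT : theta < T by lra.
  apply: (stop_exit thT); rewrite Xth j0 addr0.
  by apply: (exit_before iT); apply/andP; split; lra.
have E : tau i.+1 = q.
  by apply/eqP; rewrite eq_le tS1/=; move: tS3; rewrite min_l.
have iS : tau i < tau i.+1 by rewrite E.
exists i.+1; rewrite E; split => //; last 2 first.
- by lra.
- move=> q' qq' q'r _; apply: noj' => //; first by lra.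
  by rewrite gt_eqF.
rewrite -sgE /jump_state /exit_of /= qe.
have YZq : tau i < q <= tau i.+1 by rewrite iq E lexx.
have [-> ->] := euler_YZ ith' YZq.
by have := euler_end ith' iS; rewrite E => ->.
Qed.

Lemma at_state_end sg : at_state T sg ->
  u theta (X theta) * Y theta + Z theta = flow_value T D b c f u T sg.
Proof.
move=> [i [sgE ti iT ith noj]].
move: noj; rewrite -{1 2}sgE /flow_value /exit_of /= => noj.
have [lo hi] := (exit_ge D b (X (tau i)) iT, exit_le D b (X (tau i)) iT).
rewrite min_r//; set e := exit T D b _ _ in noj lo hi *.
have /andP[_ thT] := stop_time_itv.
move: ith; rewrite le_eqVlt => /predU1P[E|ith].
  have -> : e = theta by exact: exit_stopped.
  by rewrite -E /payoff xlin_t /ylin /zlin subrr !mulr0 !addr0.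
have tS1 : Num.min e theta <= tau i.+1.
  by apply: tauS_ge => // q iq qe; apply: noj => //; lra.
have tS2 := tauS_le i.
(* Before the stopping time the scheme is in the open domain, so the flow exits strictly later. *)
have ie : tau i < e.
  rewrite lt_neqAle lo andbT; apply/eqP => E.
  have eT : e < T by lra.
  by apply: (exit_at K0 bK openD iT eT); rewrite -/e -E xlin_t; exact: stop_before.
have iS : tau i < tau i.+1 by rewrite (lt_le_trans _ tS1)// lt_min ie.
have eth : e <= theta.
  rewrite leNgt; apply/negP => the.
  have E : tau i.+1 = theta.
    by apply/eqP; rewrite eq_le tS2/=; move: tS1; rewrite min_r// ltW.
  have := euler_end ith iS; rewrite E => Xth.
  have j0 : jump L theta = 0 by apply: noj => //; lra.
  have thT' : theta < T by lra.
  apply: (stop_exit thT'); rewrite Xth j0 addr0.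
  by apply: (exit_before iT); apply/andP; split; [lra|].
rewrite min_l// in tS1.
have je : jump L e = 0 by apply: noj.
have Xe : X e = xlin b (tau i) (X (tau i)) e.
  move: tS1; rewrite le_eqVlt => /predU1P[E|lt].
    by have := euler_end ith iS; rewrite -E je addr0.
  by apply: euler_linear => //; rewrite ie.
have E : e = theta.
  apply/eqP; rewrite eq_le eth/= leNgt; apply/negP => lt.
  have eT : e < T by lra.
  apply: (exit_at K0 bK openD iT eT); rewrite -/e -Xe; apply: stop_before => //.
  exact: le_trans ti lo.
have [Ye Ze] : Y e = ylin c (tau i) (X (tau i)) (Y (tau i)) e /\
    Z e = zlin f (tau i) (X (tau i)) (Y (tau i)) (Z (tau i)) e.
  by apply: euler_YZ => //; rewrite ie.
by rewrite -E Xe Ye Ze.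
Qed.

End path.

(** * Jumps of the truncated Levy path *)

Section trunc_levy_path.
Context {R : realType} {n : nat}.
Variables (s : R) (hs : 0 < s < 1) (eps : R) (he : 0 < eps) (he1 : eps < 1) (T : R).
Variable M : {measure set (R * 'rV[R]_n) -> \bar R}.

Local Notation cell := (cell (n := n) eps).
Local Notation lam := (levy_mass (n := n) hs he).

Hypothesis MZ : forall B, measurable B -> B `<=` cell 0 T ->
  M B = +oo%E \/ exists k : nat, M B = k%:R%:E.
Hypothesis Moo : (M (cell 0 T) < +oo)%E.

Definition ring_strip (J : interval R) (p q : R) : set (R * 'rV[R]_n) :=
  `]p, q]%classic `*` [set y | [set` J] (enorm y)].

Lemma measurable_ring_strip J p q : measurable (ring_strip J p q).
Proof.
by apply: measurableX => //; apply: measurable_enorm_set; exact: measurable_itv.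
Qed.

Lemma ring_stripU J p q r : p <= q -> q <= r ->
  ring_strip J p r = ring_strip J p q `|` ring_strip J q r.
Proof.
move=> pq qr; apply/seteqP; split => -[a y].
  move=> [/=]; rewrite in_itv/= => /andP[pa ar] Jy.
  by have [aq|qa] := leP a q; [left|right]; split => //=; rewrite in_itv/= ?pa ?qa.
by case=> -[/=]; rewrite in_itv/= => /andP[a1 a2] Jy; split => //=; rewrite in_itv/=;
  apply/andP; split; lra.
Qed.

Lemma ring_strip_disj J p q r : [disjoint ring_strip J p q & ring_strip J q r].
Proof.
rewrite disj_set2E; apply/eqP; apply/seteqP; split => // -[a y] [[/= + _] [/= + _]].
by rewrite !in_itv/= => /andP[_ aq] /andP[qa _]; move: (lt_le_trans qa aq); rewrite ltxx.
Qed.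

Local Notation Js := (`]eps, 1%R[ : interval R).
Local Notation Jl := (`[1%R, +oo[ : interval R).

Lemma ring_strip_cell p q : cell p q = ring_strip Js p q `|` ring_strip Jl p q.
Proof.
apply/seteqP; split => -[a y] /=.
  rewrite /cell /= => -[apq ey]; rewrite /ring_strip/=.
  by have [y1|y1] := ltP (enorm y) 1; [left|right]; split => //=; rewrite in_itv/= ?ey ?y1.
by case=> -[/= apq]; rewrite in_itv/= => ey; split => //=; move: ey; have := he1; lra.
Qed.

Lemma integer_lt1 B : measurable B -> B `<=` cell 0 T -> (M B < 1)%E -> M B = 0%E.
Proof.
move=> mB Bc; have [->//|[k ->]] := MZ mB Bc.
by rewrite -[1%E]/(1%:R%:E) lte_fin ltr_nat ltnS leqn0 => /eqP ->.
Qed.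

Lemma cell_sub_fin B : measurable B -> B `<=` cell 0 T -> (M B < +oo)%E.
Proof.
move=> mB Bc; apply: le_lt_trans Moo; apply: le_measure; rewrite ?inE//.
exact: measurable_cell.
Qed.

(** The masses of jumps larger than k decrease to 0 by finiteness of [M], and integers tending to 0
    reach 0. *)
Lemma bounded_jumps : exists k : nat,
  M (cell 0 T `&` [set z | k%:R < enorm z.2]) = 0%E.
Proof.
pose F k := cell 0 T `&` [set z | k%:R < enorm z.2].
have mF k : measurable (F k).
  apply: measurableI; first exact: measurable_cell.
  have -> : [set z : R * 'rV[R]_n | k%:R < enorm z.2] = snd @^-1` [set y | k%:R < enorm y] by [].
  rewrite -[X in measurable X]setTI; apply: measurable_snd => //.
  exact: measurable_enorm_gt.
have F0 : \bigcap_k F k = set0.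
  apply/seteqP; split => // z Fz.
  have := archi_boundP (enorm_ge0 z.2); set k := Num.bound _ => zk.
  by have [_ /=] := Fz k I; rewrite ltNge (ltW zk).
have := @nonincreasing_cvg_mu _ _ _ M F.
rewrite F0 measure0 => /(_ _ mF measurable0) H.
have {H} : M (F k) @[k --> \oo] --> 0%E.
  apply: H; first by apply: cell_sub_fin => //; exact: subIsetl.
  move=> k l kl; apply/subsetPset => z [cz /= zl]; split => //=.
  by apply: le_lt_trans zl; rewrite ler_nat.
move=> H; apply: contrapT => /forallNP N0.
have : (1 <= limn (M \o F))%E.
  apply: lime_ge; first by apply/cvg_ex; exists 0%E.
  apply: nearW => k /=; rewrite leNgt; apply/negP => /integer_lt1 MF.
  by apply: (N0 k); apply: MF => //; exact: subIsetl.
by rewrite (cvg_lim _ H)// leNgt lte01.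
Qed.

Lemma measurable_coord i : measurable_fun setT (fun z : R * 'rV[R]_n => z.2 ord0 i).
Proof.
have -> : (fun z : R * 'rV[R]_n => z.2 ord0 i) = rV_coord i \o snd by [].
by apply: measurableT_comp; [exact: measurable_rV_coord|exact: measurable_snd].
Qed.

Lemma integrable_coord i B : measurable B -> B `<=` cell 0 T ->
  M.-integrable B (EFin \o (fun z : R * 'rV[R]_n => z.2 ord0 i)).
Proof.
move=> mB Bc; have mc := measurable_coord i.
have Boo := cell_sub_fin mB Bc.
have [k k0] := bounded_jumps.
have mk : measurable [set z : R * 'rV[R]_n | k%:R < enorm z.2].
  have -> : [set z : R * 'rV[R]_n | k%:R < enorm z.2] = snd @^-1` [set y | k%:R < enorm y] by [].
  rewrite -[X in measurable X]setTI; apply: measurable_snd => //.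
  exact: measurable_enorm_gt.
set G := [set z | _] in k0 mk.
have mBG : measurable (B `&` G) by exact: measurableI.
have mBD : measurable (B `\` G) by exact: measurableD.
have BG0 : M (B `&` G) = 0%E.
  apply/eqP; rewrite -measure_le0 -k0; apply: le_measure; rewrite ?inE//.
    by apply: measurableI => //; exact: measurable_cell.
  by apply: setSI.
apply/integrableP; split; first exact/measurable_EFinP/measurable_funTS.
have ma : measurable_fun setT (fun z : R * 'rV[R]_n => `|(EFin \o (fun z : R * 'rV[R]_n => z.2 ord0 i)) z|%E).
  by apply: measurableT_comp => //; exact/measurable_EFinP.
rewrite -(setUIDK B G) ge0_integral_setU//; last 2 first.
- exact: measurable_funTS.
- by rewrite disj_set2E; apply/eqP/seteqP; split => // z [[_ Gz] [_]].
rewrite null_set_integral// ?add0e; last exact: measurable_funTS.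
have := @integrable_bounded _ _ _ M (B `\` G) (fun z : R * 'rV[R]_n => z.2 ord0 i) k%:R mBD.
move=> /(_ _ (measurable_funTS mc) _)/integrableP[].
- by apply: le_lt_trans Boo; apply: le_measure; rewrite ?inE//; exact: subDsetl.
- move=> z [_ /negP]; rewrite -leNgt => zk; apply: le_trans zk.
  exact: ler_coord_enorm.
- by [].
Qed.

Definition compensator i p q : R :=
  \int[(lebesgue_measure \x lebesgue_rV n)%E]_(z in ring_strip Js p q)
    (z.2 ord0 i * levy_density s z.2).

Lemma trunc_levyE i r : trunc_levy s eps M r ord0 i =
  \int[M]_(z in ring_strip Js 0 r) z.2 ord0 i - compensator i 0 r +
  \int[M]_(z in ring_strip Jl 0 r) z.2 ord0 i.
Proof.
rewrite mxE /compensator /ring_strip.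
have -> : [set y : 'rV[R]_n | [set` Js] (enorm y)] = [set y | eps < enorm y < 1].
  by apply/seteqP; split => y /=; rewrite in_itv.
have -> // : [set y : 'rV[R]_n | [set` Jl] (enorm y)] = [set y | 1 <= enorm y].
by apply/seteqP; split => y /=; rewrite in_itv/= andbT.
Qed.

Lemma compensator_abs i p q : p <= q ->
  (\int[lebesgue_measure \x lebesgue_rV n]_(z in ring_strip Js p q)
    `|(z.2 ord0 i * levy_density s z.2)%:E| <= ((q - p) * lam)%:E)%E.
Proof.
move=> pq; have mS := measurable_ring_strip Js p q.
have mc : measurable (cell p q) by exact: measurable_cell.
have md : measurable_fun setT (fun z : R * 'rV[R]_n => levy_density s z.2).
  have -> : (fun z : R * 'rV[R]_n => levy_density s z.2) = levy_density s \o snd by [].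
  by apply: measurableT_comp; [exact: measurable_levy_density|exact: measurable_snd].
apply: (@le_trans _ _ (\int[lebesgue_measure \x lebesgue_rV n]_(z in ring_strip Js p q)
    (levy_density s z.2)%:E)%E).
  apply: ge0_le_integral => //.
  - apply: measurableT_comp => //; apply/measurable_EFinP; apply: measurable_funTS.
    by apply: measurable_funM => //; exact: measurable_coord.
  - by apply/measurable_EFinP; exact: measurable_funTS.
  - move=> z [_ /=]; rewrite in_itv/= => /andP[_ z1].
    rewrite lee_fin normrM (ger0_norm (levy_density_ge0 hs _)).
    rewrite ler_piMl ?levy_density_ge0//; apply: le_trans (ltW z1).
    exact: ler_coord_enorm.
apply: (@le_trans _ _ (levy_intensity s (setT `&` cell p q))); last first.
  by rewrite (levy_intensity_cell hs he)// setTI strip_measure.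
rewrite setTI /levy_intensity; apply: ge0_subset_integral => //.
- by apply/measurable_EFinP; exact: measurable_funTS.
- by move=> z _; rewrite lee_fin levy_density_ge0.
- by rewrite ring_strip_cell; exact: subsetUl.
Qed.

(** Jumps below 1 have coordinates of absolute value at most 1, so the compensator is Lipschitz in
    time with constant [lam], and in particular continuous. *)
Lemma compensator_increment i p q r : p <= q -> q <= r ->
  `|compensator i p r - compensator i p q| <= (r - q) * lam.
Proof.
move=> pq qr; have pr : p <= r by exact: le_trans qr.
have mcd : measurable_fun setT (fun z : R * 'rV[R]_n => z.2 ord0 i * levy_density s z.2).
  apply: measurable_funM; first exact: measurable_coord.
  have -> : (fun z : R * 'rV[R]_n => levy_density s z.2) = levy_density s \o snd by [].
  by apply: measurableT_comp; [exact: measurable_levy_density|exact: measurable_snd].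
have ic p' r' : p' <= r' -> (lebesgue_measure \x lebesgue_rV n)%E.-integrable
    (ring_strip Js p' r') (EFin \o (fun z : R * 'rV[R]_n => z.2 ord0 i * levy_density s z.2)).
  move=> pr'; apply/integrableP; split.
    by apply/measurable_EFinP; exact: measurable_funTS.
  exact: le_lt_trans (compensator_abs i pr') (ltry _).
rewrite /compensator (ring_stripU _ pq qr) Rintegral_setU; last 4 first.
- exact: measurable_ring_strip.
- exact: measurable_ring_strip.
- by rewrite -ring_stripU//; exact: ic.
- exact: ring_strip_disj.
rewrite addrAC subrr add0r; apply: le_trans (le_normr_Rintegral _ (ic _ _ qr)) _.
  exact: measurable_ring_strip.
rewrite -lee_fin fineK; last first.
  rewrite ge0_fin_numE; last exact: integral_ge0.
  exact: le_lt_trans (compensator_abs i qr) (ltry _).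
exact: compensator_abs.
Qed.

Lemma trunc_levy_increment i r r' : 0 <= r -> r <= r' -> r' <= T ->
  `|trunc_levy s eps M r' ord0 i - trunc_levy s eps M r ord0 i -
    \int[M]_(z in cell r r') z.2 ord0 i| <= (r' - r) * lam.
Proof.
move=> r0 rr' r'T; have r'0 := le_trans r0 rr'.
have sub J : J = Js \/ J = Jl -> forall p q, 0 <= p -> q <= T ->
    ring_strip J p q `<=` cell 0 T.
  move=> HJ p q p0 qT z zJ; have [apq ez] : cell p q z.
    by rewrite ring_strip_cell; case: HJ zJ => ->; [left|right].
  split => //=; move: apq; rewrite /= !in_itv/= => /andP[pz zq].
  by rewrite (le_lt_trans p0) ?(le_trans zq).
have split_int J : J = Js \/ J = Jl ->
    \int[M]_(z in ring_strip J 0 r') z.2 ord0 i =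
    \int[M]_(z in ring_strip J 0 r) z.2 ord0 i + \int[M]_(z in ring_strip J r r') z.2 ord0 i.
  move=> HJ; rewrite (ring_stripU _ r0 rr') Rintegral_setU//; first last.
  - exact: ring_strip_disj.
  - rewrite -ring_stripU//; apply: integrable_coord; first exact: measurable_ring_strip.
    exact: sub.
  - exact: measurable_ring_strip.
  - exact: measurable_ring_strip.
have -> : \int[M]_(z in cell r r') z.2 ord0 i =
    \int[M]_(z in ring_strip Js r r') z.2 ord0 i +
    \int[M]_(z in ring_strip Jl r r') z.2 ord0 i.
  rewrite ring_strip_cell Rintegral_setU//.
  - exact: measurable_ring_strip.
  - exact: measurable_ring_strip.
  - rewrite -ring_strip_cell; apply: integrable_coord; first exact: measurable_cell.
    by rewrite ring_strip_cell => z [] zJ; apply: sub zJ => //; [left|right].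
  - rewrite disj_set2E; apply/eqP/seteqP; split => // z [[_ /=] + [_ /=]].
    by rewrite !in_itv/= => /andP[_ z1] /andP[z2 _]; move: (lt_le_trans z1 z2); rewrite ltxx.
rewrite !trunc_levyE !split_int; [|by right|by left].
have := compensator_increment i r0 rr'; rewrite -normrN; apply: le_trans.
rewrite le_eqVlt; apply/orP; left; apply/eqP; congr (`|_|); ring.
Qed.

(** The increment over ]p', q] is [v] up to [lam] (q - p'), which vanishes as p' tends to q from the
    left. *)
Lemma trunc_levy_jump p r q (v : 'rV[R]_n) : 0 <= p -> p < q -> q <= r -> r <= T ->
  (forall p' i, p <= p' -> p' < q -> \int[M]_(z in cell p' q) z.2 ord0 i = v ord0 i) ->
  jump (trunc_levy s eps M) q = v.
Proof.
move=> p0 pq qr rT Hv.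
have lam0 : 0 <= lam by rewrite fine_ge0.
have lam1 : 0 < lam + 1 by lra.
suff H : trunc_levy s eps M e @[e --> q^'-] --> trunc_levy s eps M q - v.
  by rewrite /jump (cvg_lim _ H)//; rewrite subKr.
apply/cvg_ballP => e e0; near=> e'.
have e'q : e' < q by near: e'; exact: nbhs_left_lt.
have pe' : p <= e' by near: e'; exact: nbhs_left_ge.
have qe : q - e' < e / (lam + 1).
  have : q - e / (lam + 1) < e'.
    by near: e'; apply: nbhs_left_gt; rewrite ltrBlDr ltrDl divr_gt0.
  lra.
split => // i0 i; rewrite ord1 /ball/= !mxE -(Hv e')//.
have := trunc_levy_increment i (le_trans p0 pe') (ltW e'q) (le_trans qr rT).
have : (q - e') * lam < e.
  move: qe; rewrite ltr_pdivlMr// => qe; apply: le_lt_trans qe.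
  by rewrite ler_wpM2l// ?subr_ge0 ?lerDl// ltW.
rewrite !mxE addrAC => h1 h2; exact: le_lt_trans h2 h1.
Unshelve. all: by end_near. Qed.

Lemma cell_subset p q p' q' : p <= p' -> q' <= q -> cell p' q' `<=` cell p q.
Proof.
move=> pp' q'q z [/= + ez]; rewrite in_itv/= => /andP[z1 z2]; split => //=.
by rewrite in_itv/= (le_lt_trans pp') ?(le_trans z2).
Qed.

Lemma trunc_levy_jump0 p r q : 0 <= p -> p < q -> q <= r -> r <= T ->
  M (cell p r) = 0%E -> jump (trunc_levy s eps M) q = 0.
Proof.
move=> p0 pq qr rT M0; apply: (trunc_levy_jump p0 pq qr rT) => p' i pp' p'q.
have mc : measurable (cell p' q) by exact: measurable_cell.
rewrite mxE /Rintegral null_set_integral//.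
  by apply/measurable_EFinP/measurable_funTS; exact: measurable_coord.
apply/eqP; rewrite -measure_le0 -M0; apply: le_measure; rewrite ?inE//.
  exact: measurable_cell.
exact: cell_subset.
Qed.

Lemma trunc_levy_jump1 p r q : 0 <= p -> p < q -> q <= r -> r <= T ->
  M (cell p r) = 1%E -> jump (trunc_levy s eps M) q =
  if q == (mark M (cell p r)).1 then (mark M (cell p r)).2 else 0.
Proof.
move=> p0 pq qr rT M1.
have mpr : measurable (cell p r) by exact: measurable_cell.
have [mC mD] : is_mark M (cell p r) (mark M (cell p r)).
  apply: markP => // B mB Bc; apply: MZ => // z /Bc; exact: cell_subset.
set m := mark _ _ in mC mD *.
have int p' i : p <= p' ->
    \int[M]_(z in cell p' q) z.2 ord0 i = (m \in cell p' q)%:R * m.2 ord0 i.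
  move=> pp'; have mc : measurable (cell p' q) by exact: measurable_cell.
  have mcd := measurable_coord i.
  rewrite /Rintegral (eq_measure_integral (\d_m)); last first.
    move=> B mB Bc; have := mD B mB; rewrite setIidl//.
    by apply: subset_trans Bc _; exact: cell_subset.
  rewrite integral_dirac//; last by apply/measurable_EFinP; exact: measurable_funTS.
move: (mC) => [/=]; rewrite in_itv/= => /andP[pm mr] em.
case: eqVneq => [qm|qm].
  apply: (trunc_levy_jump p0 pq qr rT) => p' i pp' p'q.
  rewrite int// mem_set ?mul1r//; split => //=.
  by rewrite in_itv/= -qm p'q lexx.
(* When the mark precedes [q], the approach to [q] starts at the mark, so that the half-open cells
   ending at [q] miss it. *)
pose p1 := if m.1 < q then m.1 else p.
have pp1 : p <= p1 by rewrite /p1; case: ifP => // _; exact: ltW.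
have p1q : p1 < q by rewrite /p1; case: ifP.
apply: (trunc_levy_jump (le_trans p0 pp1) p1q qr rT) => p' i p1p' p'q.
rewrite int ?(le_trans pp1)// mxE memNset ?mul0r// => -[/= + _].
rewrite in_itv/= => /andP[p'm mq].
have mq' : m.1 < q by rewrite lt_neqAle eq_sym qm.
by move: p1p'; rewrite /p1 mq' leNgt p'm.
Qed.

End trunc_levy_path.

Section path_payoff.
Context {R : realType} {n : nat}.
Variables (s : R) (hs : 0 < s < 1) (eps : R) (he : 0 < eps) (he1 : eps < 1).
Variables (T t : R) (D : set 'rV[R]_n) (b : R -> 'rV[R]_n -> 'rV[R]_n).
Variables (c f u : R -> 'rV[R]_n -> R) (K : R).
Variables (x : 'rV[R]_n) (X : R -> 'rV[R]_n) (Y Z : R -> R) (tau : nat -> R).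
Variable M : {measure set (R * 'rV[R]_n) -> \bar R}.
Variables (tk : nat -> R) (m : nat).
Hypotheses (t0 : 0 <= t) (tT : t <= T) (K0 : 0 <= K) (openD : open D).
Hypothesis bK : forall t x i, `|b t x ord0 i| <= K.
Hypothesis MZ : forall B, measurable B -> B `<=` cell eps 0 T ->
  M B = +oo%E \/ exists k : nat, M B = k%:R%:E.
Hypothesis Moo : (M (cell eps 0 T) < +oo)%E.
Hypothesis He : jump_adapted_euler D b c f T (trunc_levy s eps M) t x X Y Z tau.
Hypotheses (tk0 : tk 0%N = t) (tkm : tk m = T) (tkS : forall k, tk k <= tk k.+1).
Hypothesis good : forall k, (k < m)%N ->
  M (cell eps (tk k) (tk k.+1)) = 0%E \/ M (cell eps (tk k) (tk k.+1)) = 1%E.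

Local Notation J := (fun z => jump_state T D b c f z.1 z.2).
Local Notation Ch := (chain eps J (t, x, 1, 0) tk M).

(** With zero or one jump in each cell, the chain records exactly the jumps the scheme uses, namely
    those not later than the exit of the current flow. *)
Lemma chain_at_state k : (k <= m)%N ->
  at_state T t D b (trunc_levy s eps M) X Y Z tau (tk k) (Ch k).
Proof.
elim: k => [_|k ih km]; first by rewrite tk0; exact: at_state0 He.
have tk_le i j : (i <= j)%N -> tk i <= tk j.
  by move=> /subnKC <-; elim: (j - i)%N => [|l il]; rewrite ?addn0// addnS (le_trans il).
have kT : tk k.+1 <= T by rewrite -tkm; exact: tk_le.
have k0 : 0 <= tk k by rewrite (le_trans t0)// -tk0; exact: tk_le.
have := ih (ltnW km); rewrite [Ch k.+1]/=; set sg := Ch k => Hsg.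
have [M0|M1] := good km.
  rewrite M0 ifF; last by apply/negbTE; rewrite eq_sym onee_neq0.
  apply: (at_state_mono Hsg) => // q kq qk _.
  exact: (trunc_levy_jump0 hs he he1 MZ Moo k0 kq qk kT M0).
rewrite M1 eqxx.
have mc : measurable (cell (n := n) eps (tk k) (tk k.+1)) by exact: measurable_cell.
have [mC _] : is_mark M (cell eps (tk k) (tk k.+1)) (mark M (cell eps (tk k) (tk k.+1))).
  apply: markP => // B mB Bc; apply: MZ => // z /Bc; exact: cell_subset.
have jE q kq qk := trunc_levy_jump1 hs he he1 MZ Moo k0 kq qk kT M1 (q := q).
set mk := mark _ _ in mC jE *.
move: mC => [/=]; rewrite in_itv/= => /andP[kmk mkk] emk.
have mk2 : mk.2 != 0 by rewrite -enorm_gt0 (lt_trans he).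
have [mex|exm] := leP mk.1 (exit_of T D b sg).
  have jmk : jump (trunc_levy s eps M) mk.1 = mk.2 by rewrite jE// eqxx.
  rewrite [mk]surjective_pairing -jmk.
  apply: (at_state_jump tT He Hsg) => //; first by rewrite jmk.
  by move=> q kq qk qmk; rewrite jE// (negbTE qmk).
(* The jump comes after the exit, so the chain ignores it, and up to the exit the path does not
   jump. *)
rewrite /jump_state ifF; last by apply/negbTE; rewrite -ltNge.
apply: (at_state_mono Hsg) => // q kq qk qe; rewrite jE// ifF//.
by apply/negbTE; rewrite lt_eqF// (le_lt_trans qe).
Qed.

Lemma path_payoff : let th := stop_time D T t X in
  u th (X th) * Y th + Z th = flow_value T D b c f u T (Ch m).
Proof.
move=> th; apply: (at_state_end u tT K0 openD bK He).
by have := chain_at_state (leqnn m); rewrite tkm.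
Qed.

End path_payoff.

(** * Expectation of a limit of approximations *)

Section approx_expectation.
Context {R : realType} d (Omega : measurableType d) (P : probability Omega R).
Variables (Q : Omega -> R) (Qm : nat -> Omega -> R) (Bm : nat -> set Omega).
Variables (B v : R) (pm em : nat -> R).
Hypothesis Pc : measure_is_complete P.
Hypotheses (B0 : 0 <= B) (mQm : forall m, measurable_fun setT (Qm m)).
Hypothesis QmB : forall m w, `|Qm m w| <= B.
Hypothesis mB : forall m, measurable (Bm m).
Hypothesis PB : forall m, (P (Bm m) <= (pm m)%:E)%E.
Hypothesis pm0 : pm m @[m --> \oo] --> (0 : R).
Hypothesis QE : forall m w, ~ Bm m w -> Q w = Qm m w.
Hypothesis Qmv : forall m, `|\int[P]_w Qm m w - v| <= em m.

Let mBoo : measurable (\bigcap_m Bm m).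
Proof. exact: bigcap_measurable. Qed.

Lemma bad_null : P (\bigcap_m Bm m) = 0%E.
Proof.
apply/eqP; rewrite -measure_le0; apply/lee_addgt0Pr => e e0; rewrite add0e.
move/cvgrPdist_lt : pm0 => /(_ _ e0)[k _ /(_ k (leqnn k))]; rewrite sub0r normrN => pk.
apply: (@le_trans _ _ (P (Bm k))).
  by apply: le_measure; rewrite ?inE//; exact: bigcap_inf.
apply: le_trans (PB k) _; rewrite lee_fin; apply: le_trans (ltW pk); exact: ler_norm.
Qed.

(** Off each bad event [Q] equals a measurable function; the intersection of the bad events is null,
    and its subsets are measurable by completeness. *)
Lemma measurable_limit : measurable_fun setT Q.
Proof.
move=> _ A mA; rewrite setTI.
have -> : Q @^-1` A = (\bigcup_m (Qm m @^-1` A `\` Bm m)) `|` (Q @^-1` A `&` \bigcap_m Bm m).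
  apply/seteqP; split => w /=.
    move=> QA; have [Bw|/existsNP[m /not_implyP[_ Bw]]] := pselect ((\bigcap_m Bm m) w).
      by right.
    by left; exists m => //; split => //=; rewrite -QE.
  by case=> [[m _ [/= QA Bw]]|[]//]; rewrite (QE Bw).
apply: measurableU.
  apply: bigcup_measurable => m _; apply: measurableD => //.
  by rewrite -[X in measurable X]setTI; exact: mQm.
apply: Pc; exists (\bigcap_m Bm m); split; [exact: mBoo|exact: bad_null|exact: subIsetr].
Qed.

(** [Q] and its approximation differ only on the bad event, where both may be taken bounded by
    [B]. *)
Lemma approx_expectation m : (`|\int[P]_w (Q w)%:E - v%:E| <= (2 * B * pm m + em m)%:E)%E.
Proof.
(* Nothing bounds [Q] on the null set; clipping it there does not change the integral. *)
pose Q' w := Num.max (- B) (Num.min B (Q w)).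
have mQ' : measurable_fun setT Q' by apply: clip_measurable; exact: measurable_limit.
have Q'B w : `|Q' w| <= B by exact: clip_bound.
have iQ' := integrable_bounded_proba P mQ' Q'B.
have iQm := integrable_bounded_proba P (mQm m) (QmB m).
have -> : (\int[P]_w (Q w)%:E = \int[P]_w (Q' w)%:E)%E.
  apply: ae_eq_integral => //.
  - by apply/measurable_EFinP; exact: measurable_limit.
  - by apply/measurable_EFinP.
  exists (\bigcap_m Bm m); split => //; first exact: bad_null.
  move=> w /= H k _; apply: contrapT => Bw; apply: H => _.
  by rewrite /Q' clip_id// (QE Bw).
have fQ' : (\int[P]_w (Q' w)%:E)%E \is a fin_num by exact: integrable_fin_num.
rewrite -(fineK fQ') -EFinB abse_EFin lee_fin -/(Rintegral P setT Q').
have D1 : `|\int[P]_w Q' w - \int[P]_w Qm m w| <= 2 * B * pm m.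
  rewrite -RintegralB//.
  have mD : measurable_fun setT (fun w => Q' w - Qm m w) by exact: measurable_funB.
  have -> : \int[P]_w (Q' w - Qm m w) = \int[P]_(w in Bm m) (Q' w - Qm m w).
    rewrite [RHS]Rintegral_mkcond; apply: eq_Rintegral => w _; rewrite patchE.
    case: ifPn => // /negP Bw; rewrite /Q' (QE (m := m)).
      by rewrite clip_id// subrr.
    by move=> ?; apply: Bw; exact/mem_set.
  apply: Rintegral_le_cst => //; [exact: PB|exact: measurable_funTS|by rewrite mulr_ge0|move=> w _].
  apply: le_trans (ler_normB _ _) _.
  by have := Q'B w; have := QmB m w; lra.
rewrite -(subrK (\int[P]_w Qm m w) (\int[P]_w Q' w)) -addrA.
by apply: le_trans (ler_normD _ _) _; apply: lerD.
Qed.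

End approx_expectation.

(** * The error of the scheme *)

Lemma cvg_harmonic_cst (R : realType) (a : R) : a * harmonic m @[m --> \oo] --> (0 : R).
Proof.
by rewrite -[X in _ --> X](mulr0 a); apply: cvgM; [exact: cvg_cst|exact: cvg_harmonic].
Qed.

Section many_jumps.
Context {R : realType} {n : nat}.
Variables (s : R) (hs : 0 < s < 1) (eps : R) (he : 0 < eps) (T : R).
Context d (Omega : measurableType d) (P : probability Omega R).
Variables (F : R -> set (set Omega)) (N : R.-ker Omega ~> (R * 'rV[R]_n)%type).
Hypothesis hF : usual_conditions P T F.
Hypothesis hN : is_poisson_random_measure P (jump_space T) (levy_intensity s) N.
Hypothesis hNF : compatible_with_filtration P T F (jump_space T) N.

Local Notation lam := (levy_mass (n := n) hs he).
Local Notation cell := (cell (n := n) eps).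

Definition mesh (t h : R) (k : nat) : R := t + k%:R * h.

Lemma meshS t h k : mesh t h k.+1 - mesh t h k = h.
Proof. by rewrite /mesh -natr1; ring. Qed.

Lemma mesh_le t h k : 0 <= h -> mesh t h k <= mesh t h k.+1.
Proof. by move=> h0; rewrite -subr_ge0 meshS. Qed.

Lemma mesh_leq t h k l : 0 <= h -> (k <= l)%N -> mesh t h k <= mesh t h l.
Proof. by move=> h0 kl; rewrite /mesh lerD2l ler_wpM2r// ler_nat. Qed.

Definition many_jumps (tk : nat -> R) (k : nat) : set Omega :=
  ~` ([set w | N w (cell (tk k) (tk k.+1)) = 0%E] `|`
      [set w | N w (cell (tk k) (tk k.+1)) = 1%E]).

Lemma measurable_count B k : measurable B -> measurable [set w | N w B = k%:E].
Proof.
move=> mB; rewrite -[X in measurable X]setTI.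
by apply: (measurable_kernel N _ mB _ [set k%:E]).
Qed.

(** Union bound over the m cells. *)
Lemma mesh_many_jumps t h m : 0 <= t -> 0 <= h -> mesh t h m <= T ->
  measurable (\bigcup_(k < m) many_jumps (mesh t h) k) /\
  (P (\bigcup_(k < m) many_jumps (mesh t h) k) <= (m%:R * (h * lam) ^+ 2)%:E)%E.
Proof.
move=> t0 h0; have mm k : measurable (many_jumps (mesh t h) k).
  by apply/measurableC/measurableU; apply: measurable_count; exact: measurable_cell.
rewrite bigcup_mkord => mT; split; first exact: bigsetU_measurable.
elim: m mT => [_|m ih mT]; first by rewrite big_ord0 measure0 mul0r.
rewrite big_ord_recr /=; apply: le_trans (measureU2 _ _ _) _ => //.
  exact: bigsetU_measurable.
rewrite -natr1 mulrDl mul1r EFinD; apply: leeD.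
  by apply: ih; apply: le_trans mT; exact: mesh_le.
have := @prob_many_jumps _ _ _ hs _ he _ _ _ _ _ _ hF hN hNF (mesh t h m) (mesh t h m.+1).
rewrite meshS; apply => //; last exact: mesh_le.
by rewrite /mesh addr_ge0// mulr_ge0.
Qed.

Lemma count_ltoo w t h m : 0 <= h ->
  ~ (\bigcup_(k < m) many_jumps (mesh t h) k) w ->
  (N w (cell (mesh t h 0) (mesh t h m)) < +oo)%E.
Proof.
move=> h0; elim: m => [_|m ih Hm].
  have -> : cell (mesh t h 0) (mesh t h 0) = set0.
    apply/seteqP; split => // z [/= + _]; rewrite in_itv/= => /andP[z1 z2].
    by move: (lt_le_trans z1 z2); rewrite ltxx.
  by rewrite measure0 ltry.
have -> : cell (mesh t h 0) (mesh t h m.+1) =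
    cell (mesh t h 0) (mesh t h m) `|` cell (mesh t h m) (mesh t h m.+1).
  have m0 := mesh_leq t h0 (leq0n m); have m1 := mesh_le t m h0.
  apply/seteqP; split => z.
    move=> [/=]; rewrite in_itv/= => /andP[z1 z2] ez.
    by have [zm|mz] := leP z.1 (mesh t h m); [left|right]; split => //=; rewrite in_itv/= ?z1 ?mz.
  case=> -[/=]; rewrite in_itv/= => /andP[z1 z2] ez; split => //=; rewrite in_itv/=.
    by rewrite z1 (le_trans z2).
  by rewrite z2 (le_lt_trans m0).
have mc p q : measurable (cell p q) by exact: measurable_cell.
apply: le_lt_trans (measureU2 _ (mc _ _) (mc _ _)) _; apply: lte_add_pinfty.
  by apply: ih => -[k km Hk]; apply: Hm; exists k => //=; exact: ltnW.
have : ~ many_jumps (mesh t h) m w by move=> H; apply: Hm; exists m => //=.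
by rewrite /many_jumps => /notP[|] /= ->; rewrite ltry.
Qed.

(** An infinite count forces some cell of every mesh to contain several jumps, an event of
    probability at most (T [lam])^2 / (m + 1). *)
Lemma count_infinite : 0 <= T -> measurable [set w | N w (cell 0 T) = +oo%E] /\
  P [set w | N w (cell 0 T) = +oo%E] = 0%E.
Proof.
move=> T0; have mc : measurable (cell 0 T) by exact: measurable_cell.
have mI : measurable [set w | N w (cell 0 T) = +oo%E].
  rewrite -[X in measurable X]setTI.
  by apply: (measurable_kernel N _ mc _ [set +oo%E]).
split => //; apply/eqP; rewrite -measure_le0; apply/lee_addgt0Pr => e e0; rewrite add0e.
have /cvgrPdist_lt/(_ _ e0)[m _ /(_ m (leqnn m))] := cvg_harmonic_cst ((T * lam) ^+ 2).
rewrite sub0r normrN => me; pose h := T / m.+1%:R.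
have h0 : 0 <= h by rewrite divr_ge0.
have mT : mesh 0 h m.+1 = T by rewrite /mesh add0r mulrC divfK.
have mT' : mesh 0 h m.+1 <= T by rewrite mT.
have [mB PB] := mesh_many_jumps (lexx 0) h0 mT'.
apply: le_trans (le_trans (le_measure _ _ _ _) PB) _; rewrite ?inE//.
  move=> w /= Nw; apply: contrapT => /(count_ltoo h0).
  by rewrite mT {1}/mesh mul0r addr0 Nw ltxx.
rewrite lee_fin; apply: le_trans (ltW me); apply: le_trans (ler_norm _).
rewrite le_eqVlt; apply/orP; left; apply/eqP.
have : m.+1%:R != 0 :> R by rewrite pnatr_eq0.
by rewrite /h /harmonic /=; set Q := m.+1%:R => Q0; field.
Qed.

End many_jumps.

Section scheme.
Context {R : realType} {n : nat}.
Variables (s : R) (hs : 0 < s < 1) (eps : R) (he : 0 < eps) (he1 : eps < 1).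
Variables (T : R) (D : set 'rV[R]_n) (b : R -> 'rV[R]_n -> 'rV[R]_n).
Variables (c f u ut : R -> 'rV[R]_n -> R) (K a E : R).
Local Notation nu := (levy_measure (n := n) hs he).
Local Notation lam := (levy_mass (n := n) hs he).
Hypotheses (T0 : 0 < T) (K0 : 0 <= K) (a0 : 0 < a) (E0 : 0 <= E).
Hypothesis bK : forall t x i, `|b t x ord0 i| <= K.
Hypothesis bL : forall t r x y i,
  `|b r y ord0 i - b t x ord0 i| <= K * (`|r - t| + enorm (y - x)).
Hypothesis cK : forall t x, `|c t x| <= K.
Hypothesis cL : forall t r x y,
  `|c r y - c t x| <= K * (`|r - t| + enorm (y - x)).
Hypothesis fK : forall t x, `|f t x| <= K.
Hypothesis fL : forall t r x y,
  `|f r y - f t x| <= K * (`|r - t| + enorm (y - x)).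
Hypothesis uK : forall t x, `|u t x| <= K.
Hypothesis ud : forall t i x, derivable (u t) x (delta_mx ord0 i).
Hypothesis upK : forall t i x, `|partial i (u t) x| <= K.
Hypothesis upH : forall t i x h,
  `|partial i (u t) (x + h) - partial i (u t) x| <= K * enorm h `^ a.
Hypothesis uc : forall x, continuous (u ^~ x).
Hypothesis mu2 : measurable_fun setT (fun z : R * 'rV[R]_n => u z.1 z.2).
Hypothesis udt : forall t x, 0 < t < T -> D x ->
  is_derive t (1 : R) (u ^~ x) (ut t x).
Hypothesis gen : forall t x, 0 < t < T -> D x ->
  `|ut t x + \sum_(i < n) b t x ord0 i * partial i (u t) x + c t x * u t x
    + f t x + levy_increment u nu t x| <= E.
Hypotheses (openD : open D) (n_gt0 : (0 < n)%N).
Context d (Omega : measurableType d) (P : probability Omega R).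
Variables (F : R -> set (set Omega)) (N : R.-ker Omega ~> (R * 'rV[R]_n)%type).
Hypothesis hF : usual_conditions P T F.
Hypothesis hN : is_poisson_random_measure P (jump_space T) (levy_intensity s) N.
Hypothesis hNF : compatible_with_filtration P T F (jump_space T) N.
Variables (t : R) (x : 'rV[R]_n).
Hypotheses (t0 : 0 <= t) (tT : t <= T).
Variables (X : R -> Omega -> 'rV[R]_n) (Y Z : R -> Omega -> R).
Variable tau : nat -> Omega -> R.
Hypothesis hX : {ae P, forall w,
  jump_adapted_euler D b c f T (trunc_levy s eps (N w)) t x
    (X ^~ w) (Y ^~ w) (Z ^~ w) (tau ^~ w)}.

Local Notation J := (fun z => jump_state T D b c f z.1 z.2).
Local Notation s0 := (t, x, 1, 0).
Local Notation C := (expR (K * T) * flow_const (n := n) T K).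
Let h m : R := (T - t) / m.+1%:R.
Let tk m := mesh t (h m).
Let Ch m w k := chain eps J s0 (tk m) (N w) k.

Let lam_gt0 : 0 < lam.
Proof.
apply: lt_le_trans (levy_mass_ge hs he n_gt0).
have n2 : 0 < 2 * n%:R :> R by rewrite mulr_gt0// ltr0n.
apply: mulr_gt0; last exact: powR_gt0.
by apply: mulr_gt0; [exact: frac_const_gt0|exact: powR_gt0].
Qed.

Let h_ge0 m : 0 <= h m.
Proof. by rewrite divr_ge0// subr_ge0. Qed.

Let tk0 m : tk m 0 = t.
Proof. by rewrite /tk /mesh mul0r addr0. Qed.

Let tkm m : tk m m.+1 = T.
Proof. by rewrite /tk /mesh /h mulrC divfK// addrC subrK. Qed.

Let tk0_ge0 m : 0 <= tk m 0.
Proof. by rewrite tk0. Qed.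

Let tkS m k : tk m k <= tk m k.+1.
Proof. exact: mesh_le. Qed.

Let mJ : measurable_fun setT (J : state * (R * 'rV[R]_n) -> state).
Proof. exact: (measurable_jump_state T K0 bK bL cL fL openD n_gt0). Qed.

Let C_ge0 : 0 <= C.
Proof. by rewrite mulr_ge0 ?expR_ge0// flow_const_ge0. Qed.

Let reach0 m : reach T K t (tk m 0) s0.
Proof.
by rewrite tk0; split => /=; rewrite ?lexx// subrr mulr0 ?expR0 ?normr1 ?normr0.
Qed.

Let reachS m k (sg : @state R n) : tk m k.+1 <= T -> reach T K t (tk m k) sg ->
  reach T K t (tk m k.+1) sg.
Proof.
move=> _ [/andP[H1 H2] H3 H4]; split => //; rewrite H1 /=.
exact: le_trans H2 (tkS m k).
Qed.

Let reachJ m k (sg : @state R n) z : tk m k.+1 <= T -> reach T K t (tk m k) sg ->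
  tk m k < z.1 <= tk m k.+1 -> reach T K t (tk m k.+1) (J (sg, z)).
Proof.
move=> kT Hr /andP[z1 z2]; apply: (reach_jump D b K0 cK fK t0 Hr) => //.
by rewrite (ltW z1).
Qed.

Let measurable_age r : measurable_fun setT (age T D b r).
Proof.
apply: measurable_fun_ifT => //.
  by apply: measurable_fun_ltr => //; exact: (measurable_exit_of T K0 bK bL openD n_gt0).
apply: measurable_funB => //; apply: measurableT_comp => //; exact: measurableT_comp.
Qed.

Let age0 m : age T D b (tk m 0) s0 = 0.
Proof. by rewrite /age tk0 subrr if_same. Qed.

Let age_itv m k sg : tk m k <= T -> reach T K t (tk m k) sg ->
  0 <= age T D b (tk m k) sg <= T.
Proof.
move=> kT [/andP[H1 H2] _ _]; have HT := T0; have Ht := t0; rewrite /age.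
by case: ifP => _; apply/andP; split; lra.
Qed.

Let ageS m k sg : tk m k.+1 <= T -> reach T K t (tk m k) sg ->
  age T D b (tk m k.+1) sg <= age T D b (tk m k) sg + h m.
Proof.
move=> kT [/andP[H1 H2] _ _]; have h0 := h_ge0 m; have := meshS t (h m) k.
rewrite -/(tk m) /age => hE.
case: ifPn => [e1|_].
  have -> : tk m k < exit_of T D b sg by apply: le_lt_trans e1; exact: tkS.
  by lra.
by case: ifP => _; lra.
Qed.

Let ageJ m k sg z : tk m k.+1 <= T -> reach T K t (tk m k) sg ->
  tk m k < z.1 <= tk m k.+1 -> age T D b (tk m k.+1) (J (sg, z)) <= h m.
Proof.
move=> kT Hr /andP[z1 z2]; have h0 := h_ge0 m; have := meshS t (h m) k.
rewrite -/(tk m) /age /= => hE.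
case: ifP => // H; move: H; rewrite /jump_state; case: ifPn => [_ _ /=|].
  by lra.
rewrite -ltNge => ze; have := lt_le_trans ze z2.
by move=> /ltW; rewrite leNgt => /negbTE ->.
Qed.

Let V m k := flow_value T D b c f u (tk m k).

Let value_bound_ge0 : 0 <= value_bound T K.
Proof.
by rewrite addr_ge0// ?mulr_ge0 ?expR_ge0//; exact: ltW.
Qed.

Let V_bound m k sg : tk m k <= T -> reach T K t (tk m k) sg ->
  `|V m k sg| <= value_bound T K.
Proof.
move=> kT Hr; have [/andP[_ H2] _ _] := Hr.
exact: (flow_value_bound D b K0 cK fK uK t0 Hr kT H2).
Qed.

(** All of the one-step error except the age, divided by the step; it tends to C E as the mesh is
    refined. *)
Let err m : R := C * (h m + E) + h m * step_const (n := n) T K E lam.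

Let step m k sg : tk m k.+1 <= T -> reach T K t (tk m k) sg ->
  `|V m k.+1 sg - V m k sg + expR (- (h m * lam)) *
    \int[(lebesgue_measure \x nu)%E]_(z in `]tk m k, tk m k.+1]%classic `*` setT)
       (V m k.+1 (J (sg, z)) - V m k.+1 sg)| <=
  h m * (C * age T D b (tk m k) sg + err m).
Proof.
move=> kT Hr; have hE : tk m k.+1 - tk m k = h m by exact: meshS.
have x0 : 0 <= h m * lam by apply: mulr_ge0; [exact: h_ge0|exact: ltW].
have th01 : 0 <= expR (- (h m * lam)) <= 1.
  by rewrite expR_ge0 -[leRHS]expR0 ler_expR oppr_le0.
have thl : 1 - expR (- (h m * lam)) <= lam * (tk m k.+1 - tk m k).
  by rewrite hE; have := expR_ge1Dx (- (h m * lam)); lra.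
have nuT : nu setT = lam%:E by exact: levy_measureT.
have := one_step T0 K0 a0 E0 nuT bK bL cK cL fK fL uK ud upK upH uc mu2 udt gen
  openD n_gt0 t0 Hr (tkS m k) kT th01 thl.
rewrite hE => /le_trans; apply; rewrite /err le_eqVlt; apply/orP; left; apply/eqP.
ring.
Qed.

Let mean m : `|\int[P]_w V m m.+1 (Ch m w m.+1) - u t x| <=
  (T - t) * (C * (expR (lam * h m) / lam) + err m).
Proof.
have mT : tk m m.+1 <= T by rewrite tkm.
have -> : u t x = V m 0%N s0.
  rewrite /V tk0 /flow_value /exit_of /= min_l; last exact: exit_ge.
  by rewrite /payoff xlin_t /ylin /zlin subrr !mulr0 !addr0 mulr1.
have -> : T - t = m.+1%:R * h m by rewrite /h mulrC divfK.
rewrite -mulrA.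
apply: (mean_value hF hN hNF mJ (tk0_ge0 m) (tkS m) (reach0 m) (@reachS m) (@reachJ m)
  (h_ge0 m) (ltW T0) lam_gt0 (meshS t (h m)) (fun k => measurable_age (tk m k)) (age0 m)
  (@age_itv m) (@ageS m) (@ageJ m) value_bound_ge0 C_ge0) => //.
  by move=> k; exact: (measurable_flow_value T K0 bK bL cL fL mu2 openD n_gt0).
- exact: V_bound.
- exact: (@step m).
Qed.

Let pathQ w := let th := stop_time D T t (X ^~ w) in
  u th (X th w) * Y th w + Z th w.

(** The left side does not depend on the mesh, so the limit may be taken in the bound: bad events,
    the factor e^(lam h) - 1 and the h^2 terms disappear, leaving the age 1 / [lam] and [E]. *)
Lemma scheme_error :
  (`|\int[P]_w (pathQ w)%:E - (u t x)%:E| <= (T * (C * (lam^-1 + E)))%:E)%E.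
Proof.
have [Pc _ _ _ _] := hF; have HT := T0; have Ht := t0; have HE := E0.
have [N0 [mN0 PN0 HN0]] := hX.
have [mI PI] := count_infinite hs he hF hN hNF (ltW T0).
pose Z0 := N0 `|` [set w | N w (cell eps 0 T) = +oo%E].
have mZ0 : measurable Z0 by exact: measurableU.
have PZ0 : P Z0 = 0%E.
  by apply/eqP; rewrite -measure_le0; apply: le_trans (measureU2 _ mN0 mI) _; rewrite [X in (X + _)%E]PN0 [X in (_ + X)%E]PI adde0.
pose Bm m := Z0 `|` \bigcup_(k < m.+1) many_jumps eps N (tk m) k.
(* There are m + 1 cells, each containing several jumps with probability at most (h [lam])^2, with h
   = (T - t) / (m + 1). *)
pose pm m := ((T - t) * lam) ^+ 2 * harmonic m.
pose em m := (T - t) * (C * (expR (lam * h m) / lam) + err m).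
have bad m : measurable (\bigcup_(k < m.+1) many_jumps eps N (tk m) k) /\
    (P (\bigcup_(k < m.+1) many_jumps eps N (tk m) k) <= (pm m)%:E)%E.
  have mT : mesh t (h m) m.+1 <= T by rewrite -/(tk m) tkm.
  have [mB PB] := mesh_many_jumps hs he hF hN hNF t0 (h_ge0 m) mT; split => //.
  apply: le_trans PB _; rewrite lee_fin le_eqVlt; apply/orP; left; apply/eqP.
  have : m.+1%:R != 0 :> R by rewrite pnatr_eq0.
  by rewrite /pm /h /harmonic /=; set q := m.+1%:R => q0; field.
have mBm m : measurable (Bm m) by apply: measurableU => //; have [] := bad m.
have PBm m : (P (Bm m) <= (pm m)%:E)%E.
  have [mB PB] := bad m; apply: le_trans (measureU2 _ mZ0 mB) _.
  by rewrite [X in (X + _)%E]PZ0 add0e.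
have Chr m w : reach T K t (tk m m.+1) (Ch m w m.+1).
  apply: (chain_reach he hN (tk0_ge0 m) (tkS m) (reach0 m) (@reachS m) (@reachJ m)).
  by rewrite tkm.
have mQm m : measurable_fun setT (fun w => V m m.+1 (Ch m w m.+1)).
  apply: (measurableT_comp (measurable_flow_value T K0 bK bL cL fL mu2 openD n_gt0 (tk m m.+1))).
  have mT : tk m m.+1 <= T by rewrite tkm.
  exact: (measurable_chain he hF hN hNF _ mJ (tk0_ge0 m) (tkS m) mT).
have QmB m w : `|V m m.+1 (Ch m w m.+1)| <= value_bound T K.
  by apply: V_bound => //; rewrite tkm.
have QE m w : ~ Bm m w -> pathQ w = V m m.+1 (Ch m w m.+1).
  move=> Bw; rewrite /pathQ /V tkm.
  have N0w : ~ N0 w by move=> ?; apply: Bw; left; left.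
  have Iw : (N w (cell eps 0 T) < +oo)%E.
    by rewrite ltey; apply/eqP => ?; apply: Bw; left; right.
  have He : jump_adapted_euler D b c f T (trunc_levy s eps (N w)) t x
    (X ^~ w) (Y ^~ w) (Z ^~ w) (tau ^~ w).
    by apply: contrapT => H; apply: N0w; exact: HN0.
  have MZ B : measurable B -> B `<=` cell (n := n) eps 0 T ->
      N w B = +oo%E \/ exists k : nat, N w B = k%:R%:E.
    exact: (poisson_integer he hN w (lexx 0) (lexx T)).
  have gd k : (k < m.+1)%N -> N w (cell eps (tk m k) (tk m k.+1)) = 0%E \/
      N w (cell eps (tk m k) (tk m k.+1)) = 1%E.
    move=> km; have : ~ many_jumps eps N (tk m) k w by move=> H; apply: Bw; right; exists k.
    by move=> /notP.
  exact: (@path_payoff R n s hs eps he he1 T t D b c f u K x (X ^~ w) (Y ^~ w) (Z ^~ w)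
    (tau ^~ w) (N w) (tk m) m.+1 t0 tT K0 openD bK MZ Iw He (tk0 m) (tkm m) (tkS m) gd).
have pm0 : pm m @[m --> \oo] --> (0 : R) by exact: cvg_harmonic_cst.
have main m := approx_expectation Pc value_bound_ge0 mQm QmB mBm PBm pm0 QE mean m.
have h0 : h m @[m --> \oo] --> (0 : R) by exact: cvg_harmonic_cst.
have lim : 2 * value_bound T K * pm m + em m @[m --> \oo] -->
    2 * value_bound T K * 0 + (T - t) * (C * (expR (lam * 0) / lam) +
      (C * (0 + E) + 0 * step_const (n := n) T K E lam)).
  have h1 (g : R) : (cst g : nat -> R) m @[m --> \oo] --> g by exact: cvg_cst.
  apply: cvgD; first exact: cvgM (h1 _) pm0.
  apply: cvgM; first exact: h1.
  apply: cvgD.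
    apply: cvgM; first exact: h1.
    apply: cvgM; last exact: h1.
    by apply: continuous_cvg; [exact: continuous_expR|apply: cvgM; [exact: h1|exact: h0]].
  apply: cvgD; last by apply: cvgM; [exact: h0|exact: h1].
  by apply: cvgM; [exact: h1|apply: cvgD; [exact: h0|exact: h1]].
set I := (`|_|)%E in main *.
have I0 : (0 <= I)%E by exact: abse_ge0.
have Ifin : I \is a fin_num by rewrite ge0_fin_numE//; apply: le_lt_trans (main 0%N) (ltry _).
rewrite -(fineK Ifin) lee_fin.
have : fine I <= 2 * value_bound T K * 0 + (T - t) * (C * (expR (lam * 0) / lam) +
      (C * (0 + E) + 0 * step_const (n := n) T K E lam)).
  rewrite -(cvg_lim (@Rhausdorff R) lim); apply: limr_ge; first by apply/cvg_ex; eexists; exact: lim.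
  by apply: nearW => m; rewrite -lee_fin fineK.
move=> /le_trans; apply; rewrite !mulr0 expR0 mul0r addr0 add0r add0r div1r -mulrDr.
apply: ler_wpM2r; last lra.
by apply: mulr_ge0; [exact: C_ge0|apply: addr_ge0 => //; rewrite invr_ge0 ltW].
Qed.

End scheme.

(** * Extension of the data to all times *)

Section clamp.
Context {R : realType} (T : R).
Hypothesis T0 : 0 <= T.

(** The data are controlled on [0, T] only; composing them with this 1-Lipschitz retraction makes
    the bounds hold at every real time. *)
Definition clamp (r : R) : R := Num.max 0 (Num.min r T).

Lemma clamp_itv r : 0 <= clamp r <= T.
Proof. by rewrite /clamp le_max lexx ge_max T0 ge_min lexx orbT. Qed.

Lemma clamp_id r : 0 <= r <= T -> clamp r = r.
Proof. by move=> /andP[r0 rT]; rewrite /clamp min_l// max_r. Qed.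

Lemma clamp_lip r t : `|clamp r - clamp t| <= `|r - t|.
Proof.
wlog rt : r t / r <= t.
  by move=> H; have [|/ltW] := leP r t; [exact: H|rewrite distrC (distrC r); exact: H].
have a : clamp r <= clamp t.
  rewrite /clamp ge_max !le_max lexx/=; apply/orP; right.
  by rewrite le_min !ge_min rt lexx orbT.
have b : clamp t <= clamp r + (t - r).
  rewrite {1}/clamp ge_max; apply/andP; split.
    by have /andP[c0 _] := clamp_itv r; lra.
  have c : Num.min r T <= clamp r by rewrite /clamp le_max lexx orbT.
  have [rT|Tr] := leP r T.
    by rewrite min_l// in c; apply: (@le_trans _ _ t); [rewrite ge_min lexx|lra].
  rewrite min_r ?(ltW Tr)// in c; apply: (@le_trans _ _ T); last lra.
  by rewrite ge_min lexx orbT.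
by rewrite distrC (distrC r) !ger0_norm; lra.
Qed.

Lemma measurable_clamp : measurable_fun setT clamp.
Proof. by apply: measurable_maxr => //; exact: measurable_minr. Qed.

End clamp.

Section clamped.
Context {R : realType} {n : nat}.
Variables (T : R) (T0 : 0 < T).
Implicit Types (w : R -> 'rV[R]_n -> R) (t r : R) (x y : 'rV[R]_n).

Local Notation cl := (clamp T).

Lemma tau_itv t D b c f L x X Y Z tau : t <= T ->
  jump_adapted_euler (n := n) D b c f T L t x X Y Z tau ->
  forall i, t <= tau i <= T.
Proof.
move=> tT He; have /andP[tth thT] := stop_time_itv D X tT.
elim=> [|i /andP[ti iT]]; first by rewrite (euler_tau0 He) lexx tT.
rewrite -!lee_fin (tauSE tT He) le_min !ge_min !lee_fin tth thT orbT !andbT.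
by apply: le_trans (next_jump_ge _ _); rewrite lee_fin.
Qed.

(** The coefficients are evaluated at grid times, which all lie in [0, T]. *)
Lemma euler_clamp t D b c f L x X Y Z tau : 0 <= t <= T ->
  jump_adapted_euler (n := n) D b c f T L t x X Y Z tau ->
  jump_adapted_euler D (fun r => b (cl r)) (fun r => c (cl r)) (fun r => f (cl r))
    T L t x X Y Z tau.
Proof.
move=> /andP[t0 tT] He; have cli i : cl (tau i) = tau i.
  by have /andP[ti iT] := tau_itv tT He i; rewrite clamp_id// (le_trans t0).
by case: He => *; split => //; move=> i *; rewrite cli; eauto.
Qed.

Lemma lipschitz_clamp w : bounded_with_derivatives T w ->
  exists2 M : R, 0 <= M & (forall t x, `|w (cl t) x| <= M) /\
    forall t r x y, `|w (cl r) y - w (cl t) x| <= M * (`|r - t| + enorm (y - x)).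
Proof.
move=> /lipschitz_space_time [M M0 HM]; exists M => //.
have H t r x y := HM (cl t) (cl r) x y (clamp_itv (ltW T0) t) (clamp_itv (ltW T0) r).
split=> [t x|t r x y]; first by have [] := H t t x x.
have [_ /le_trans] := H t r x y; apply.
by rewrite ler_wpM2l// lerD2r clamp_lip// ltW.
Qed.

Lemma clamp_time_continuous u x : (forall t, 0 <= t <= T -> dt_derivable T u t x) ->
  continuous (fun t => u (cl t) x).
Proof.
move=> du t; apply/cvgrPdist_lt => e e0.
have [d d0 H] := dt_continuous (clamp_itv (ltW T0) t) (du _ (clamp_itv (ltW T0) t)) e0.
near=> r; rewrite distrC; apply: H; first exact/clamp_itv/ltW.
apply: le_lt_trans (clamp_lip (ltW T0) _ _) _; rewrite distrC.
by near: r; exists d.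
Unshelve. all: by end_near. Qed.

Lemma clamp_is_derive u t x : 0 < t < T -> dt_derivable T u t x ->
  is_derive t (1 : R) (fun r => u (cl r) x) (dt T u t x).
Proof.
move=> tT du; apply: near_eq_is_derive (dt_is_derive tT du).
move/andP: tT => [t0 tT]; near=> r; rewrite clamp_id//; apply/andP; split.
  by apply: ltW; near: r; exact: lt_nbhsr.
by apply: ltW; near: r; exact: lt_nbhsl.
Unshelve. all: by end_near. Qed.

Lemma measurable_clamp_time (u : R -> 'rV[R]_n -> R) :
  measurable_fun ([set t | 0 <= t <= T] `*` [set: 'rV[R]_n])
    (fun z : R * 'rV[R]_n => u z.1 z.2) ->
  measurable_fun setT (fun z : R * 'rV[R]_n => u (cl z.1) z.2).
Proof.
move=> mu.
have -> : (fun z : R * 'rV[R]_n => u (cl z.1) z.2) =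
  (fun z : R * 'rV[R]_n => u z.1 z.2) \o (fun z => (cl z.1, z.2)) by [].
apply: (measurable_comp _ _ mu).
- apply: measurableX => //.
  have -> : [set t : R | 0 <= t <= T] = `[0, T]%classic.
    by apply/seteqP; split => r /=; rewrite in_itv.
  exact: measurable_itv.
- by move=> _ [z _ <-]; split => //=; exact/clamp_itv/ltW.
- apply: measurable_fun_pair => //.
  by apply: (measurableT_comp (measurable_clamp T)); exact: measurable_fst.
Qed.

End clamped.

Theorem theorem3p1 (R : realType) (n : nat) (hn : (3 <= n)%N)
  (s : R) (hs : 0 < s < 1) (T : R) (hT : 0 < T)
  (D : set 'rV[R]_n) (hDopen : open D) (hDbounded : bounded_set D)
  (b : R -> 'rV[R]_n -> 'rV[R]_n) (c f : R -> 'rV[R]_n -> R)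
  (g : 'rV[R]_n -> R) (chi : R -> 'rV[R]_n -> R)
  (hb : forall i : 'I_n,
     bounded_with_derivatives T (fun t x => b t x ord0 i))
  (hc : bounded_with_derivatives T c)
  (hf : bounded_with_derivatives T f)
  (beta : R) (hbeta : Num.max (2 * s) 1 < beta < 2)
  (u : R -> 'rV[R]_n -> R)
  (hu : C1_holder_space T beta u)
  (husol : is_solution T D s b c f g chi u)
  (huniq : forall v : R -> 'rV[R]_n -> R,
     C1_holder_space T beta v -> is_solution T D s b c f g chi v ->
     forall (t : R) (x : 'rV[R]_n), 0 <= t <= T -> v t x = u t x)
  (d : measure_display) (Omega : measurableType d) (P : probability Omega R)
  (F : R -> set (set Omega)) (hF : usual_conditions P T F)
  (N : R.-ker Omega ~> (R * 'rV[R]_n)%type)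
  (hN : is_poisson_random_measure P (jump_space T) (levy_intensity s) N)
  (hNF : compatible_with_filtration P T F (jump_space T) N) :
  exists C1 C2 : R,
    forall (eps : R) (heps : 0 < eps < 1)
      (t : R) (ht : 0 <= t <= T) (x : 'rV[R]_n) (hx : D x)
      (X : R -> Omega -> 'rV[R]_n) (Y Z : R -> Omega -> R)
      (tau : nat -> Omega -> R)
      (hX : {ae P, forall w,
         jump_adapted_euler D b c f T (trunc_levy s eps (N w)) t x
           (X ^~ w) (Y ^~ w) (Z ^~ w) (tau ^~ w)}),
    let theta w := stop_time D T t (X ^~ w) in
    (`| 'E_P[fun w => (u (theta w) (X (theta w) w) * Y (theta w) w
                       + Z (theta w) w)%R] - (u t x)%:E |
     <= (C1 * eps `^ (2 * s) + C2 * eps `^ (beta - 2 * s))%R%:E)%E.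
Proof.
have n0 : (0 < n)%N by exact: ltn_trans hn.
have T0 := ltW hT; have cli := clamp_itv T0.
move: hbeta; rewrite gt_max => /andP[/andP[b2s b1] b2].
have b12 : 1 < beta < 2 by rewrite b1.
have [HS Hdt] := hu; have [mu _ _] := HS.
have [pde _ _] := husol.
have [Ku Ku0 HKu] := holder_spaceP n0 T0 b12 HS.
have [Kc Kc0 [HcK HcL]] := lipschitz_clamp hT hc.
have [Kf Kf0 [HfK HfL]] := lipschitz_clamp hT hf.
have /choice[Kb HKb] : forall i : 'I_n, exists M : R, 0 <= M /\
    ((forall t x, `|b (clamp T t) x ord0 i| <= M) /\
     forall t r x y, `|b (clamp T r) y ord0 i - b (clamp T t) x ord0 i| <=
       M * (`|r - t| + enorm (y - x))).
  by move=> i; have [M M0 HM] := lipschitz_clamp hT (hb i); exists M.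
(* A single constant for all the bounds, which does not involve [eps]. *)
pose K := Ku + Kc + Kf + \sum_(i < n) Kb i.
have Kb0 : 0 <= \sum_(i < n) Kb i by apply: sumr_ge0 => i _; have [] := HKb i.
have K0 : 0 <= K by rewrite !addr_ge0.
have KuK : Ku <= K by rewrite /K; lra.
have KcK : Kc <= K by rewrite /K; lra.
have KfK : Kf <= K by rewrite /K; lra.
have KbK i : Kb i <= K.
  have : Kb i <= \sum_(i < n) Kb i.
    rewrite (bigD1 i)//= lerDl; apply: sumr_ge0 => j _; by have [] := HKb j.
  by rewrite /K; lra.
have d0 (t r : R) (x y : 'rV[R]_n) : 0 <= `|r - t| + enorm (y - x).
  by rewrite addr_ge0 ?enorm_ge0.
have [K1 K10 HK1] := @frac_laplacian_error R n s hs beta b2s.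
pose Cc := expR (K * T) * flow_const (n := n) T K.
have Cc0 : 0 <= Cc by rewrite mulr_ge0 ?expR_ge0// flow_const_ge0.
pose A0 := @frac_const R n s * (2 * n%:R) `^ (- (n%:R + 2 * s)).
have A00 : 0 < A0.
  by apply: mulr_gt0; [exact: frac_const_gt0|apply/powR_gt0/mulr_gt0 => //; rewrite ltr0n].
(* The first constant comes from 1 / [lam] <= [eps]^(2s) / [A0], the second from E = K1 n K
   [eps]^(beta - 2s), where n K is the Taylor constant of [u]. *)
exists (T * (Cc * A0^-1)), (T * (Cc * (K1 * (n%:R * K)))).
move=> eps heps t ht x hx X Y Z tau hX; pose theta w := stop_time D T t (X ^~ w).
suff : (`| 'E_P[fun w => (u (theta w) (X (theta w) w) * Y (theta w) w
                       + Z (theta w) w)%R] - (u t x)%:E |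
     <= (T * (Cc * A0^-1) * eps `^ (2 * s) +
         T * (Cc * (K1 * (n%:R * K))) * eps `^ (beta - 2 * s))%R%:E)%E by [].
have /andP[he he1] := heps; have /andP[t0 tT] := ht.
pose E := K1 * (n%:R * K) * eps `^ (beta - 2 * s).
have E0 : 0 <= E by rewrite !mulr_ge0 ?powR_ge0.
have a0 : 0 < beta - 1 by rewrite subr_gt0.
have ud r i y : derivable (u (clamp T r)) y (delta_mx ord0 i).
  by have [_ H _ _] := HKu _ (cli r).
have upK r i y : `|partial i (u (clamp T r)) y| <= K.
  by have [_ _ H _] := HKu _ (cli r); exact: le_trans (H i y) KuK.
have upH r i y v : `|partial i (u (clamp T r)) (y + v) - partial i (u (clamp T r)) y| <=
    K * enorm v `^ (beta - 1).
  have [_ _ _ H] := HKu _ (cli r); apply: le_trans (H i y v) _.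
  by rewrite ler_wpM2r ?powR_ge0.
have uK r y : `|u (clamp T r) y| <= K.
  by have [H _ _ _] := HKu _ (cli r); exact: le_trans (H y) KuK.
have muc := measurable_clamp_time hT mu.
have ut r : measurable_fun setT (u (clamp T r)).
  have -> : u (clamp T r) = (fun z : R * 'rV[R]_n => u (clamp T z.1) z.2) \o pair r by [].
  by apply: measurableT_comp => //; exact: measurable_pair1.
have gen r y : 0 < r < T -> D y ->
    `|dt T u r y + \sum_(i < n) b (clamp T r) y ord0 i * partial i (u (clamp T r)) y
      + c (clamp T r) y * u (clamp T r) y + f (clamp T r) y
      + levy_increment (fun q => u (clamp T q)) (levy_measure hs he) r y| <= E.
  move=> /andP[r0 rT] Dy; have clr : clamp T r = r by rewrite clamp_id// !ltW.
  have r0T : 0 <= r < T by rewrite (ltW r0).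
  have [_ cpv _ eq0] := pde r y r0T Dy.
  pose v := u (clamp T r); have vE : u r = v by rewrite /v clr.
  rewrite vE in cpv eq0; rewrite /levy_increment -/v clr.
  (* By the equation the local terms add up to the fractional Laplacian, so that only its truncation
     error remains. *)
  have -> : dt T u r y + \sum_(i < n) b r y ord0 i * partial i v y +
      c r y * v y + f r y = frac_laplacian s v y.
    by apply/eqP; rewrite -subr_eq0 -[X in _ == X]eq0; apply/eqP; ring.
  (* The first-order Taylor term, odd in [z]. *)
  pose L (z : 'rV[R]_n) := \sum_(i < n) z ord0 i * partial i v y.
  apply: (HK1 _ L y eps K (n%:R * K)) => //.
  - exact: ut.
  - exact: uK.
  - apply: measurable_sum => i; apply: measurable_funM => //.
    exact: measurable_rV_coord.
  - by move=> z; rewrite /L -sumrN; apply: eq_bigr => i _; rewrite mxE mulNr.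
  - move=> rr; exists (\sum_(i < n) rr * K) => z zr.
    apply: le_trans (ler_norm_sum _ _ _) _; apply: ler_sum => i _.
    rewrite normrM; apply: ler_pM => //; last exact: upK.
    exact: le_trans (ler_coord_enorm _ _) zr.
  - by rewrite mulr_ge0.
  - move=> z; have := taylor_of_holder z (ltW a0) K0 (ud r) (fun i v => upH r i y v).
    by rewrite subrK.
have hX' : {ae P, forall w,
    jump_adapted_euler D (fun r => b (clamp T r)) (fun r => c (clamp T r))
      (fun r => f (clamp T r)) T (trunc_levy s eps (N w)) t x
      (X ^~ w) (Y ^~ w) (Z ^~ w) (tau ^~ w)}.
  by apply: filterS hX => w; exact: euler_clamp.
have udt r y : 0 < r < T -> D y ->
    is_derive r (1 : R) (fun q => u (clamp T q) y) (dt T u r y).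
  move=> rT _; apply: clamp_is_derive => //; have [H _ _] := Hdt y; apply: H.
  by move/andP: rT => [? ?]; rewrite !ltW.
have uc y : continuous (fun q => u (clamp T q) y).
  by apply: clamp_time_continuous => //; have [H _ _] := Hdt y.
have bK r y i : `|b (clamp T r) y ord0 i| <= K.
  by have [_ [H _]] := HKb i; exact: le_trans (H r y) (KbK i).
have bL r q y z i : `|b (clamp T q) z ord0 i - b (clamp T r) y ord0 i| <=
    K * (`|q - r| + enorm (z - y)).
  by have [_ [_ H]] := HKb i; apply: le_trans (H r q y z) _; rewrite ler_wpM2r.
have cK r y : `|c (clamp T r) y| <= K by exact: le_trans (HcK r y) KcK.
have fK r y : `|f (clamp T r) y| <= K by exact: le_trans (HfK r y) KfK.
have cL r q y z : `|c (clamp T q) z - c (clamp T r) y| <=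
    K * (`|q - r| + enorm (z - y)).
  by apply: le_trans (HcL r q y z) _; rewrite ler_wpM2r.
have fL r q y z : `|f (clamp T q) z - f (clamp T r) y| <=
    K * (`|q - r| + enorm (z - y)).
  by apply: le_trans (HfL r q y z) _; rewrite ler_wpM2r.
have := scheme_error he1 hT K0 a0 E0 bK bL cK cL fK fL uK ud upK upH uc muc udt gen
  hDopen n0 hF hN hNF t0 tT hX'.
rewrite unlock (clamp_id ht) => main.
have -> : (\int[P]_w (u (theta w) (X (theta w) w) * Y (theta w) w + Z (theta w) w)%:E =
    \int[P]_w (u (clamp T (theta w)) (X (theta w) w) * Y (theta w) w + Z (theta w) w)%:E)%E.
  apply: eq_integral => w _; rewrite (@clamp_id _ T (theta w))//.
  have /andP[H1 H2] := stop_time_itv D (X ^~ w) tT.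
  by rewrite (le_trans t0 H1).
apply: le_trans main _; rewrite lee_fin.
have lamA := levy_mass_ge hs he n0; rewrite -/A0 powRN in lamA.
have e2s : 0 < eps `^ (2 * s) by exact: powR_gt0.
have lam0 : 0 < A0 / eps `^ (2 * s) by rewrite divr_gt0.
have lamV : (levy_mass (n := n) hs he)^-1 <= A0^-1 * eps `^ (2 * s).
  rewrite -[X in _ <= _ * X]invrK -invfM lef_pV2// posrE//.
  exact: lt_le_trans lamA.
rewrite /E -!mulrA -mulrDr ler_wpM2l//.
rewrite -!mulrDr; apply: ler_wpM2l; first exact: expR_ge0.
by apply: ler_wpM2l; [exact: flow_const_ge0|rewrite lerD2r].
Qed.
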